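(* Let $\mathbb G$ be a group of Heisenberg type with logarithmic coordinates $(z,\sigma)\in\mathbb R^m\times\mathbb R^k$ and horizontal Laplacian $\mathscr L$. For every $0<s<1$, the heat kernel with pole at the origin of the operator $\mathfrak L_{(s)}-\partial_t$, where $$\mathfrak L_{(s)}U=\partial_{yy}U+\frac{1-2s}{y}\,\partial_yU+\frac{y^2}{4}\Delta_\sigma U+\mathscr L U ,\qquad (z,\sigma)\in\mathbb G,\ y>0,$$ is given by $$\mathfrak q_{(s)}((z,\sigma),t,y)=\frac{2^k}{(4\pi t)^{\frac m2+k+1-s}}\int_{\mathbb R^k}e^{-\frac it\langle\sigma,\lambda\rangle}\left(\frac{|\lambda|}{\sinh|\lambda|}\right)^{\frac m2+1-s}e^{-\frac{|z|^2+y^2}{4t}\frac{|\lambda|}{\tanh|\lambda|}}\,d\lambda .$$ That is: (i) $\mathfrak L_{(s)}\mathfrak q_{(s)}-\partial_t\mathfrak q_{(s)}=0$ for $(z,\sigma)\in\mathbb R^m\times\mathbb R^k$, $y>0$, $t>0$; and (ii) for every $\varphi\in\mathscr S(\mathbb R^m\times\mathbb R^k\times[0,\infty))$, $$\lim_{t\to0^+}\int_{\mathbb R^m\times\mathbb R^k\times(0,\infty)}\mathfrak q_{(s)}((z,\sigma),t,y)\,\varphi(z,\sigma,y)\,d\mu=\varphi(0,0,0),\qquad d\mu=\frac{2\pi^{1-s}}{\Gamma(1-s)}\,y^{1-2s}\,dy\,d\sigma\,dz .$$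
   Context: A Carnot group of step two $\mathbb G$ is a simply connected Lie group whose Lie algebra $\mathfrak g=V_1\oplus V_2$ carries an inner product $\langle\cdot,\cdot\rangle$ and satisfies $[V_1,V_1]=V_2$, $[V_1,V_2]=\{0\}$. Put $m=\dim V_1$, $k=\dim V_2$, and fix orthonormal bases $\{e_1,\dots,e_m\}$ of $V_1$ and $\{\varepsilon_1,\dots,\varepsilon_k\}$ of $V_2$; via the exponential map points of $\mathbb G$ are identified with their logarithmic coordinates $(z,\sigma)\in\mathbb R^m\times\mathbb R^k$. The Kaplan map $J:V_2\to\operatorname{End}(V_1)$ is defined by $\langle J(\sigma)z,\zeta\rangle=\langle[z,\zeta],\sigma\rangle$; each $J(\sigma)$ is skew-symmetric. $\mathbb G$ is of Heisenberg type if $J(\sigma)^2=-|\sigma|^2I_{V_1}$ for all $\sigma\in V_2$. The horizontal Laplacian is $\mathscr L=\sum_{j=1}^mX_j^2$ with $X_j=\partial_{z_j}+\frac12\sum_{\ell=1}^k\langle J(\varepsilon_\ell)z,e_j\rangle\partial_{\sigma_\ell}$; in a group of Heisenberg type it equals $$\mathscr L=\Delta_z+\frac{|z|^2}{4}\Delta_\sigma+\sum_{\ell=1}^k\Theta_\ell\,\partial_{\sigma_\ell},\qquad \Theta_\ell=\sum_{i=1}^m\langle J(\varepsilon_\ell)z,e_i\rangle\,\partial_{z_i}.$$ The functions $|\lambda|/\sinh|\lambda|$ and $|\lambda|/\tanh|\lambda|$ are taken equal to $1$ at $\lambda=0$. $\mathscr S(\mathbb R^m\times\mathbb R^k\times[0,\infty))$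 denotes the Schwartz functions on the closed half-space (restrictions of Schwartz functions on $\mathbb R^{m+k+1}$). *)

(* Defs.v *)
(* Built on MathComp-Analysis, with R an arbitrary [realType] and R[i] the
   complex numbers of mathcomp-real-closed. *)
From HB Require Import structures.
From mathcomp Require Import all_boot all_order all_algebra.
From mathcomp Require Import all_classical all_reals all_analysis.
From mathcomp Require Export complex.

Set Implicit Arguments.
Unset Strict Implicit.
Unset Printing Implicit Defensive.
Import Order.TTheory GRing.Theory Num.Theory.
Import numFieldNormedType.Exports.

Local Open Scope classical_set_scope.
Local Open Scope ring_scope.
Local Open Scope complex_scope.

Section LieAlgebra.
Context {R : realType} {g : vectType R}.
Implicit Types (br : {bilinear g -> g -> g}) (ip : {dot g for idfun}).
Implicit Types V W : {vspace g}.

Definition lie_bracket br :=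
  (forall x, br x x = 0) /\
  (forall x y z, br x (br y z) + br y (br z x) + br z (br x y) = 0).

Definition bracketv br V W : {vspace g} :=
  <<[seq br x y | x <- vbasis V, y <- vbasis W]>>%VS.

Definition carnot_step_two br V1 V2 :=
  [/\ lie_bracket br,
      (V1 + V2 = fullv)%VS /\ (V1 :&: V2 = 0)%VS,
      bracketv br V1 V1 = V2
    & bracketv br V1 V2 = 0%VS].

Definition orthonormal_basis ip V n (e : n.-tuple (subvs_of V)) :=
  basis_of fullv e /\
  forall i j, ip (vsval (tnth e i)) (vsval (tnth e j)) = (i == j)%:R.

Definition kaplan_map br ip V1 V2 (J : subvs_of V2 -> 'End(subvs_of V1)) :=
  forall (sigma : subvs_of V2) (z zeta : subvs_of V1),
    ip (vsval (J sigma z)) (vsval zeta) =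
    ip (br (vsval z) (vsval zeta)) (vsval sigma).

Definition heisenberg_type ip V1 V2 (J : subvs_of V2 -> 'End(subvs_of V1)) :=
  forall sigma,
    (J sigma \o J sigma)%VF = - (ip (vsval sigma) (vsval sigma)) *: \1%VF.

End LieAlgebra.

(* The library norm on 'rV[R]_n is the sup norm. *)
Definition dotrv (R : realType) n (u v : 'rV[R]_n) : R :=
  \sum_(i < n) u 0 i * v 0 i.
Definition enorm (R : realType) n (u : 'rV[R]_n) : R := Num.sqrt (dotrv u u).

Section LebesgueMeasure.
Context {R : realType}.

Let T := measurableTypeR R.

Let cons_pair n (p : T * n.-tuple T) : n.+1.-tuple T := [tuple of p.1 :: p.2].

Let measurable_cons_pair n : measurable_fun setT (@cons_pair n).
Proof. exact: measurable_cons. Qed.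

Section step.
Variables (n : nat) (mu : {sigma_finite_measure set n.-tuple T -> \bar R}).

Definition cons_measure : set (n.+1.-tuple T) -> \bar R :=
  pushforward (@lebesgue_measure R \x mu)%E (@cons_pair n).

HB.instance Definition _ := Measure.copy cons_measure
  (measure_function_pushforward__canonical__measure_function_Measure
     (@lebesgue_measure R \x mu)%E (@measurable_cons_pair n)).

Let cons_measure_sigma_finite : sigma_finite setT cons_measure.
Proof.
have /sigma_finiteP[F [FT ndF Foo]] := sigma_finiteT (@lebesgue_measure R).
have /sigma_finiteP[G [GT ndG Goo]] := sigma_finiteT mu.
pose u (t : n.+1.-tuple T) : T * n.-tuple T := (thead t, [tuple of behead t]).
have mu_ : measurable_fun setT u.
  apply: measurable_fun_pair; last exact: measurable_behead.
  exact: measurable_tnth.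
have uK : u \o @cons_pair n = id.
  by apply/funext => -[x t]; rewrite /u /cons_pair/=; congr pair; exact/val_inj.
exists (fun i => u @^-1` (F i `*` G i)).
  rewrite -preimage_bigcup -[LHS](preimage_setT u); congr (u @^-1` _).
  apply/esym/seteqP; split => // -[x t] _.
  have [i _ Fx] : (\bigcup_i F i) x by rewrite -FT.
  have [j _ Gt] : (\bigcup_j G j) t by rewrite -GT.
  exists (maxn i j) => //; split => /=.
    exact: (subsetPset _ _ (ndF _ _ (leq_maxl i j))).
  exact: (subsetPset _ _ (ndG _ _ (leq_maxr i j))).
move=> i; have [mF Fi] := Foo i; have [mG Gi] := Goo i.
have mFG : measurable (F i `*` G i) by exact: measurableX.
split; first by rewrite -[X in measurable X]setTI; exact: mu_.
rewrite /cons_measure /pushforward -comp_preimage uK preimage_id.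
by rewrite product_measure1E// lte_mul_pinfty// ge0_fin_numE.
Qed.

HB.instance Definition _ := Measure_isSigmaFinite.Build _ _ _
  cons_measure cons_measure_sigma_finite.

End step.

(* Lebesgue measure on R^n, the n-fold product of [lebesgue_measure], carried
   by the library's product sigma-algebra on n-tuples. *)
Fixpoint lebesgue_rn n : {sigma_finite_measure set n.-tuple T -> \bar R} :=
  match n with
  | 0 => dirac [tuple]
  | n.+1 => cons_measure (lebesgue_rn n)
  end.

End LebesgueMeasure.

Definition rv_of (R : realType) n (t : n.-tuple (measurableTypeR R)) :
  'rV[R]_n := \row_i tnth t i.

Section ComplexIntegral.
Context d (T : measurableType d) (R : realType).
Variable mu : {measure set T -> \bar R}.
Implicit Types (D : set T) (f : T -> R[i]).

Definition cintegrable D f :=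
  mu.-integrable D (EFin \o (@complex.Re R \o f)) /\
  mu.-integrable D (EFin \o (@complex.Im R \o f)).

Definition cintegral D f : R[i] :=
  (\int[mu]_(x in D) complex.Re (f x)) +i*
  (\int[mu]_(x in D) complex.Im (f x)).

End ComplexIntegral.

Section Coordinates.
Context {R : realType} {m k : nat}.

(* The point (z, sigma, y) of R^m x R^k x R. *)
Definition pt := ('rV[R]_m * 'rV[R]_k * R)%type.

Definition coordinate := ('I_m + 'I_k + unit)%type.
Definition cz (i : 'I_m) : coordinate := inl (inl i).
Definition cs (l : 'I_k) : coordinate := inl (inr l).
Definition cy : coordinate := inr tt.

Definition coordv (i : coordinate) (x : pt) : R :=
  match i with
  | inl (inl j) => x.1.1 0 j
  | inl (inr l) => x.1.2 0 l
  | inr _ => x.2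
  end.

Definition dirv (i : coordinate) : pt :=
  match i with
  | inl (inl j) => (delta_mx 0 j, 0, 0)
  | inl (inr l) => (0, delta_mx 0 l, 0)
  | inr _ => (0, 0, 1)
  end.

Definition cpartial (i : coordinate) (f : pt -> R[i]) (x : pt) : R[i] :=
  ('D_(dirv i) (@complex.Re R \o f) x) +i* ('D_(dirv i) (@complex.Im R \o f) x).

Definition cderivable (i : coordinate) (f : pt -> R[i]) (x : pt) :=
  derivable (@complex.Re R \o f) x (dirv i) /\
  derivable (@complex.Im R \o f) x (dirv i).

Definition cdifferentiable (f : pt -> R[i]) (x : pt) :=
  differentiable (@complex.Re R \o f) x /\
  differentiable (@complex.Im R \o f) x.

(* [ds] lists the coordinates of the successive partial derivatives. *)
Definition iter_cpartial (ds : seq coordinate) (f : pt -> R[i]) : pt -> R[i] :=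
  foldr cpartial f ds.

Definition schwartz (f : pt -> R[i]) :=
  (forall ds x, cdifferentiable (iter_cpartial ds f) x) /\
  (forall (a : coordinate -> nat) ds, exists C : R, forall x : pt,
     `|(\prod_i coordv i x ^+ a i)%:C * iter_cpartial ds f x| <= C%:C).

Definition schwartz_halfspace (phi : pt -> R[i]) :=
  exists2 psi, schwartz psi & forall x : pt, 0 <= x.2 -> phi x = psi x.

Section Operator.
Context {g : vectType R} (ip : {dot g for idfun}) (V1 V2 : {vspace g}).
Variables (J : subvs_of V2 -> 'End(subvs_of V1)).
Variables (e : m.-tuple (subvs_of V1)) (eps : k.-tuple (subvs_of V2)).
Implicit Type U : pt -> R[i].

Definition zvec (z : 'rV[R]_m) : subvs_of V1 := \sum_(i < m) z 0 i *: tnth e i.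

Definition horizontal_field (j : 'I_m) U (x : pt) : R[i] :=
  cpartial (cz j) U x +
  2^-1 * \sum_(l < k)
    (ip (vsval (J (tnth eps l) (zvec x.1.1))) (vsval (tnth e j)))%:C
    * cpartial (cs l) U x.

Definition horizontal_laplacian U (x : pt) : R[i] :=
  \sum_(j < m) horizontal_field j (horizontal_field j U) x.

Definition extension_operator (s : R) U (x : pt) : R[i] :=
  cpartial cy (cpartial cy U) x
  + ((1 - 2 * s) / x.2)%:C * cpartial cy U x
  + (x.2 ^+ 2 / 4)%:C * \sum_(l < k) cpartial (cs l) (cpartial (cs l) U) x
  + horizontal_laplacian U x.

(* [q t x] is the value at time t and point x. *)
Definition ctime_derivable (q : R -> pt -> R[i]) (t : R) (x : pt) :=
  derivable (fun r => complex.Re (q r x)) t 1 /\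
  derivable (fun r => complex.Im (q r x)) t 1.

Definition ctime_derivative (q : R -> pt -> R[i]) (t : R) (x : pt) : R[i] :=
  (derive1 (fun r => complex.Re (q r x)) t)
  +i* (derive1 (fun r => complex.Im (q r x)) t).

(* 'D_v and derive1 are total, so the existence of the derivatives is stated
   alongside the equation. *)
Definition solves_extension_heat (s : R) (q : R -> pt -> R[i]) :=
  forall t (x : pt), 0 < t -> 0 < x.2 ->
  [/\ ctime_derivable q t x,
      forall i, cderivable i (q t) x,
      forall i j, cderivable i (cpartial j (q t)) x
    & extension_operator s (q t) x - ctime_derivative q t x = 0].

End Operator.

Definition sinh (r : R) : R := (expR r - expR (- r)) / 2.
Definition cosh (r : R) : R := (expR r + expR (- r)) / 2.
Definition tanh (r : R) : R := sinh r / cosh r.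

Definition over_sinh (r : R) : R := if r == 0 then 1 else r / sinh r.
Definition over_tanh (r : R) : R := if r == 0 then 1 else r / tanh r.

Definition expi (r : R) : R[i] := cos r +i* sin r.

Definition kernel_integrand (s t : R) (x : pt) (lambda : 'rV[R]_k) : R[i] :=
  let r := enorm lambda in
  expi (- (t^-1 * dotrv x.1.2 lambda))
  * (over_sinh r `^ (m%:R / 2 + 1 - s))%:C
  * (expR (- ((enorm x.1.1 ^+ 2 + x.2 ^+ 2) / (4 * t) * over_tanh r)))%:C.

Definition q_kernel (s t : R) (x : pt) : R[i] :=
  (2 ^+ k / (4 * pi * t) `^ (m%:R / 2 + k%:R + 1 - s))%:C
  * cintegral (lebesgue_rn k) setT (kernel_integrand s t x \o @rv_of R k).

Definition Gamma (a : R) : R :=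
  \int[@lebesgue_measure R]_(u in `]0, +oo[) (u `^ (a - 1) * expR (- u)).

(* Lebesgue measure on R^m x R^k x R, and the open half-space y > 0 in it. *)
Definition pt_measure := (lebesgue_rn m \x lebesgue_rn k \x @lebesgue_measure R)%E.

Definition halfspace :
  set (m.-tuple (measurableTypeR R) * k.-tuple (measurableTypeR R) * measurableTypeR R) :=
  [set p | 0 < p.2].

Definition pt_of (p : m.-tuple (measurableTypeR R) * k.-tuple (measurableTypeR R) *
                      measurableTypeR R) : pt :=
  (rv_of p.1.1, rv_of p.1.2, p.2).

Definition mu_density (s : R) (x : pt) : R :=
  2 * pi `^ (1 - s) / Gamma (1 - s) * x.2 `^ (1 - 2 * s).

Definition tested_integrand (s : R) (q : R -> pt -> R[i]) (phi : pt -> R[i])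
    (t : R) (x : pt) : R[i] :=
  q t x * phi x * (mu_density s x)%:C.

(* Convergence in R[i] is componentwise. *)
Definition initial_dirac (s : R) (q : R -> pt -> R[i]) :=
  forall phi, schwartz_halfspace phi ->
  (forall t, 0 < t ->
     cintegrable pt_measure halfspace (tested_integrand s q phi t \o pt_of)) /\
  let I t := cintegral pt_measure halfspace (tested_integrand s q phi t \o pt_of) in
  complex.Re (I t) @[t --> 0^'+] --> complex.Re (phi (0, 0, 0)) /\
  complex.Im (I t) @[t --> 0^'+] --> complex.Im (phi (0, 0, 0)).

End Coordinates.
Arguments pt R m k : clear implicits.

(* Main.v *)
(* Scaling the frequency by [t] turns the kernel into
   c int w_t(mu) e^{-rho^2 b_t(mu) / 4 + i<sigma,mu>} dmu with rho^2 = |z|^2 + y^2,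
   w_t = (|mu| / sinh(t|mu|))^beta, b_t = |mu| / tanh(t|mu|) and beta = m/2 + 1 - s,
   so that all derivatives may be taken under the integral sign.  Each derivative
   multiplies the integrand by a symbol, and the Heisenberg relations (skew-symmetry of J, orthogonality
   of the J(eps_l) z) reduce the equation to the identity
   -beta b + rho^2 (b^2 - |mu|^2) / 4 = -beta b + rho^2 / (4 S^2) of symbols, S = sinh(t|mu|) / |mu|,
   whose right-hand side comes from the time derivative.

   For the initial condition, Fubini replaces the test function by its partial Fourier transform V in
   sigma.  Rescaling (z, y) by sqrt t cancels all powers of t, and dominated convergence leaves a
   Gaussian integral in z, a Gamma integral in y, and the integral of V(0, mu, 0) over mu, which is
   evaluated by Fourier inversion. *)
Require Import Defs.
From HB Require Import structures.
From mathcomp Require Import all_boot all_order all_algebra.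
From mathcomp Require Import all_classical all_reals all_analysis.
From mathcomp Require Import measurable_realfun.
From mathcomp Require Import complex ring lra.
Set Implicit Arguments.
Unset Strict Implicit.
Unset Printing Implicit Defensive.
Import Order.TTheory GRing.Theory Num.Theory.
Import numFieldNormedType.Exports.
Local Open Scope classical_set_scope.
Local Open Scope ring_scope.
Local Open Scope complex_scope.

(** * Integration on R^n *)

(** After the rescaling the hyperbolic weight tends to [1] as [t] tends to [0], so the kernel offers
    no decay in the frequency that is uniform in [t]. The decay which dominated convergence needs is
    taken from [V] instead: two derivatives of the test function in [sigma_l] give the factor
    [1 / (1 + mu_l^2)]. In [z] and [y] the Gaussian and the density supply integrability. Complex
    exponentials are replaced by real waves [cos(<sigma,mu> + th)] with a free phase: [th = 0] and
    [th = pi/2] are the real and imaginary parts of [e^(-i<sigma,mu>)], and a derivative in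
    [sigma_l] multiplies the symbol by [mu_l] and adds [pi/2] to [th]. A statement proved for every
    [th] thus serves both parts and is stable under differentiation. The zero frequency is never a
    special case in the calculus: [sinh(t r) / r] is extended to [r = 0], where its derivatives in
    [t] keep the same formulas. *)

Section RealIntegral.
Context d (T : measurableType d) (R : realType).
Variable mu : {measure set T -> \bar R}.

Lemma integrable_dominated (D : set T) (f g : T -> R) : measurable D ->
  measurable_fun D f -> mu.-integrable D (EFin \o g) ->
  (forall x, D x -> `|f x| <= g x) -> mu.-integrable D (EFin \o f).
Proof.
move=> mD mf ig fg; apply: (le_integrable mD _ _ ig).
  exact/measurable_EFinP.
move=> x Dx /=; rewrite lee_fin (le_trans (fg _ Dx))// ler_norm//.
Qed.

Lemma integrable_mull (D : set T) (f : T -> R) (c : R) : measurable D ->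
  mu.-integrable D (EFin \o f) -> mu.-integrable D (EFin \o (fun x => c * f x)).
Proof. by move=> mD fi; apply: (integrableZl mD c fi). Qed.

Lemma integrable_add (D : set T) (f g : T -> R) : measurable D ->
  mu.-integrable D (EFin \o f) -> mu.-integrable D (EFin \o g) ->
  mu.-integrable D (EFin \o (fun x => f x + g x)).
Proof. by move=> mD fi gi; apply: (integrableD mD fi gi). Qed.

Lemma dominated_Rintegral_cvg (D : set T) (f_ : nat -> T -> R) (f g : T -> R) :
  measurable D -> (forall n, measurable_fun D (f_ n)) ->
  (forall x, D x -> f_ n x @[n --> \oo] --> f x) ->
  mu.-integrable D (EFin \o g) ->
  (forall n x, D x -> `|f_ n x| <= g x) ->
  \int[mu]_(x in D) f_ n x @[n --> \oo] --> \int[mu]_(x in D) f x.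
Proof.
move=> mD mf_ ff ig fg.
have mf : measurable_fun D f.
  apply/measurable_EFinP.
  apply: (emeasurable_fun_cvg (fun n => EFin \o f_ n)) => [n|x Dx].
    exact/measurable_EFinP.
  by apply: cvg_EFin; [exact: nearW|exact: ff].
have fgl x : D x -> `|f x| <= g x.
  move=> Dx; apply: (@closed_cvg _ _ _ eventually_filter (fun n => `|f_ n x|)
    [set y | y <= g x] (@closed_le _ _) _ `|f x|).
    by apply: nearW => n; exact: fg.
  by apply: cvg_norm; exact: ff.
have if_ n := integrable_dominated mD (mf_ n) ig (fg n).
have iff := integrable_dominated mD mf ig fgl.
have := @dominated_cvg _ _ _ mu D mD (fun n => EFin \o f_ n) (EFin \o f)
  (EFin \o g).
move=> /(_ (fun n => (measurable_EFinP _ _).2 (mf_ n))) H.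
rewrite /Rintegral; apply: fine_cvg.
rewrite fineK; last exact: integrable_fin_num.
apply: H => //.
by move=> x Dx; apply: cvg_EFin; [exact: nearW|exact: ff].
Qed.

Lemma dominated_Rintegral_cvg_right (D : set T) (F : R -> T -> R) (a : R)
    (f g : T -> R) : measurable D ->
  (forall t, a < t -> measurable_fun D (F t)) ->
  (forall x, D x -> F t x @[t --> a^'+] --> f x) ->
  mu.-integrable D (EFin \o g) ->
  (forall t x, a < t -> D x -> `|F t x| <= g x) ->
  \int[mu]_(x in D) F t x @[t --> a^'+] --> \int[mu]_(x in D) f x.
Proof.
move=> mD mF Ff ig Fg; apply/cvg_at_rightP => u [u0 ua].
apply: (@dominated_Rintegral_cvg D (fun n => F (u n)) f g) => //.
- by move=> n; exact: mF.
- by move=> x Dx; have /cvg_at_rightP := Ff x Dx; exact.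
- by move=> n x Dx; exact: Fg.
Qed.

End RealIntegral.

Section RealFubini.
Context d1 d2 (T1 : measurableType d1) (T2 : measurableType d2) (R : realType).
Variables (m1 : {sigma_finite_measure set T1 -> \bar R})
          (m2 : {sigma_finite_measure set T2 -> \bar R}).
Variable f : T1 * T2 -> R.
Hypothesis fi : (m1 \x m2)%E.-integrable setT (EFin \o f).

(** The inner integral is real-valued through [fine], which is faithful only at finite values;
    integrability of every section, and not of almost every one, makes this hold pointwise. *)
Lemma Rintegral_fubini1 : (forall x, m2.-integrable setT (fun y => (f (x, y))%:E)) ->
  \int[(m1 \x m2)%E]_z f z = \int[m1]_x \int[m2]_y f (x, y).
Proof.
move=> fx; rewrite /Rintegral; congr fine.
rewrite -(integral12_prod_meas1 fi); apply: eq_integral => x _.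
by rewrite /fubini_F fineK//; exact: integrable_fin_num.
Qed.

Lemma Rintegral_fubini2 : (forall y, m1.-integrable setT (fun x => (f (x, y))%:E)) ->
  \int[(m1 \x m2)%E]_z f z = \int[m2]_y \int[m1]_x f (x, y).
Proof.
move=> fy; rewrite /Rintegral; congr fine.
rewrite -(integral21_prod_meas1 fi); apply: eq_integral => y _.
by rewrite /fubini_G fineK//; exact: integrable_fin_num.
Qed.

Lemma integrable_Rintegral1 : (forall x, m2.-integrable setT (fun y => (f (x, y))%:E)) ->
  m1.-integrable setT (fun x => (\int[m2]_y f (x, y))%:E).
Proof.
move=> fx; have := integrable_fubini_F fi; apply: eq_integrable => // x _.
by rewrite /fubini_F /Rintegral fineK//; exact: integrable_fin_num.
Qed.

End RealFubini.

Section AffineLine.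
Context {R : realType}.
Local Notation T := (measurableTypeR R).
Local Notation leb := (@lebesgue_measure R).

Lemma measurable_affine (a b : R) :
  measurable_fun setT (fun x : T => a * x + b : T).
Proof. by apply: measurable_funD => //; exact: measurable_funM. Qed.

(** By uniqueness of Lebesgue measure it suffices to compare the two measures on half-open
    intervals. *)
Lemma lebesgue_measure_affine (a b : R) (A : set R) : 0 < a -> measurable A ->
  leb A = (a%:E * pushforward leb (fun x : T => a * x + b : T)%R A)%E.
Proof.
move=> a0 mA.
pose nu0 : {measure set T -> \bar R} :=
  measure_function_pushforward__canonical__measure_function_Measure
    leb (measurable_affine a b).
pose nu : {measure set T -> \bar R} := mscale (NngNum (ltW a0)) nu0.
rewrite (_ : (_ * _)%E = nu A)//.
apply: lebesgue_measure_unique => //= _ [[u v]] _ <-.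
rewrite /nu /= /mscale/= /pushforward.
rewrite (_ : _ @^-1` _ = `](u - b) / a, (v - b) / a]%classic); last first.
  apply/seteqP; split => x /=; rewrite !in_itv/=.
    by rewrite ltr_pdivrMr// ler_pdivlMr// ltrBlDr lerBrDr mulrC.
  by rewrite ltr_pdivrMr// ler_pdivlMr// ltrBlDr lerBrDr mulrC.
rewrite !lebesgue_measure_itv/= !lte_fin ltr_pM2r ?invr_gt0// ltrD2r.
case: ifPn => uv; last by rewrite mule0.
by rewrite -EFinB -EFinM; congr EFin; field; rewrite gt_eqF.
Qed.

Lemma ge0_integral_affine (a b : R) (f : T -> \bar R) : 0 < a ->
  measurable_fun setT f -> (forall x, 0 <= f x)%E ->
  (\int[leb]_x f x = a%:E * \int[leb]_x f (a * x + b)%R)%E.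
Proof.
move=> a0 mf f0.
pose nu0 : {measure set T -> \bar R} :=
  measure_function_pushforward__canonical__measure_function_Measure
    leb (measurable_affine a b).
transitivity (\int[mscale (NngNum (ltW a0)) nu0]_x f x)%E.
  by apply: eq_measure_integral => A mA _; rewrite /= /mscale/= (lebesgue_measure_affine b a0).
rewrite ge0_integral_mscale//=; congr (_ * _)%E.
rewrite ge0_integral_pushforward//=; exact: measurable_affine.
Qed.

End AffineLine.

(** * Changes of variables and product integrands on R^n *)

Section LebesgueRn.
Context {R : realType}.
Local Notation T := (measurableTypeR R).
Local Notation leb := (@lebesgue_measure R).
Local Notation rn n := (@lebesgue_rn R n).

Definition consp n (p : T * n.-tuple T) : n.+1.-tuple T := [tuple of p.1 :: p.2].

Lemma measurable_consp n : measurable_fun setT (@consp n).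
Proof. exact: measurable_cons. Qed.

Lemma integral_rn0 (f : 0.-tuple T -> \bar R) :
  (\int[rn 0]_t f t = f [tuple])%E.
Proof.
rewrite (_ : f = cst (f [tuple])); last by apply/funext => t; rewrite tuple0.
by rewrite integral_cst//= diracT mule1.
Qed.

Lemma ge0_integral_rnS n (f : n.+1.-tuple T -> \bar R) :
  measurable_fun setT f -> (forall x, 0 <= f x)%E ->
  (\int[rn n.+1]_t f t = \int[leb]_x \int[rn n]_t f (consp (x, t)))%E.
Proof.
move=> mf f0.
transitivity (\int[pushforward (leb \x rn n)%E (@consp n)]_t f t)%E => //.
rewrite ge0_integral_pushforward//=; last exact: measurable_consp.
rewrite fubini_tonelli1//.
exact: (measurableT_comp mf (@measurable_consp n)).
Qed.

(** Dilations ([v = 0]) and translations ([a = 1]) in one map: the former carry the rescalings, the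
    latter the integration by parts in [sigma]. *)
Definition affine n (a : R) (v : 'I_n -> R) (t : n.-tuple T) : n.-tuple T :=
  [tuple (a * tnth t i + v i : T) | i < n].

Lemma measurable_affine_tuple n a (v : 'I_n -> R) :
  measurable_fun setT (affine a v).
Proof.
apply/measurable_fun_tnthP => i.
rewrite (_ : _ \o _ = fun t : n.-tuple T => a * tnth t i + v i); last first.
  by apply/funext => t /=; rewrite tnth_mktuple.
apply: (measurableT_comp (measurable_affine a (v i))).
exact: measurable_tnth.
Qed.

(** Induction on the dimension through Tonelli: the tail of the tuple contributes [a^n], the head
    one more factor [a]. *)
Lemma ge0_integral_rn_affine n a v (f : n.-tuple T -> \bar R) : 0 < a ->
  measurable_fun setT f -> (forall x, 0 <= f x)%E ->
  (\int[rn n]_t f t = (a ^+ n)%:E * \int[rn n]_t f (affine a v t))%E.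
Proof.
move=> a0; elim: n v f => [|n IH] v f mf f0.
  rewrite expr0 mul1e; apply: eq_integral => t _; congr f.
  by rewrite [RHS]tuple0 [LHS]tuple0.
have mfa : measurable_fun setT (fun t => f (affine a v t)).
  exact: (measurableT_comp mf (measurable_affine_tuple a v)).
rewrite !ge0_integral_rnS//.
pose v' i := v (lift ord0 i).
transitivity (\int[leb]_x ((a ^+ n)%:E * \int[rn n]_t f (consp (x, affine a v' t))))%E.
  apply: eq_integral => x _; rewrite (IH v')//.
  apply: (measurableT_comp mf).
  apply: (measurableT_comp (@measurable_consp n)).
  exact: measurable_pair1.
have mF : measurable_fun setT (fun x => \int[rn n]_t f (consp (x, affine a v' t)))%E.
  pose F := fun p : T * n.-tuple T => f (consp (p.1, affine a v' p.2)).
  apply: (@measurable_fun_fubini_tonelli_F _ _ _ _ _ (rn n) F) => //; last by move=> p; exact: f0.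
  apply: (measurableT_comp mf).
  apply: (measurableT_comp (@measurable_consp n)).
  apply: measurable_fun_pair => //.
  exact: (measurableT_comp (measurable_affine_tuple a v')).
rewrite ge0_integralZl//; last 2 first.
  by move=> x _; exact: integral_ge0.
  by rewrite lee_fin exprn_ge0// ltW.
have F0 (x : T) : (0 <= \int[rn n]_t f (consp (x, affine a v' t)))%E.
  by apply: integral_ge0 => t _; exact: f0.
have -> := ge0_integral_affine (v ord0) a0 mF F0.
rewrite muleA -EFinM -exprSr; congr (_ * _)%E.
apply: eq_integral => x _; apply: eq_integral => t _; congr f.
apply: eq_from_tnth => i; rewrite tnth_mktuple.
case: (unliftP ord0 i) => [j|] ->.
  by rewrite !tnthS tnth_mktuple.
by rewrite !tnth0.
Qed.

Lemma integrable_rn_affine n a v (f : n.-tuple T -> R) : 0 < a ->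
  (rn n).-integrable setT (EFin \o f) ->
  (rn n).-integrable setT (EFin \o (f \o affine a v)).
Proof.
move=> a0 /integrableP[mf fi]; apply/integrableP; split.
  exact: (measurableT_comp mf (measurable_affine_tuple a v)).
have mf' : measurable_fun setT (fun x => `|(EFin \o f) x|)%E by exact: measurableT_comp.
move: fi; rewrite (@ge0_integral_rn_affine _ _ v (fun x => `|(EFin \o f) x|)%E a0)//.
(* An infinite integral after the substitution would stay infinite when multiplied by [a^n > 0]. *)
move=> h; apply/negP => h'; move: h; apply/negP.
move: h' => /negP; rewrite -leNgt leye_eq => /eqP ->.
by rewrite gt0_muley ?ltxx// lte_fin exprn_gt0.
Qed.

Lemma Rintegral_rn_affine n a v (f : n.-tuple T -> R) : 0 < a ->
  (rn n).-integrable setT (EFin \o f) ->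
  \int[rn n]_t f t = a ^+ n * \int[rn n]_t f (affine a v t).
Proof.
move=> a0 fi; have fi' := integrable_rn_affine v a0 fi.
have hp : (((EFin \o f) \o affine a v)^\+ = (EFin \o f)^\+ \o affine a v)%E.
  exact: funepos_comp.
have hn : (((EFin \o f) \o affine a v)^\- = (EFin \o f)^\- \o affine a v)%E.
  exact: funeneg_comp.
rewrite /Rintegral [in LHS]integralE [in RHS]integralE.
have [mf _] := integrableP _ _ _ fi.
rewrite (ge0_integral_rn_affine v a0 (measurable_funepos mf))//.
rewrite (ge0_integral_rn_affine v a0 (measurable_funeneg mf))//.
rewrite -muleBr//; last first.
  have := integrable_add_def measurableT fi'.
  rewrite -[EFin \o (f \o affine a v)]/((EFin \o f) \o affine a v).
  by rewrite hp hn.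
rewrite fineM//.
- rewrite -[fun _ => (f _)%:E]/((EFin \o f) \o affine a v).
  rewrite hp hn; reflexivity.
- have := integrable_fin_num measurableT fi'; rewrite integralE.
  rewrite -[EFin \o (f \o affine a v)]/((EFin \o f) \o affine a v).
  by rewrite hp hn.
Qed.


Lemma measurable_prod_tnth n (g : T -> R) : measurable_fun setT g ->
  measurable_fun setT (fun t : n.-tuple T => \prod_(i < n) g (tnth t i)).
Proof.
move=> mg; apply: measurable_prod => i _.
by apply: (measurableT_comp mg); exact: measurable_tnth.
Qed.

Lemma ge0_integral_rn_prod n (g : T -> R) (c : R) : measurable_fun setT g ->
  (forall x, 0 <= g x) -> (\int[leb]_x (g x)%:E = c%:E)%E ->
  (\int[rn n]_t (\prod_(i < n) g (tnth t i))%:E = (c ^+ n)%:E)%E.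
Proof.
move=> mg g0 gc; elim: n => [|n IH].
  by rewrite integral_rn0 big_ord0.
have g0' k (t : k.-tuple T) : (0 <= (\prod_(i < k) g (tnth t i))%:E)%E.
  by rewrite lee_fin prodr_ge0.
rewrite ge0_integral_rnS//; last first.
  by apply/measurable_EFinP; exact: measurable_prod_tnth.
transitivity (\int[leb]_x ((g x)%:E * (c ^+ n)%:E))%E.
  apply: eq_integral => x _; rewrite -IH -ge0_integralZl//=.
  - apply: eq_integral => t _; rewrite -EFinM big_ord_recl; congr (_ * _)%:E.
    by apply: eq_bigr => i _; rewrite tnthS.
  - by apply/measurable_EFinP; exact: measurable_prod_tnth.
  - by move=> t _; exact: g0'.
  - by rewrite lee_fin.
have mgE : measurable_fun setT (fun x : T => (g x)%:E) by exact/measurable_EFinP.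
have cn0 : (0 <= (c ^+ n)%:E)%E.
  rewrite lee_fin exprn_ge0// -lee_fin -gc.
  by apply: integral_ge0 => x _; rewrite lee_fin.
rewrite ge0_integralZr// => [|x _]; last by rewrite lee_fin.
by rewrite gc -EFinM exprSr mulrC -exprSr exprS.
Qed.

Lemma integrable_rn_prod n (g : T -> R) : measurable_fun setT g ->
  (forall x, 0 <= g x) -> leb.-integrable setT (EFin \o g) ->
  (rn n).-integrable setT (fun t => (\prod_(i < n) g (tnth t i))%:E).
Proof.
move=> mg g0 gi.
have /fineK/esym gc := integrable_fin_num measurableT gi.
apply/integrableP; split.
  by apply/measurable_EFinP; exact: measurable_prod_tnth.
rewrite (_ : (fun _ => _) = (fun t : n.-tuple T => (\prod_(i < n) g (tnth t i))%:E)).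
  by rewrite (ge0_integral_rn_prod n mg g0 gc) ltry.
by apply/funext => t; rewrite gee0_abs// lee_fin prodr_ge0.
Qed.

Lemma Rintegral_rnS n (f : n.+1.-tuple T -> R) :
  (rn n.+1).-integrable setT (EFin \o f) ->
  (forall x, (rn n).-integrable setT (fun t => (f (consp (x, t)))%:E)) ->
  \int[rn n.+1]_t f t = \int[leb]_x \int[rn n]_t f (consp (x, t)).
Proof.
move=> fi fx.
have [mf fioo] := integrableP _ _ _ fi.
have fi' : (leb \x rn n)%E.-integrable setT (EFin \o (f \o @consp n)).
  apply/integrableP; split.
    exact: (measurableT_comp mf (@measurable_consp n)).
  rewrite ge0_integral_rnS// in fioo; last exact: measurableT_comp.
  rewrite fubini_tonelli1//.
  apply: measurableT_comp => //.
  exact: (measurableT_comp mf (@measurable_consp n)).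
rewrite -(@Rintegral_fubini1 _ _ _ _ _ _ _ (f \o @consp n))//.
rewrite /Rintegral; congr fine.
transitivity (\int[pushforward (leb \x rn n)%E (@consp n)]_t (f t)%:E)%E => //.
by rewrite integral_pushforward//; exact: measurable_consp.
Qed.

(** [gh] plays the role of the Fourier transform of an even [g]. The phase is kept free because the
    induction integrates out the tail of the tuple with phase [a_0 x + th], where [x] is the
    head. *)
Lemma Rintegral_rn_prod_cos n (g gh : T -> R) (a : 'I_n -> R) (th : R) :
  measurable_fun setT g -> (forall x, 0 <= g x) ->
  leb.-integrable setT (EFin \o g) ->
  (forall b th', \int[leb]_x (g x * cos (b * x + th')) = gh b * cos th') ->
  \int[rn n]_t ((\prod_(i < n) g (tnth t i)) *
     cos (\sum_(i < n) a i * tnth t i + th)) = (\prod_(i < n) gh (a i)) * cos th.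
Proof.
move=> mg g0 gi ggh.
have int k (b : 'I_k -> R) c : (rn k).-integrable setT
    (EFin \o (fun t : k.-tuple T => (\prod_(i < k) g (tnth t i)) *
     cos (\sum_(i < k) b i * tnth t i + c))).
  apply: (@integrable_dominated _ _ _ _ _ _
    (fun t => \prod_(i < k) g (tnth t i))) => //.
  - apply: measurable_funM; first exact: measurable_prod_tnth.
    apply: measurableT_comp; first exact: continuous_measurable_fun (@continuous_cos R).
    apply: measurable_funD => //.
    apply: measurable_sum => i; apply: measurable_funM => //.
    exact: measurable_tnth.
  - exact: integrable_rn_prod.
  - move=> t _; rewrite normrM ger0_norm ?prodr_ge0//.
    by rewrite ler_piMr ?prodr_ge0// cos_max.
elim: n a th => [|n IH] a th.
  by rewrite /Rintegral integral_rn0 !big_ord0 add0r.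
have E x (t : n.-tuple T) : (\prod_(i < n.+1) g (tnth (consp (x, t)) i)) *
    cos (\sum_(i < n.+1) a i * tnth (consp (x, t)) i + th) =
  g x * ((\prod_(i < n) g (tnth t i)) *
    cos (\sum_(i < n) a (lift ord0 i) * tnth t i + (a ord0 * x + th))).
  rewrite !big_ord_recl -mulrA; congr (_ * (_ * cos _)).
    by apply: eq_bigr => i _; rewrite tnthS.
  rewrite addrCA addrA; congr (_ + _ + _).
  by apply: eq_bigr => i _; rewrite tnthS.
rewrite Rintegral_rnS//; last first.
  move=> x; under eq_fun do rewrite E EFinM.
  by apply: integrableZl => //; exact: int.
transitivity (\int[leb]_x ((\prod_(i < n) gh (a (lift ord0 i))) *
    (g x * cos (a ord0 * x + th)))).
  apply: eq_Rintegral => x _; rewrite mulrCA -IH -RintegralZl//.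
  by apply: eq_Rintegral => t _; rewrite E.
rewrite RintegralZl//; last first.
  apply: (@integrable_dominated _ _ _ _ _ _ g) => //.
  - apply: measurable_funM => //.
    apply: measurableT_comp; first exact: continuous_measurable_fun (@continuous_cos R).
    exact: measurable_affine.
  - by move=> x _; rewrite normrM ger0_norm// ler_piMr// cos_max.
by rewrite ggh mulrA big_ord_recl mulrAC mulrC mulrA.
Qed.

End LebesgueRn.

(** * Hyperbolic kernel functions and integrals on the line *)

Section RealDerivative.
Context {R : realType} {V : normedModType R}.
Implicit Types (f g : V -> R) (x v : V).

Lemma is_derive_congr f g x v a b : is_derive x v f a -> f =1 g -> a = b ->
  is_derive x v g b.
Proof. by move=> fa /funext <- <-. Qed.

Lemma is_derive_add f g x v a b : is_derive x v f a -> is_derive x v g b ->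
  is_derive x v (fun y => f y + g y) (a + b).
Proof. by move=> fa gb; exact: is_deriveD. Qed.

Lemma is_derive_mul f g x v a b : is_derive x v f a -> is_derive x v g b ->
  is_derive x v (fun y => f y * g y) (f x * b + a * g x).
Proof.
move=> fa gb; have := @is_deriveM _ _ f g x v a b fa gb.
by rewrite /GRing.scale/= (mulrC a).
Qed.

Lemma is_derive_mull f x v a c : is_derive x v f a ->
  is_derive x v (fun y => c * f y) (c * a).
Proof. by move=> fa; exact: is_deriveZ. Qed.

Lemma is_derive_mulr f x v a c : is_derive x v f a ->
  is_derive x v (fun y => f y * c) (a * c).
Proof. by move=> /(is_derive_mull c); rewrite mulrC; under eq_fun do rewrite mulrC. Qed.

Lemma is_derive_opp f x v a : is_derive x v f a ->
  is_derive x v (fun y => - f y) (- a).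
Proof. by move=> fa; exact: is_deriveN. Qed.

End RealDerivative.

Section RealDerivative1.
Context {R : realType}.
Implicit Types (f g : R -> R) (x : R).

Lemma is_derive_comp1 f g x a b : is_derive (g x) 1 f a -> is_derive x 1 g b ->
  is_derive x 1 (fun y => f (g y)) (a * b).
Proof. exact: is_derive1_comp. Qed.

Lemma is_derive_linear x (a b : R) : is_derive x 1 (fun y => a * y + b) a.
Proof.
have := is_derive_add (is_derive_mull a (is_derive_id x 1)) (is_derive_cst b x 1).
by rewrite mulr1 addr0.
Qed.

End RealDerivative1.

Section HyperbolicKernel.
Context {R : realType}.
Implicit Types t r x : R.

Lemma is_derive_sinh x : is_derive x 1 (@sinh R) (cosh x).
Proof.
rewrite /sinh /cosh; apply: trigger_derive.
by rewrite !(mulrN1, scaler0, add0r, mulr1) opprK /GRing.scale/= mulrC.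
Qed.

Lemma is_derive_cosh x : is_derive x 1 (@cosh R) (sinh x).
Proof.
rewrite /sinh /cosh; apply: trigger_derive.
by rewrite !(mulrN1, scaler0, add0r, mulr1) /GRing.scale/= mulrC.
Qed.

Lemma is_derive_continuous (f df : R -> R) :
  (forall x, is_derive x 1 f (df x)) -> continuous f.
Proof.
by move=> fd x; apply/differentiable_continuous/derivable1_diffP; exact: ex_derive.
Qed.

(** Applied in the variable [t] at fixed [r], this yields [shc_homo], [shc_ge] and [shc_le_cosh] for
    [r = 0] and [r != 0] alike. *)
Lemma is_derive_ge0_le (f df : R -> R) (a : R) :
  (forall x, is_derive x 1 f (df x)) -> (forall x, a < x -> 0 <= df x) ->
  forall x y, a <= x -> x <= y -> f x <= f y.
Proof.
move=> fd df0; apply: ger0_derive1_ndecry => [x _|x|].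
- by have [] := fd x.
- rewrite in_itv/= andbT => ax; rewrite derive1E.
  by have [_ ->] := fd x; exact: df0.
- by apply: continuous_subspaceT; exact: is_derive_continuous fd.
Qed.

Lemma sqr_cosh x : cosh x ^+ 2 = 1 + sinh x ^+ 2.
Proof.
have h : expR (- x) = (expR x)^-1 by exact: expRN.
rewrite /sinh /cosh h; field; exact: lt0r_neq0 (expR_gt0 x).
Qed.

Lemma cosh_ge1 x : 1 <= cosh x.
Proof.
rewrite /cosh ler_pdivlMr// mul1r.
have h := expRxMexpNx_1 x; have a0 := expR_gt0 x; have b0 := expR_gt0 (- x).
have := sqr_ge0 (expR x - 1); nra.
Qed.

Lemma sinh0 : sinh 0 = 0 :> R.
Proof. by rewrite /sinh oppr0 subrr mul0r. Qed.

Lemma cosh0 : cosh 0 = 1 :> R.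
Proof. by rewrite /cosh oppr0 expR0; lra. Qed.

(* [shc t r] is [sinh (t r) / r], extended by continuity to [r = 0]. *)
Definition shc t r : R := if r == 0 then t else sinh (t * r) / r.

Lemma is_derive_cosh_scale t r :
  is_derive t 1 (fun x => cosh (x * r)) (r ^+ 2 * shc t r).
Proof.
have h := is_derive_cosh (t * r).
have g : is_derive t 1 (fun x => x * r) r.
  by apply: trigger_derive; rewrite !(mulr1, scaler0, add0r) /GRing.scale/= mulr1.
have := @is_derive1_comp _ (@cosh R) (fun x => x * r) t _ _ h g.
rewrite (_ : sinh _ * r = r ^+ 2 * shc t r)//.
rewrite /shc; case: eqVneq => [->|r0]; first by rewrite mulr0 expr0n/= mul0r.
by field.
Qed.

Lemma is_derive_shc t r : is_derive t 1 (shc^~ r) (cosh (t * r)).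
Proof.
rewrite /shc; case: eqVneq => [->|r0].
  by rewrite mulr0 cosh0; exact: is_derive_id.
have h := is_derive_sinh (t * r).
have g : is_derive t 1 (fun x => x * r) r.
  by apply: trigger_derive; rewrite !(mulr1, scaler0, add0r) /GRing.scale/= mulr1.
have := is_derive_mulr r^-1 (@is_derive_comp1 _ (@sinh R) ( *%R^~ r) t _ _ h g).
by rewrite mulfK.
Qed.

Lemma shc0 r : shc 0 r = 0.
Proof. by rewrite /shc; case: eqP => // _; rewrite mul0r sinh0 mul0r. Qed.

Lemma shc_homo r s t : s <= t -> shc s r <= shc t r.
Proof.
move=> st; apply: (@is_derive_ge0_le (shc^~ r) (fun x => cosh (x * r)) s) => //.
  by move=> x; exact: is_derive_shc.
by move=> x _; rewrite (le_trans _ (cosh_ge1 _)).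
Qed.

Lemma shc_ge0 t r : 0 <= t -> 0 <= shc t r.
Proof. by move=> t0; rewrite -(shc0 r); exact: shc_homo. Qed.

Lemma shc_ge t r : 0 <= t -> t <= shc t r.
Proof.
move=> t0; rewrite -subr_ge0 (_ : 0 = shc 0 r - 0); last by rewrite shc0 subrr.
apply: (@is_derive_ge0_le (fun x => shc x r - x) (fun x => cosh (x * r) - 1) 0) => //.
  move=> x; have h := is_derive_shc x r; exact: is_deriveB.
by move=> x _; rewrite subr_ge0 cosh_ge1.
Qed.

Lemma shc_gt0 t r : 0 < t -> 0 < shc t r.
Proof. by move=> t0; rewrite (lt_le_trans t0)// shc_ge// ltW. Qed.

Lemma shc_le_cosh t r : 0 <= t -> shc t r <= t * cosh (t * r).
Proof.
move=> t0; rewrite -subr_ge0.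
rewrite (_ : 0 = 0 * cosh (0 * r) - shc 0 r); last by rewrite shc0 mul0r subrr.
apply: (@is_derive_ge0_le (fun x => x * cosh (x * r) - shc x r)
  (fun x => x * (r ^+ 2 * shc x r)) 0); [| |exact: lexx|exact: t0].
- move=> x; have h := is_derive_shc x r; have h' := is_derive_cosh_scale x r.
  have h3 := @is_deriveM _ _ id (fun y => cosh (y * r)) x 1 _ _ (is_derive_id x 1) h'.
  have := @is_deriveB _ _ _ _ _ x 1 _ _ h3 h.
  by rewrite /GRing.scale/= mulr1 addrK.
- move=> x x0; apply: mulr_ge0; first exact: ltW.
  by apply: mulr_ge0; [exact: sqr_ge0|exact/shc_ge0/ltW].
Qed.

Lemma sqr_cosh_shc t r : cosh (t * r) ^+ 2 = 1 + r ^+ 2 * shc t r ^+ 2.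
Proof.
rewrite sqr_cosh /shc; case: eqVneq => [->|r0].
  by rewrite mulr0 sinh0 !expr0n/= mul0r.
by field.
Qed.

(** With [S = shc t r], [cosh^2 = 1 + (r S)^2 <= (1 + r S)^2], so the quotient is at most
    [1 / S + r], and [S >= t]. Growth linear in [r] is what makes the coth symbol tame. *)
Lemma cosh_shc_le t r : 0 < t -> 0 <= r -> cosh (t * r) / shc t r <= t^-1 + r.
Proof.
move=> t0 r0; have S0 := shc_gt0 r t0.
have : cosh (t * r) <= 1 + r * shc t r.
  rewrite -(@ler_pXn2r _ 2)// ?nnegrE; last 2 first.
    by rewrite (le_trans _ (cosh_ge1 _)).
    by rewrite addr_ge0// mulr_ge0// ltW.
  rewrite sqr_cosh_shc sqrrD exprMn expr1n mul1r.
  have : 0 <= r * shc t r by rewrite mulr_ge0// ltW.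
  lra.
move=> h; rewrite ler_pdivrMr// (le_trans h)// mulrDl lerD2r.
by rewrite mulrC ler_pdivlMr// mul1r shc_ge// ltW.
Qed.

Lemma cosh_shc_ge t r : 0 < t -> t^-1 <= cosh (t * r) / shc t r.
Proof.
move=> t0; rewrite ler_pdivlMr ?shc_gt0// mulrC ler_pdivrMr//.
by rewrite mulrC shc_le_cosh// ltW.
Qed.

(** For [x = t r] and [E = e^(x/2) >= 1], [e^x = E^2 >= (1 + x/2) E] and [e^(-x) <= 1 <= E] give
    [sinh x >= (x/4) E]. Half of the exponential rate is given up for a bound without
    cancellation. *)
Lemma expR_le_shc t r : 0 < t -> 0 <= r -> t / 4 * expR (t * r / 2) <= shc t r.
Proof.
move=> t0; rewrite le_eqVlt => /predU1P[<-|r0].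
  by rewrite /shc eqxx mulr0 mul0r expR0; lra.
rewrite /shc gt_eqF// ler_pdivlMr// /sinh.
have x0 : 0 < t * r by exact: mulr_gt0.
rewrite [leLHS](_ : _ = t * r / 4 * expR (t * r / 2)); last by ring.
move: (t * r) x0 => x x0.
have E : expR x = expR (x / 2) ^+ 2 by rewrite -expRM_natr; congr expR; field.
have h1 := expR_ge1Dx (x / 2).
have h2 : expR (- x) <= 1 by rewrite expR_le1; lra.
rewrite E; nra.
Qed.

Lemma over_sinhE t r : 0 < t -> over_sinh (t * r) = t / shc t r.
Proof.
move=> t0; rewrite /over_sinh /shc mulf_eq0 gt_eqF//=.
case: eqVneq => [_|r0]; first by rewrite divff// gt_eqF.
by rewrite -mulrA [(_ / r)^-1]invf_div.
Qed.

Lemma over_tanhE t r : 0 < t ->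
  over_tanh (t * r) = t * (cosh (t * r) / shc t r).
Proof.
move=> t0; rewrite /over_tanh /shc mulf_eq0 gt_eqF//=.
case: eqVneq => [->|r0]; first by rewrite mulr0 cosh0 mul1r divff// gt_eqF.
by rewrite /tanh !invf_div; ring.
Qed.

(** The reciprocal of [over_sinh (t * r)] is the difference quotient of [shc^~ r] at [0], whose
    limit is [cosh 0 = 1]. *)
Lemma over_sinh_cvg1 r : over_sinh (t * r) @[t --> 0^'+] --> (1 : R).
Proof.
have [D E] := is_derive_shc 0 r.
have {D} : h^-1 *: (shc (h *: 1 + 0) r - shc 0 r) @[h --> 0^'+] --> 'D_1 (shc^~ r) 0.
  by apply: cvg_dnbhs_at_right; exact: D.
rewrite E mul0r cosh0.
move=> /(cvgV (oner_neq0 R)); rewrite invr1.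
apply: cvg_trans; apply: near_eq_cvg; near=> t.
have t0 : 0 < t by [].
rewrite over_sinhE// /GRing.scale/= mulr1 addr0 shc0 subr0.
by rewrite invfM invrK.
Unshelve. all: by end_near. Qed.

Lemma over_tanh_cvg1 r : over_tanh (t * r) @[t --> 0^'+] --> (1 : R).
Proof.
have : over_sinh (t * r) * cosh (t * r) @[t --> 0^'+] --> (1 * cosh (0 * r) : R).
  apply: cvgM; first exact: over_sinh_cvg1.
  apply: cvg_at_right_filter.
  exact: (is_derive_continuous (is_derive_cosh_scale^~ r)).
rewrite mul0r cosh0 mulr1; apply: cvg_trans; apply: near_eq_cvg; near=> t.
have t0 : 0 < t by [].
by rewrite over_sinhE// over_tanhE//; ring.
Unshelve. all: by end_near. Qed.

End HyperbolicKernel.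

Section Measurability.
Context d (T : measurableType d) (R : realType).
Implicit Types (D : set T) (f : T -> R).

(** Written as [f * (f^2)^(-1)], the inverse involves a real power of a nonnegative number only;
    both expressions vanish where [f] does. *)
Lemma measurable_fun_inv D f : measurable_fun D f ->
  measurable_fun D (fun x => (f x)^-1).
Proof.
move=> mf; rewrite (_ : (fun x => _) = fun x => f x * (f x ^+ 2) `^ (-1)).
  apply: measurable_funM => //.
  apply: (measurableT_comp (measurable_powR (-1))); exact: measurable_funX.
apply/funext => x; rewrite powR_inv1 ?sqr_ge0//.
have [->|f0] := eqVneq (f x) 0; first by rewrite invr0 mul0r.
by field.
Qed.

Lemma measurable_fun_expR D f : measurable_fun D f ->
  measurable_fun D (fun x => expR (f x)).
Proof. by move=> mf; apply: (measurableT_comp (@measurable_expR R)). Qed.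

Lemma measurable_fun_cos D f : measurable_fun D f ->
  measurable_fun D (fun x => cos (f x)).
Proof.
move=> mf; apply: measurableT_comp => //.
exact: continuous_measurable_fun (@continuous_cos R).
Qed.

Lemma measurable_fun_cosh D f : measurable_fun D f ->
  measurable_fun D (fun x => cosh (f x)).
Proof.
move=> mf; apply: measurableT_comp => //.
exact: continuous_measurable_fun (is_derive_continuous (@is_derive_cosh R)).
Qed.

End Measurability.

Section MeasurabilityShc.
Context d (T : measurableType d) (R : realType).
Implicit Types (D : set T) (f : T -> R).

Lemma measurable_fun_shc t D f : measurable_fun D f ->
  measurable_fun D (fun x => shc t (f x)).
Proof.
move=> mf; apply: (@measurableT_comp _ _ _ _ _ _ (shc t)) => //.
rewrite /shc; apply: measurable_fun_ifT => //.
  by apply: measurable_fun_eqr.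
apply: measurable_funM; last exact: measurable_fun_inv.
apply: (@measurableT_comp _ _ _ _ _ _ (@sinh R)).
  exact: continuous_measurable_fun (is_derive_continuous (@is_derive_sinh R)).
exact: measurable_funM.
Qed.

Lemma measurable_fun_sqrt D f : measurable_fun D f ->
  measurable_fun D (fun x => Num.sqrt (f x)).
Proof.
move=> mf; apply: measurableT_comp => //.
exact: continuous_measurable_fun (@sqrt_continuous R).
Qed.

End MeasurabilityShc.

(** * Explicit integrals on the line *)

Section LineIntegrals.
Context {R : realType}.
Local Notation leb := (@lebesgue_measure R).

Lemma integral_setT_halves (f : R -> \bar R) : measurable_fun setT f ->
  (forall x, 0 <= f x)%E ->
  (\int[leb]_x f x = \int[leb]_(x in `[0%R, +oo[) f x +
    \int[leb]_(x in `[0%R, +oo[) f (- x)%R)%E.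
Proof.
move=> mf f0.
have mfN : measurable_fun setT (fun x : R => f (- x)).
  by apply: (measurableT_comp mf); exact: oppr_measurable.
rewrite (ge0_integration_by_substitution0 mfN)//.
under [in X in (_ + X)%E]eq_integral do rewrite opprK.
rewrite -(@integral_itv_bndo_bndc _ _ _ f); last exact: measurable_funTS.
rewrite addeC -ge0_integral_setU//=.
- by rewrite -setCitvr setvU.
- exact: measurable_funTS.
- rewrite disj_set2E; apply/eqP; rewrite -subset0 => x []/= /[!in_itv]/=.
  by move=> x0; rewrite leNgt andbT x0.
Qed.

Lemma integral_onedsqrV : (\int[leb]_x ((1 + x ^+ 2)^-1)%:E = pi%:E)%E.
Proof.
rewrite (@ge0_symfun_integralT R (fun x => (1 + x ^+ 2)^-1)).
- rewrite (_ : [set x | _] = `[0%R, +oo[%classic); last first.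
    by apply/seteqP; split => x/=; rewrite in_itv/= andbT.
  rewrite integral0y_oneDsqr -EFinM; congr EFin.
  by rewrite mulrC divfK.
- by move=> x; rewrite invr_ge0 addr_ge0// sqr_ge0.
- exact: continuous_oneDsqrV.
- by move=> x /=; rewrite sqrrN.
Qed.

Lemma integral_gauss4 :
  (\int[leb]_x (expR (- (x ^+ 2 / 4)))%:E = (2 * Num.sqrt pi)%:E)%E.
Proof.
have mg : measurable_fun setT (EFin \o @gauss_fun R).
  by apply/measurable_EFinP; exact: measurable_gauss_fun.
have g0 (x : R) : (0 <= (EFin \o @gauss_fun R) x)%E by rewrite lee_fin gauss_fun_ge0.
have h20 : (0 : R) < 2^-1 by [].
have := ge0_integral_affine 0 h20 mg g0.
rewrite /comp integralT_gauss => h.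
rewrite EFinM h muleA -EFinM divff// mul1e; apply: eq_integral => x _.
by rewrite /gauss_fun addr0; congr (expR (- _))%:E; field.
Qed.

(* The summand [1] makes the integrand nonnegative, as the improper fundamental
   theorem of calculus requires. *)
Lemma integral_laplace_half (eps a th : R) : 0 < eps ->
  (\int[leb]_(x in `[0%R, +oo[) (expR (- (eps * x)) * (1 + cos (a * x + th)))%:E =
    (eps^-1 + (eps * cos th - a * sin th) / (eps ^+ 2 + a ^+ 2))%:E)%E.
Proof.
move=> e0.
have d0 : eps ^+ 2 + a ^+ 2 != 0 by rewrite gt_eqF// ltr_wpDr ?sqr_ge0// exprn_gt0.
(* [F = e^(-eps x) h] is a primitive of the integrand: the fraction accounts for the cosine,
   [- eps^-1] for the summand [1]. *)
pose h (x : R) := (a * sin (a * x + th) - eps * cos (a * x + th)) / (eps ^+ 2 + a ^+ 2) - eps^-1.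
pose F (x : R) := expR (- (eps * x)) * h x.
pose f (x : R) := expR (- (eps * x)) * (1 + cos (a * x + th)).
have de (x : R) : is_derive x 1 (fun y => expR (- (eps * y))) (expR (- (eps * x)) * - eps).
  apply: (is_derive_comp1 (is_derive_expR _)).
  by apply: is_derive_opp; have := is_derive_linear x eps 0; under eq_fun do rewrite addr0.
have dF (x : R) : is_derive x 1 F (f x).
  have d2 := is_derive_comp1 (is_derive_sin _) (is_derive_linear x a th).
  have d3 := is_derive_comp1 (is_derive_cos _) (is_derive_linear x a th).
  have dh : is_derive x 1 h (((a * (cos (a * x + th) * a) + - (eps * (- sin (a * x + th) * a)))
      / (eps ^+ 2 + a ^+ 2)) + 0).
    exact: (is_derive_add (is_derive_mulr _ (is_derive_add (is_derive_mull a d2)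
      (is_derive_opp (is_derive_mull eps d3)))) (is_derive_cst _ x 1)).
  have := is_derive_mul (de x) dh; rewrite (_ : _ + _ = f x)//.
  by rewrite /f /h; field; rewrite d0 gt_eqF.
have cf : continuous f.
  move=> x; apply: cvgM; first exact: (is_derive_continuous de).
  apply: cvgD; first exact: cvg_cst.
  apply: continuous_comp; last exact: continuous_cos.
  exact: (is_derive_continuous (fun x => is_derive_linear x a th)).
have F0 : F x @[x --> +oo] --> (0 : R).
  pose K := (`|a| + eps) / (eps ^+ 2 + a ^+ 2) + eps^-1.
  apply/norm_cvg0P.
  apply: (@squeeze_cvgr _ _ _ _ (fun=> 0) (fun x => expR (- (eps * x)) * K)).
  - apply: nearW => x; rewrite normr_ge0/= normrM ger0_norm ?expR_ge0//.
    rewrite ler_wpM2l ?expR_ge0// (le_trans (ler_normB _ _))// lerD//; last first.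
      by rewrite ger0_norm// invr_ge0 ltW.
    rewrite normrM [`|_^-1|]ger0_norm; last by rewrite invr_ge0 addr_ge0// sqr_ge0.
    rewrite ler_wpM2r ?invr_ge0 ?addr_ge0 ?sqr_ge0//.
    rewrite (le_trans (ler_normB _ _))// lerD// normrM.
      by rewrite ler_piMr// ler_norml sin_geN1 sin_le1.
    by rewrite (gtr0_norm e0) ler_piMr ?cos_max// ltW.
  - exact: cvg_cst.
  - rewrite -(mul0r K); apply: cvgM; last exact: cvg_cst.
    apply: (@cvg_comp _ _ _ (fun x => eps * x) (fun y => expR (- y)) _ (pinfty_nbhs R)).
      exact: gt0_cvgMry.
    exact: cvgr_expR.
rewrite (@ge0_continuous_FTC2y R f F 0 0)//.
- rewrite -EFinB sub0r; congr EFin; rewrite /F /h !mulr0 oppr0 expR0 add0r mul1r.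
  by field; rewrite d0 gt_eqF.
- by move=> x _; rewrite mulr_ge0 ?expR_ge0// -lerBlDl sub0r cos_geN1.
- exact: continuous_subspaceT.
- by apply: cvg_at_right_filter; exact: (is_derive_continuous dF).
- by move=> x _; rewrite derive1E; have [] := dF x.
Qed.

(** The two half-lines carry the frequencies [a] and [- a]: the sine terms cancel and the cosine
    terms double. *)
Lemma integral_laplace1 (eps a th : R) : 0 < eps ->
  (\int[leb]_x (expR (- (eps * `|x|)) * (1 + cos (a * x + th)))%:E =
    (2 / eps + 2 * eps / (eps ^+ 2 + a ^+ 2) * cos th)%:E)%E.
Proof.
move=> e0.
rewrite integral_setT_halves; last 2 first.
- apply/measurable_EFinP; apply: measurable_funM.
    apply: measurable_fun_expR; apply: measurableT_comp => //.
    exact: measurable_funM.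
  apply: measurable_funD => //; apply: measurable_fun_cos.
  exact: measurable_affine.
- by move=> x; rewrite lee_fin mulr_ge0 ?expR_ge0// -lerBlDl sub0r cos_geN1.
have E1 := integral_laplace_half a th e0.
have E2 := integral_laplace_half (- a) th e0.
rewrite (_ : (\int[leb]_(x in `[0%R, +oo[) (expR (- (eps * `|- x|)) * _)%:E)%E =
  (\int[leb]_(x in `[0%R, +oo[) (expR (- (eps * x)) * (1 + cos (- a * x + th)))%:E)%E); last first.
  apply: eq_integral => x; rewrite inE/= in_itv/= andbT => x0.
  by rewrite normrN ger0_norm// mulrN mulNr.
rewrite (_ : (\int[leb]_(x in `[0%R, +oo[) (expR (- (eps * `|x|)) * _)%:E)%E =
  (\int[leb]_(x in `[0%R, +oo[) (expR (- (eps * x)) * (1 + cos (a * x + th)))%:E)%E); last first.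
  by apply: eq_integral => x; rewrite inE/= in_itv/= andbT => x0; rewrite ger0_norm.
rewrite E1 E2 -EFinD; congr EFin; rewrite sqrrN.
have d0 : eps ^+ 2 + a ^+ 2 != 0 by rewrite gt_eqF// ltr_wpDr ?sqr_ge0// exprn_gt0.
by field; rewrite d0 gt_eqF.
Qed.

(** The choice [a = 0], [th = pi/2] makes the cosine vanish identically. *)
Lemma integral_expR_abs (eps : R) : 0 < eps ->
  (\int[leb]_x (expR (- (eps * `|x|)))%:E = (2 / eps)%:E)%E.
Proof.
move=> e0; have := integral_laplace1 0 (pi / 2) e0.
rewrite cos_pihalf mulr0 addr0 => <-; apply: eq_integral => x _.
by rewrite mul0r add0r cos_pihalf addr0 mulr1.
Qed.

Lemma integrable_ge0_EFin (f : R -> R) c : measurable_fun setT f ->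
  (forall x, 0 <= f x) -> (\int[leb]_x (f x)%:E = c%:E)%E ->
  leb.-integrable setT (EFin \o f).
Proof.
move=> mf f0 fc; apply/integrableP; split; first exact/measurable_EFinP.
rewrite (_ : (fun _ => _) = (EFin \o f)); first by rewrite fc ltry.
by apply/funext => x /=; rewrite ger0_norm.
Qed.

Lemma measurable_expR_abs (eps : R) :
  measurable_fun setT (fun x : R => expR (- (eps * `|x|))).
Proof.
apply: measurable_fun_expR; apply: measurableT_comp => //.
exact: measurable_funM.
Qed.

Lemma integrable_expR_abs (eps : R) : 0 < eps ->
  leb.-integrable setT (EFin \o (fun x : R => expR (- (eps * `|x|)))).
Proof.
move=> e0; apply: (integrable_ge0_EFin _ _ (integral_expR_abs e0)).
  exact: measurable_expR_abs.
by move=> x; exact: expR_ge0.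
Qed.

Lemma measurable_onedsqrV : measurable_fun setT (fun x : R => (1 + x ^+ 2)^-1).
Proof. exact: continuous_measurable_fun (@continuous_oneDsqrV R). Qed.

Lemma integrable_onedsqrV :
  leb.-integrable setT (EFin \o (fun x : R => (1 + x ^+ 2)^-1)).
Proof.
apply: (integrable_ge0_EFin _ _ integral_onedsqrV); first exact: measurable_onedsqrV.
by move=> x; rewrite invr_ge0 addr_ge0// sqr_ge0.
Qed.

(** The Fourier transform of [e^(-eps |x|)] is a Cauchy kernel; in this form it is the hypothesis on
    [gh] in [Rintegral_rn_prod_cos]. *)
Lemma Rintegral_laplace_cos (eps a th : R) : 0 < eps ->
  \int[leb]_x (expR (- (eps * `|x|)) * cos (a * x + th)) =
    2 * eps / (eps ^+ 2 + a ^+ 2) * cos th.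
Proof.
move=> e0; have i0 := integrable_expR_abs e0.
have ic : leb.-integrable setT
    (EFin \o (fun x : R => expR (- (eps * `|x|)) * cos (a * x + th))).
  apply: (integrable_dominated measurableT _ i0).
    apply: measurable_funM; first exact: measurable_expR_abs.
    by apply: measurable_fun_cos; exact: measurable_affine.
  by move=> x _; rewrite normrM ger0_norm ?expR_ge0// ler_piMr ?expR_ge0// cos_max.
have := RintegralD measurableT i0 ic.
rewrite {2}/Rintegral integral_expR_abs//= => h.
apply: (addrI (2 / eps)); rewrite -h /Rintegral -[RHS]/(fine _%:E) -(integral_laplace1 a th e0).
by congr fine; apply: eq_integral => x _; rewrite mulrDr mulr1.
Qed.

End LineIntegrals.

(** * Oscillatory integrals over the frequency space *)

Section DirectionalDerivative.
Context {R : realType} {V : normedModType R}.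

Lemma is_derive_line (f : V -> R) (x v : V) (c : R) :
  is_derive (0 : R) (1 : R) (fun h : R => f (h *: v + x)) c -> is_derive x v f c.
Proof.
move=> [D E]; have D' : derivable f x v by apply/derivable1P.
split => //; rewrite -E /derive.
suff -> : (fun h : R => h^-1 *: ((f \o shift x) (h *: v) - f x)) =
    (fun h : R => h^-1 *: (((fun h : R => f (h *: v + x)) \o shift 0) (h *: 1) -
      f (0 *: v + x))) by [].
by apply/funext => h /=; rewrite addr0 scale0r add0r -[h *: 1]/(h * 1) mulr1.
Qed.

Lemma is_derive_affine_dir (f : V -> R) (x v : V) (c : R) :
  (forall h : R, f (h *: v + x) = c * h + f x) -> is_derive x v f c.
Proof.
move=> fh; apply: is_derive_line; under eq_fun do rewrite fh.
exact: is_derive_linear.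
Qed.

Lemma is_derive_along (f : V -> R) (x v : V) (df : V -> R) (r : R) :
  (forall y, is_derive y v f (df y)) ->
  is_derive r (1 : R) (fun h : R => f (h *: v + x)) (df (r *: v + x)).
Proof.
move=> /(_ (r *: v + x))[D E].
have e : (fun h : R => h^-1 *: (((fun h : R => f (h *: v + x)) \o shift r) (h *: 1) -
      f (r *: v + x))) =
    (fun h : R => h^-1 *: ((f \o shift (r *: v + x)) (h *: v) - f (r *: v + x))).
  by apply/funext => h /=; rewrite -[h *: 1]/(h * 1) mulr1 scalerDl addrA.
by split; [rewrite /derivable e|rewrite /derive e].
Qed.

Context d (Y : measurableType d) (mu : {measure set Y -> \bar R}).

(** Restricted to the line [x + h v], this is differentiation under the integral in one real
    variable. The hypotheses are asked only for [|h| < e], so that a time derivative can stay within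
    positive times. *)
Lemma is_derive_under_integral (f : V -> Y -> R) (x v : V) (e : R)
    (df : R -> Y -> R) (G : Y -> R) : 0 < e ->
  (forall h, - e < h -> h < e -> mu.-integrable setT (EFin \o f (h *: v + x))) ->
  (forall (h : R) y, - e < h -> h < e ->
    is_derive h (1 : R) (fun h' : R => f (h' *: v + x) y) (df h y)) ->
  mu.-integrable setT (EFin \o G) ->
  (forall h y, - e < h -> h < e -> `|df h y| <= G y) ->
  is_derive x v (fun x' => \int[mu]_y f x' y) (\int[mu]_y df 0 y).
Proof.
move=> e0 fi fd Gi dfG; apply: is_derive_line.
have G0 y : 0 <= G y.
  by rewrite (le_trans _ (dfG 0 y _ _))// oppr_lt0.
have I0 : `]- e, e[%classic 0 by rewrite /= in_itv/= oppr_lt0 e0.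
pose F h y := f (h *: v + x) y.
have Fi h : `]- e, e[%classic h -> mu.-integrable setT (EFin \o F h).
  by rewrite /= in_itv/= => /andP[h1 h2]; exact: fi.
have Fd h y : `]- e, e[%classic h -> [set: Y] y -> derivable (F ^~ y) h 1.
  by rewrite /= in_itv/= => /andP[h1 h2] _; have [] := fd h y h1 h2.
have FG h y : `]- e, e[%classic h -> [set: Y] y -> `|partial1of2 F h y| <= G y.
  rewrite /= in_itv/= => /andP[h1 h2] _; rewrite partial1of2E.
  by have [_ ->] := fd h y h1 h2; exact: dfG.
have D := derivable_under_integral measurableT I0 Fi Fd G0 Gi FG.
have E := differentiation_under_integral measurableT I0 Fi Fd G0 Gi FG.
split => //; rewrite -derive1E E; apply: eq_Rintegral => y _.
have H : is_derive (0 : R) (1 : R) (F ^~ y) (df 0 y) by apply: fd; rewrite ?oppr_lt0.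
by rewrite partial1of2E; case: H.
Qed.

End DirectionalDerivative.

Section FrequencySpace.
Context {R : realType} {k : nat}.
Local Notation T := (measurableTypeR R).
Local Notation rn n := (@lebesgue_rn R n).
Implicit Types (mu : k.-tuple T) (h : k.-tuple T -> R).

Definition nrm mu : R := enorm (rv_of mu).
Definition dotp (sigma : 'rV[R]_k) mu : R := dotrv sigma (rv_of mu).

Lemma dotpE sigma mu : dotp sigma mu = \sum_(i < k) sigma 0 i * tnth mu i.
Proof. by apply: eq_bigr => i _; rewrite mxE. Qed.

Lemma dotrv_ge0 n (u : 'rV[R]_n) : 0 <= dotrv u u.
Proof. by apply: sumr_ge0 => i _; rewrite -expr2 sqr_ge0. Qed.

Lemma sqr_nrm mu : nrm mu ^+ 2 = \sum_(i < k) tnth mu i ^+ 2.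
Proof.
rewrite /nrm /enorm sqr_sqrtr ?dotrv_ge0//.
by apply: eq_bigr => i _; rewrite mxE expr2.
Qed.

Lemma nrm_ge0 mu : 0 <= nrm mu.
Proof. exact: sqrtr_ge0. Qed.

Lemma tnth_le_nrm mu i : `|tnth mu i| <= nrm mu.
Proof.
rewrite -(@ler_pXn2r _ 2)// ?nnegrE ?nrm_ge0// sqr_nrm.
by rewrite real_normK ?num_real// (bigD1 i)//= lerDl sumr_ge0// => j _; exact: sqr_ge0.
Qed.

Lemma nrm_scale (t : R) mu : 0 <= t -> nrm (affine t (fun=> 0) mu) = t * nrm mu.
Proof.
move=> t0; rewrite -[t in RHS](ger0_norm t0) -sqrtr_sqr -sqrtrM ?sqr_ge0//.
congr Num.sqrt; rewrite /dotrv mulr_sumr; apply: eq_bigr => i _.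
by rewrite !mxE tnth_mktuple addr0; ring.
Qed.

Lemma dotp_scale (t : R) sigma mu :
  dotp sigma (affine t (fun=> 0) mu) = t * dotp sigma mu.
Proof.
rewrite !dotpE mulr_sumr; apply: eq_bigr => i _.
by rewrite tnth_mktuple addr0 mulrCA.
Qed.

Lemma measurable_dotp sigma : measurable_fun setT (dotp sigma).
Proof.
rewrite (_ : dotp sigma = fun mu => \sum_(i < k) sigma 0 i * tnth mu i).
  apply: measurable_sum => i; apply: measurable_funM => //.
  exact: measurable_tnth.
by apply/funext => mu; exact: dotpE.
Qed.

Lemma measurable_nrm : measurable_fun setT nrm.
Proof.
rewrite (_ : nrm = fun mu => Num.sqrt (\sum_(i < k) tnth mu i ^+ 2)).
  apply: measurable_fun_sqrt; apply: measurable_sum => i.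
  by apply: measurable_funX; exact: measurable_tnth.
by apply/funext => mu; rewrite -sqr_nrm sqrtr_sqr ger0_norm ?nrm_ge0.
Qed.

(** Each [|mu_i|] is at most the norm, so [c |mu| >= c' (|mu_1| + ... + |mu_k|)] with
    [c' = c / (k+1)], and a product of one-dimensional exponentials dominates. Dividing by [k+1]
    rather than [k] includes [k = 0]. *)
Lemma integrable_expR_nrm (c : R) : 0 < c ->
  (rn k).-integrable setT (EFin \o (fun mu => expR (- (c * nrm mu)))).
Proof.
move=> c0; pose c' := c / k.+1%:R.
have c'0 : 0 < c' by rewrite divr_gt0.
apply: (integrable_dominated measurableT _
  (integrable_rn_prod k (@measurable_expR_abs R c') _ (integrable_expR_abs c'0))) => //.
- apply: measurable_fun_expR; apply: measurableT_comp => //.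
  apply: measurable_funM => //; exact: measurable_nrm.
- move=> mu _; rewrite ger0_norm ?expR_ge0// -expR_sum ler_expR sumrN lerN2.
  rewrite -mulr_sumr /c' mulrAC ler_pdivrMr// -mulrA ler_wpM2l ?(ltW c0)//.
  rewrite mulrC -nat1r mulrDl mul1r ler_wpDl ?nrm_ge0//.
  rewrite mulr_natl -[X in _ *+ X]card_ord -sumr_const.
  by apply: ler_sum => i _; exact: tnth_le_nrm.
Qed.

(** Subexponential growth. The class contains the symbols which differentiation produces, is closed
    under sums and products, and is integrable against [weight], which decays exponentially; every
    derivative of a wave integral is therefore of the same kind. *)
Definition tame h := measurable_fun setT h /\
  forall eps : R, 0 < eps -> exists C, forall mu, `|h mu| <= C * expR (eps * nrm mu).

Lemma tame_cst (c : R) : tame (fun=> c).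
Proof.
split => // eps e0; exists `|c| => mu.
by rewrite ler_peMr// -expR0 ler_expR mulr_ge0 ?nrm_ge0// ltW.
Qed.

Lemma tame_bounded_poly h (a b : R) : measurable_fun setT h -> 0 <= a -> 0 <= b ->
  (forall mu, `|h mu| <= a + b * nrm mu) -> tame h.
Proof.
move=> mh a0 b0 hab; split => // eps e0; exists (a + b / eps) => mu.
apply: (le_trans (hab mu)); rewrite mulrDl lerD//.
  by rewrite ler_peMr// -expR0 ler_expR mulr_ge0 ?nrm_ge0// ltW.
(* The constant [b / eps] comes from [eps r <= e^(eps r)]. *)
rewrite -mulrA ler_wpM2l// mulrC ler_pdivlMr// mulrC.
by rewrite (le_trans _ (expR_ge1Dx _))// lerDr.
Qed.

Lemma tameM h1 h2 : tame h1 -> tame h2 -> tame (fun mu => h1 mu * h2 mu).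
Proof.
move=> [m1 H1] [m2 H2]; split; first exact: measurable_funM.
move=> eps e0; have e20 : 0 < eps / 2 by rewrite divr_gt0.
have [C1 hC1] := H1 _ e20; have [C2 hC2] := H2 _ e20.
exists (C1 * C2) => mu; rewrite normrM [eps]splitr mulrDl expRD mulrACA.
exact: ler_pM.
Qed.

Lemma tameD h1 h2 : tame h1 -> tame h2 -> tame (fun mu => h1 mu + h2 mu).
Proof.
move=> [m1 H1] [m2 H2]; split; first exact: measurable_funD.
move=> eps e0; have [C1 hC1] := H1 _ e0; have [C2 hC2] := H2 _ e0.
by exists (C1 + C2) => mu; rewrite mulrDl (le_trans (ler_normD _ _))// lerD.
Qed.

Lemma tame_norm h : tame h -> tame (fun mu => `|h mu|).
Proof.
move=> [m1 H1]; split; first exact: measurableT_comp.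
by move=> eps e0; have [C1 hC1] := H1 _ e0; exists C1 => mu; rewrite normr_id.
Qed.

Lemma tame_tnth i : tame (fun mu => tnth mu i).
Proof.
apply: (@tame_bounded_poly _ 0 1) => //; first exact: measurable_tnth.
by move=> mu; rewrite add0r mul1r tnth_le_nrm.
Qed.

Lemma tame_shcV (t : R) : 0 < t -> tame (fun mu => (shc t (nrm mu))^-1).
Proof.
move=> t0; apply: (@tame_bounded_poly _ t^-1 0) => //.
- by apply: measurable_fun_inv; apply: measurable_fun_shc; exact: measurable_nrm.
- by rewrite invr_ge0 ltW.
- move=> mu; rewrite mul0r addr0 ger0_norm ?invr_ge0 ?shc_ge0 ?(ltW t0)//.
  by rewrite lef_pV2 ?posrE ?shc_gt0// shc_ge// ltW.
Qed.

(** This is [|mu| coth(t |mu|)]; since [shc t 0 = t], its value at [mu = 0] is the limit [1 / t]. *)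
Definition coth_symbol (t : R) mu := cosh (t * nrm mu) / shc t (nrm mu).

Lemma coth_symbol_ge0 t mu : 0 <= t -> 0 <= coth_symbol t mu.
Proof.
by move=> t0; rewrite divr_ge0 ?shc_ge0// (le_trans _ (cosh_ge1 _)).
Qed.

Lemma measurable_coth_symbol t : measurable_fun setT (coth_symbol t).
Proof.
apply: measurable_funM.
  by apply: measurable_fun_cosh; apply: measurable_funM => //; exact: measurable_nrm.
by apply: measurable_fun_inv; apply: measurable_fun_shc; exact: measurable_nrm.
Qed.

Lemma tame_coth (t : R) : 0 < t -> tame (coth_symbol t).
Proof.
move=> t0; apply: (@tame_bounded_poly _ t^-1 1) => //.
- exact: measurable_coth_symbol.
- by rewrite invr_ge0 ltW.
- move=> mu; rewrite mul1r ger0_norm ?coth_symbol_ge0 ?(ltW t0)//.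
  by rewrite cosh_shc_le ?nrm_ge0.
Qed.

Section Weight.
Variable beta : R.
Hypothesis beta_gt0 : 0 < beta.

Definition weight (t : R) mu : R := shc t (nrm mu) `^ (- beta).

Lemma weight_ge0 t mu : 0 <= weight t mu.
Proof. exact: powR_ge0. Qed.

Lemma measurable_weight t : measurable_fun setT (weight t).
Proof.
apply: (measurableT_comp (measurable_powR (- beta))).
by apply: measurable_fun_shc; exact: measurable_nrm.
Qed.

Lemma powRN_anti (x y : R) : 0 < x -> x <= y -> y `^ (- beta) <= x `^ (- beta).
Proof.
move=> x0 xy; rewrite !powRN lef_pV2 ?posrE ?powR_gt0 ?(lt_le_trans x0)//.
have y0 := lt_le_trans x0 xy.
by apply: ge0_ler_powR => //; rewrite ?nnegrE ltW.
Qed.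

Lemma weight_anti t0 t mu : 0 < t0 -> t0 <= t -> weight t mu <= weight t0 mu.
Proof.
move=> t00 tt0; apply: powRN_anti; first exact: shc_gt0.
exact: shc_homo.
Qed.

(** By [expR_le_shc] the weight decays at rate [beta t / 2 = 2 c]. Half of the rate absorbs the
    growth [e^(c |mu|)] allowed to [h], and the other half remains integrable. *)
Lemma integrable_weight (t : R) h : 0 < t -> tame h ->
  (rn k).-integrable setT (EFin \o (fun mu => `|h mu| * weight t mu)).
Proof.
move=> t0 [mh H]; pose c := beta * t / 4.
have c0 : 0 < c by rewrite !mulr_gt0.
have [C hC] := H c c0.
have C0 : 0 <= C.
  have := le_trans (normr_ge0 _) (hC [tuple of nseq k 0]).
  by rewrite pmulr_lge0// expR_gt0.
pose K := C * (t / 4) `^ (- beta).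
apply: (@integrable_dominated _ _ _ _ _ _ (fun mu => K * expR (- (c * nrm mu)))) => //.
- by apply: measurable_funM; [exact: measurableT_comp|exact: measurable_weight].
- rewrite (_ : _ \o _ = (fun mu => K%:E * (expR (- (c * nrm mu)))%:E)%E)//.
  by apply: integrableZl => //; exact: integrable_expR_nrm.
- move=> mu _; rewrite ger0_norm ?mulr_ge0 ?weight_ge0//.
  have wl : weight t mu <= (t / 4) `^ (- beta) * expR (- (c *+ 2 * nrm mu)).
    rewrite (_ : - (c *+ 2 * nrm mu) = (t * nrm mu / 2) * - beta); last first.
      by rewrite /c mulr2n; field.
    rewrite expRM -powRM ?expR_ge0//; last by rewrite divr_ge0// ltW.
    apply: powRN_anti; first by rewrite mulr_gt0 ?expR_gt0 ?divr_gt0.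
    by rewrite expR_le_shc ?nrm_ge0.
  rewrite (le_trans (ler_pM (normr_ge0 _) (weight_ge0 _ _) (hC mu) wl))//.
  rewrite mulrACA /K ler_wpM2l ?mulr_ge0 ?powR_ge0// -expRD ler_expR.
  by rewrite mulr2n; lra.
Qed.


Context {m : nat}.
Local Notation pt := (pt R m k).
Implicit Types (x : pt) (t th : R).

Definition sqr_radius x : R := enorm x.1.1 ^+ 2 + x.2 ^+ 2.

Lemma sqr_radius_ge0 x : 0 <= sqr_radius x.
Proof. by rewrite addr_ge0 ?sqr_ge0. Qed.

(** Half of the first derivative of [sqr_radius] along coordinate [i]; [is_radial] is half of the
    second one, and [frequency] is the derivative of the phase. With them a single differentiation
    lemma covers [z], [sigma] and [y]. *)
Definition radial_coord (i : @coordinate m k) x : R :=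
  match i with inl (inl j) => x.1.1 0 j | inl (inr _) => 0 | inr _ => x.2 end.

Definition is_radial (i : @coordinate m k) : R :=
  match i with inl (inr _) => 0 | _ => 1 end.

Definition frequency (i : @coordinate m k) mu : R :=
  match i with inl (inr l) => tnth mu l | _ => 0 end.

Lemma sqr_enorm n (u : 'rV[R]_n) : enorm u ^+ 2 = \sum_(j < n) u 0 j ^+ 2.
Proof. by rewrite /enorm sqr_sqrtr ?dotrv_ge0//; apply: eq_bigr => j _; rewrite expr2. Qed.

Lemma sqr_radius_dirv i x (h : R) : sqr_radius (h *: dirv i + x) =
  sqr_radius x + 2 * h * radial_coord i x + is_radial i * h ^+ 2.
Proof.
rewrite /sqr_radius; case: i => [[j|l]|[]] /=; rewrite !sqr_enorm /=.
- rewrite scaler0 add0r (bigD1 j)//= [in RHS](bigD1 j)//= !mxE !eqxx/=.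
  under eq_bigr => i ij do rewrite !mxE eqxx/= (negPf ij) mulr0 add0r.
  by ring.
- by rewrite !scaler0 !add0r; ring.
- by rewrite !scaler0 !add0r -[h *: 1]/(h * 1); ring.
Qed.

Lemma dotp_dirv i x (h : R) mu :
  dotp (h *: dirv i + x).1.2 mu = dotp x.1.2 mu + h * frequency i mu.
Proof.
rewrite !dotpE; case: i => [[j|l]|[]] /=; rewrite ?scaler0 ?add0r ?mulr0 ?addr0//.
rewrite (bigD1 l)//= [in RHS](bigD1 l)//= !mxE !eqxx/=.
under eq_bigr => i il do rewrite !mxE eqxx/= (negPf il) mulr0 add0r.
by ring.
Qed.

Lemma tame_frequency i : tame (frequency i).
Proof.
by case: i => [[j|l]|[]]; [exact: tame_cst|exact: tame_tnth|exact: tame_cst].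
Qed.

Definition modulus t x mu : R :=
  weight t mu * expR (- (sqr_radius x / 4 * coth_symbol t mu)).

Lemma modulus_ge0 t x mu : 0 <= modulus t x mu.
Proof. by rewrite mulr_ge0 ?weight_ge0 ?expR_ge0. Qed.

Lemma modulus_le t x mu : 0 < t -> modulus t x mu <= weight t mu.
Proof.
move=> t0; rewrite ler_piMr ?weight_ge0// expR_le1 oppr_le0.
rewrite mulr_ge0//; last exact/coth_symbol_ge0/ltW.
by rewrite divr_ge0// sqr_radius_ge0.
Qed.

Lemma measurable_modulus t x : measurable_fun setT (modulus t x).
Proof.
apply: measurable_funM; first exact: measurable_weight.
apply: measurable_fun_expR; apply: measurableT_comp => //.
apply: measurable_funM => //; exact: measurable_coth_symbol.
Qed.

(** A symbol [h] and a phase [th] in front of the common modulus; the phases [0] and [pi/2] give the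
    two parts of [h e^(-i<sigma,mu>)] times the modulus. *)
Definition wave t h th x mu : R := h mu * modulus t x mu * cos (dotp x.1.2 mu + th).

Definition waveint t h th x : R := \int[rn k]_mu wave t h th x mu.

Lemma measurable_wave t h th x : measurable_fun setT h ->
  measurable_fun setT (wave t h th x).
Proof.
move=> mh; apply: measurable_funM.
  by apply: measurable_funM => //; exact: measurable_modulus.
by apply: measurable_fun_cos; apply: measurable_funD => //; exact: measurable_dotp.
Qed.

Lemma wave_le t h th x mu : 0 < t -> `|wave t h th x mu| <= `|h mu| * weight t mu.
Proof.
move=> t0; rewrite /wave normrM normrM -[leRHS]mulr1 ler_pM ?mulr_ge0 ?cos_max//.
by rewrite ler_wpM2l// ger0_norm ?modulus_ge0// modulus_le.
Qed.

Lemma integrable_wave t h th x : 0 < t -> tame h ->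
  (rn k).-integrable setT (EFin \o wave t h th x).
Proof.
move=> t0 hh; apply: (integrable_dominated measurableT _ (integrable_weight t0 hh)).
  by apply: measurable_wave; case: hh.
by move=> mu _; exact: wave_le.
Qed.

Lemma waveintD t h1 h2 th x : 0 < t -> tame h1 -> tame h2 ->
  waveint t (fun mu => h1 mu + h2 mu) th x = waveint t h1 th x + waveint t h2 th x.
Proof.
move=> t0 hh1 hh2; rewrite /waveint -RintegralD//; try exact: integrable_wave.
by apply: eq_Rintegral => mu _; rewrite /wave !mulrDl.
Qed.

Lemma waveintZ t h th x c : 0 < t -> tame h ->
  waveint t (fun mu => c * h mu) th x = c * waveint t h th x.
Proof.
move=> t0 hh; rewrite /waveint -RintegralZl//; last exact: integrable_wave.
by apply: eq_Rintegral => mu _; rewrite /wave !mulrA.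
Qed.

Lemma waveint_eq t h1 h2 th x : (forall mu, h1 mu = h2 mu) ->
  waveint t h1 th x = waveint t h2 th x.
Proof. by move=> e; congr waveint; apply/funext. Qed.

(** Along a coordinate direction the exponent is quadratic and the phase affine in the increment.
    The modulus is bounded by [weight] independently of the point, so only the factor brought down
    by the exponent has to be controlled near [x]. *)
Lemma is_derive_waveint t h th i x : 0 < t -> tame h ->
  is_derive x (dirv i) (waveint t h th)
    (- (radial_coord i x / 2) * waveint t (fun mu => h mu * coth_symbol t mu) th x
     + waveint t (fun mu => h mu * frequency i mu) (th + pi / 2) x).
Proof.
move=> t0 hh; have hhc := tameM hh (tame_coth t0); have hhf := tameM hh (tame_frequency i).
pose df (r : R) mu := - ((radial_coord i x + r * is_radial i) / 2) *
    wave t (fun mu => h mu * coth_symbol t mu) th (r *: dirv i + x) mu +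
  wave t (fun mu => h mu * frequency i mu) (th + pi / 2) (r *: dirv i + x) mu.
(* For increments [|r| < 1] the shifted radial coordinate is at most [a] in absolute value. *)
pose a := `|radial_coord i x| + 1.
pose G mu := (a * `|h mu * coth_symbol t mu| + `|h mu * frequency i mu|) * weight t mu.
rewrite (_ : _ + _ = \int[rn k]_mu df 0 mu); last first.
  rewrite /df; under eq_Rintegral do rewrite mul0r addr0 scale0r add0r.
  have i1 := integrable_wave th x t0 hhc.
  have i2 := integrable_wave (th + pi / 2) x t0 hhf.
  rewrite RintegralD//; first by rewrite RintegralZl.
  exact: integrable_mull.
apply: (@is_derive_under_integral _ _ _ _ _ _ x (dirv i) 1 df G); first exact: ltr01.
- by move=> r _ _; exact: integrable_wave.
- move=> r mu _ _; rewrite /df /wave.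
  pose F (u : R) := h mu * (weight t mu *
    expR (- ((sqr_radius x + 2 * u * radial_coord i x + is_radial i * u ^+ 2) / 4 *
    coth_symbol t mu))) * cos (dotp x.1.2 mu + u * frequency i mu + th).
  rewrite (_ : (fun _ => _) = F); last first.
    by apply/funext => u; rewrite /F /modulus sqr_radius_dirv dotp_dirv.
  have d1 : is_derive r 1 (fun u =>
      - ((sqr_radius x + 2 * u * radial_coord i x + is_radial i * u ^+ 2) / 4 * coth_symbol t mu))
     (- ((radial_coord i x + r * is_radial i) / 2 * coth_symbol t mu)).
    have p := is_derive_mul (is_derive_id r 1) (is_derive_id r 1).
    have q := is_derive_add (is_derive_linear r (2 * radial_coord i x) (sqr_radius x))
      (is_derive_mull (is_radial i) p).
    apply: (is_derive_congr (is_derive_opp (is_derive_mulr (coth_symbol t mu)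
      (is_derive_mulr 4^-1 q)))); last by field.
    by move=> u; field.
  have d2 : is_derive r 1 (fun u => dotp x.1.2 mu + u * frequency i mu + th) (frequency i mu).
    apply: (is_derive_congr (is_derive_linear r (frequency i mu) (dotp x.1.2 mu + th))) => //.
    by move=> u; ring.
  have d3 := is_derive_mul (is_derive_mull (h mu) (is_derive_mull (weight t mu)
    (is_derive_comp1 (is_derive_expR _) d1))) (is_derive_comp1 (is_derive_cos _) d2).
  apply: (is_derive_congr d3) => //.
  by rewrite /modulus sqr_radius_dirv dotp_dirv addrA cosDpihalf; ring.
- rewrite (_ : EFin \o G = (fun mu =>
      (EFin \o (fun mu => `|a * `|h mu * coth_symbol t mu| + `|h mu * frequency i mu| | * weight t mu)) mu)).
    apply: integrable_weight => //; apply: tameD; last exact: tame_norm.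
    by apply: tameM; [exact: tame_cst|exact: tame_norm].
  apply/funext => mu /=; rewrite ger0_norm// addr_ge0// mulr_ge0// addr_ge0//.
- move=> r mu r1 r2; rewrite /df /G [leRHS]mulrDl (le_trans (ler_normD _ _))// lerD//.
    rewrite normrM -mulrA ler_pM//; last by apply: wave_le.
    rewrite normrN normrM (@ger0_norm _ 2^-1)// ler_pdivrMr// (le_trans (ler_normD _ _))//.
    have h1 : `|r * is_radial i| <= 1.
      have r3 : `|r| <= 1 by rewrite ltW// ltr_norml r1 r2.
      by case: (i) => [[]|] * /=; rewrite ?mulr1 ?mulr0 ?normr0.
    by have := normr_ge0 (radial_coord i x); rewrite /a; lra.
  exact: wave_le.
Qed.

(** The logarithmic derivative of [modulus] in [t]. *)
Definition heat_symbol t x mu : R :=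
  - beta * coth_symbol t mu + sqr_radius x / 4 * (shc t (nrm mu)) ^- 2.

Lemma tame_heat_symbol t x : 0 < t -> tame (heat_symbol t x).
Proof.
move=> t0; apply: tameD.
  by apply: tameM; [exact: tame_cst|exact: tame_coth].
apply: tameM; first exact: tame_cst.
have := tameM (tame_shcV t0) (tame_shcV t0).
by congr tame; apply/funext => mu; rewrite -expr2 exprVn.
Qed.

Lemma is_derive_weight t mu : 0 < t ->
  is_derive t 1 (weight^~ mu) (weight t mu * (- beta * coth_symbol t mu)).
Proof.
move=> t0; have S0 := shc_gt0 (nrm mu) t0.
have := @is_derive_comp1 _ (fun y : R => y `^ (- beta)) (shc ^~ (nrm mu)) t _ _
  (is_derive1_powR (- beta) S0) (is_derive_shc t (nrm mu)).
rewrite (_ : - beta * _ * _ = weight t mu * (- beta * coth_symbol t mu))//.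
rewrite /weight /coth_symbol powRB ?powRr1 ?ltW//; first by field; rewrite gt_eqF.
by rewrite (gt_eqF S0) implybT.
Qed.

(** With [C = cosh(t r)] and [S = shc t r] the derivative of [C / S] is [(r^2 S^2 - C^2) / S^2], and
    [C^2 - r^2 S^2 = 1]. *)
Lemma is_derive_coth_symbol t mu : 0 < t ->
  is_derive t 1 (coth_symbol^~ mu) (- (shc t (nrm mu)) ^- 2).
Proof.
move=> t0; have S0 := shc_gt0 (nrm mu) t0.
have dV := @is_deriveV _ (shc ^~ (nrm mu)) t _ _ (lt0r_neq0 S0) (is_derive_shc t (nrm mu)).
have := is_derive_mul (is_derive_cosh_scale t (nrm mu)) dV.
rewrite (_ : _ + _ = - (shc t (nrm mu)) ^- 2)//.
have := sqr_cosh_shc t (nrm mu); rewrite /GRing.scale/=.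
move: (cosh _) (shc _ _) S0 => C S S0 h.
have -> : C * (- S ^- 2 * C) = - (C ^+ 2) * S ^- 2 by ring.
by rewrite h; field; rewrite gt_eqF.
Qed.

(** Times at distance less than [t/2] from [t] exceed [t/2]. There the weight is at most
    [weight (t/2)], the coth symbol at most [(t/2)^-1 + |mu|], and [shc] at least [t/2]; these
    bounds make up [H]. *)
Lemma is_derive_waveint_time t th x : 0 < t ->
  is_derive t 1 (fun r => waveint r (fun=> 1) th x) (waveint t (heat_symbol t x) th x).
Proof.
move=> t0; have t20 : 0 < t / 2 by rewrite divr_gt0.
pose df (r : R) mu := wave (r * 1 + t) (heat_symbol (r * 1 + t) x) th x mu.
pose H (mu : k.-tuple T) := beta * ((t / 2)^-1 + 1 * nrm mu) + sqr_radius x / 4 * (t / 2) ^- 2.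
pose G mu := H mu * weight (t / 2) mu.
rewrite (_ : waveint _ _ _ _ = \int[rn k]_mu df 0 mu); last first.
  by apply: eq_Rintegral => mu _; rewrite /df mul0r add0r.
have pos r : - (t / 2) < r -> t / 2 <= r * 1 + t.
  by rewrite mulr1 => h; rewrite (_ : t / 2 = - (t / 2) + t) ?lerD2r ?ltW//; field.
have H0 mu : 0 <= H mu.
  rewrite addr_ge0// mulr_ge0 ?(ltW beta_gt0)//.
  - by rewrite addr_ge0 ?invr_ge0 ?mul1r ?nrm_ge0// ltW.
  - by rewrite divr_ge0// sqr_radius_ge0.
  - by rewrite invr_ge0 exprn_ge0// ltW.
have tH : tame H.
  apply: tameD; last exact: tame_cst.
  apply: tameM; first exact: tame_cst.
  apply: (@tame_bounded_poly _ (t / 2)^-1 1) => //.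
  - by apply: measurable_funD => //; apply: measurable_funM => //; exact: measurable_nrm.
  - by rewrite invr_ge0 ltW.
  - move=> mu; rewrite ger0_norm// addr_ge0 ?mul1r ?nrm_ge0//.
    by rewrite invr_ge0 ltW.
apply: (@is_derive_under_integral _ _ _ _ _ (fun r mu => wave r (fun=> 1) th x mu) t 1 (t / 2) df G) => //.
- move=> r /pos h _; apply: integrable_wave; last exact: tame_cst.
  exact: lt_le_trans h.
- move=> r mu /pos h _; have r0 : 0 < r * 1 + t by exact: lt_le_trans h.
  have d1 := is_derive_mul (is_derive_weight mu r0)
    (is_derive_comp1 (is_derive_expR _) (is_derive_opp
      (is_derive_mull (sqr_radius x / 4) (is_derive_coth_symbol mu r0)))).
  have d2 := is_derive_mulr (cos (dotp x.1.2 mu + th)) (is_derive_mull 1 d1).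
  pose F y := 1 * (weight y mu * expR (- (sqr_radius x / 4 * coth_symbol y mu))) *
    cos (dotp x.1.2 mu + th).
  rewrite -[r * 1]mulrC in d2.
  apply: (is_derive_congr (@is_derive_comp1 _ F (fun y => 1 * y + t) r _ _ d2
    (is_derive_linear r 1 t))).
    by move=> u; rewrite /F /wave /modulus -[u *: 1]/(u * 1) mulr1 !mul1r.
  by rewrite /df (mulrC r 1) /wave /modulus /heat_symbol; ring.
- rewrite (_ : EFin \o G = EFin \o (fun mu => `|H mu| * weight (t / 2) mu)).
    exact: integrable_weight.
  by apply/funext => mu /=; rewrite ger0_norm.
- move=> r mu /pos h _; have r0 : 0 < r * 1 + t by exact: lt_le_trans h.
  apply: (le_trans (wave_le (heat_symbol (r * 1 + t) x) th x mu r0)).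
  apply: ler_pM; [exact: normr_ge0|exact: weight_ge0| |exact: weight_anti].
  rewrite (le_trans (ler_normD _ _))// lerD//.
    rewrite mulNr normrN ger0_norm; last first.
      by apply: mulr_ge0; [exact: ltW|exact/coth_symbol_ge0/ltW].
    rewrite ler_wpM2l ?(ltW beta_gt0)// (le_trans (cosh_shc_le r0 (nrm_ge0 _)))//.
    by rewrite mul1r lerD2r lef_pV2 ?posrE.
  rewrite ger0_norm; last first.
    by rewrite mulr_ge0 ?divr_ge0 ?sqr_radius_ge0// invr_ge0 exprn_ge0 ?shc_ge0// ltW.
  rewrite ler_wpM2l ?divr_ge0 ?sqr_radius_ge0// lef_pV2 ?posrE ?exprn_gt0 ?shc_gt0//.
  rewrite ler_pXn2r ?nnegrE ?shc_ge0 ?(ltW r0) ?(ltW t20)//.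
  by rewrite (le_trans h)// shc_ge// ltW.
Qed.

End Weight.
End FrequencySpace.

(** * Heisenberg-type algebra *)

Section HeisenbergAlgebra.
Context {R : realType} {g : vectType R}.
Variables (br : {bilinear g -> g -> g}) (ip : {dot g for idfun}).
Variables (V1 V2 : {vspace g}).
Hypothesis br_alt : forall x, br x x = 0.
Variables (J : subvs_of V2 -> 'End(subvs_of V1)).
Hypothesis hJ : kaplan_map br ip J.
Hypothesis hH : heisenberg_type ip J.
Implicit Types (u v w : subvs_of V1) (sigma tau : subvs_of V2).

Local Notation ip1 u v := (ip (vsval u) (vsval v)).

Lemma dotC x y : ip x y = ip y x.
Proof. by rewrite hermC expr0 mul1r. Qed.

Lemma br_anti x y : br x y = - br y x.
Proof.
apply/eqP; rewrite -addr_eq0; have := br_alt (x + y).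
by rewrite linearDl !linearDr !br_alt add0r addr0 => ->.
Qed.

Lemma kaplan_skew sigma v w : ip1 (J sigma v) w = - ip1 (J sigma w) v.
Proof. by rewrite !hJ br_anti linearNl. Qed.

Lemma kaplan_alt sigma v : ip1 (J sigma v) v = 0.
Proof. by rewrite hJ br_alt linear0l. Qed.

Lemma kaplan_norm sigma v : ip1 (J sigma v) (J sigma v) = ip1 sigma sigma * ip1 v v.
Proof.
rewrite kaplan_skew -[J sigma (J sigma v)]comp_lfunE hH scale_lfunE id_lfunE.
by rewrite linearZ/= linearZl_LR/= mulNr opprK.
Qed.

Lemma vsvalD (V : {vspace g}) (s s' : subvs_of V) :
  vsval (s + s') = vsval s + vsval s'.
Proof. exact: linearD. Qed.

(** Polarisation of [kaplan_norm] in [sigma]. *)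
Lemma kaplan_dot sigma tau v :
  ip1 (J sigma v) (J tau v) = ip1 sigma tau * ip1 v v.
Proof.
pose B s t := ip1 (J s v) (J t v).
have BC s t : B s t = B t s by exact: dotC.
have BD s s' t : B (s + s') t = B s t + B s' t.
  by rewrite /B !hJ vsvalD linearDr.
have := kaplan_norm (sigma + tau) v.
rewrite -/(B _ _) BD BC [B tau _]BC !BD.
rewrite vsvalD linearDl !linearDr [B tau sigma]BC.
have -> : B sigma sigma = ip1 sigma sigma * ip1 v v by exact: kaplan_norm.
have -> : B tau tau = ip1 tau tau * ip1 v v by exact: kaplan_norm.
have key (a b b' c n d : R) : b' = b ->
    a * n + d + (d + c * n) = (a + b + (b' + c)) * n -> d = b * n.
  by move=> ->; lra.
by apply: key; exact: dotC.
Qed.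

Variables (m k : nat) (e : m.-tuple (subvs_of V1)) (eps : k.-tuple (subvs_of V2)).
Hypotheses (he : orthonormal_basis ip e) (heps : orthonormal_basis ip eps).

Local Notation zv := (zvec e).

Lemma dot_zvec z j : ip1 (zv z) (tnth e j) = z 0 j.
Proof.
rewrite /zvec linear_sum linear_sumlz (bigD1 j)//= big1 ?addr0.
  by rewrite linearZl_LR/= (he.2 j j) eqxx mulr1.
by move=> i ij; rewrite linearZl_LR/= (he.2 i j) (negPf ij) mulr0.
Qed.

Lemma zvec_dot u : u = zv (\row_j ip1 u (tnth e j)).
Proof.
have := coord_basis he.1 (memvf u) => ue.
rewrite {1}ue; apply: eq_bigr => j _; rewrite mxE; congr (_ *: _); last first.
  by rewrite (tnth_nth 0).
rewrite [in RHS]ue linear_sum linear_sumlz (bigD1 j)//= big1 ?addr0.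
  by rewrite linearZl_LR/= -tnth_nth (he.2 j j) eqxx mulr1.
by move=> i ij; rewrite linearZl_LR/= -tnth_nth (he.2 i j) (negPf ij) mulr0.
Qed.

Lemma parseval u w : \sum_(j < m) ip1 u (tnth e j) * ip1 w (tnth e j) = ip1 u w.
Proof.
rewrite [in RHS](zvec_dot w) /zvec linear_sum linear_sumr.
by apply: eq_bigr => j _; rewrite linearZr_LR/= mxE mulrC.
Qed.

(** Twice the coefficient of the derivative in [sigma_l] in the [j]-th horizontal field. *)
Definition drift (l : 'I_k) (j : 'I_m) (z : 'rV[R]_m) : R :=
  ip1 (J (tnth eps l) (zv z)) (tnth e j).

Lemma zvecD z z' : zv (z + z') = zv z + zv z'.
Proof. by rewrite -big_split/=; apply: eq_bigr => i _; rewrite mxE scalerDl. Qed.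

Lemma zvecZ a z : zv (a *: z) = a *: zv z.
Proof. by rewrite scaler_sumr; apply: eq_bigr => i _; rewrite mxE scalerA. Qed.

Lemma zvec_delta j : zv (delta_mx 0 j) = tnth e j.
Proof.
rewrite /zvec (bigD1 j)//= big1 ?addr0; first by rewrite mxE !eqxx scale1r.
by move=> i ij; rewrite mxE eqxx (negPf ij) scale0r.
Qed.

Lemma drift_line l j a z z' : drift l j (a *: z + z') = a * drift l j z + drift l j z'.
Proof.
rewrite /drift zvecD zvecZ linearD linearZ/=.
by rewrite linearDl linearZl_LR.
Qed.

(** Skew-symmetry of [J]: the coefficients of the [j]-th horizontal field do not depend on [z_j], so
    squaring the field creates no first-order term in [sigma]. *)
Lemma drift_delta l j : drift l j (delta_mx 0 j) = 0.
Proof. by rewrite /drift zvec_delta kaplan_alt. Qed.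

Lemma drift0 l j : drift l j 0 = 0.
Proof. by have := drift_line l j (-1) 0 0; rewrite scaler0 addr0 mulN1r addNr. Qed.

(** The sum is [<J(eps_l) z, z>]: the rotation field [Theta_l] annihilates functions of [|z|]. *)
Lemma sum_drift_coord l z : \sum_(j < m) drift l j z * z 0 j = 0.
Proof.
under eq_bigr => j _ do rewrite -(dot_zvec z j).
by rewrite parseval kaplan_alt.
Qed.

(** The vectors [J(eps_l) z] are orthogonal of length [|z|]; this is the origin of the term
    [|z|^2 / 4] times the Laplacian in [sigma]. *)
Lemma sum_drift2 l l' z :
  \sum_(j < m) drift l j z * drift l' j z = (l == l')%:R * \sum_(j < m) z 0 j ^+ 2.
Proof.
rewrite parseval kaplan_dot (heps.2 l l') -parseval.
by congr (_ * _); apply: eq_bigr => j _; rewrite dot_zvec expr2.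
Qed.

End HeisenbergAlgebra.

(** * The heat equation *)

Section ComplexPartial.
Context {R : realType} {m k : nat}.
Local Notation pt := (pt R m k).
Implicit Types (f g : pt -> R) (x : pt).

Lemma cpartialE i f g (df dg : pt -> R) :
  (forall x, is_derive x (dirv i) f (df x)) ->
  (forall x, is_derive x (dirv i) g (dg x)) ->
  cpartial i (fun x => f x +i* g x) = (fun x => df x +i* dg x).
Proof.
move=> fd gd; apply/funext => x; rewrite /cpartial.
have -> : (@complex.Re R \o (fun x => f x +i* g x)) = f by [].
have -> : (@complex.Im R \o (fun x => f x +i* g x)) = g by [].
by have [_ ->] := fd x; have [_ ->] := gd x.
Qed.

Lemma cderivableE i f g x a b : is_derive x (dirv i) f a ->
  is_derive x (dirv i) g b -> cderivable i (fun x => f x +i* g x) x.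
Proof. by move=> [fd _] [gd _]; split. Qed.

Lemma addcE (a b c d : R) : (a +i* b) + (c +i* d) = (a + c) +i* (b + d).
Proof. by []. Qed.

Lemma realcM (r a b : R) : r%:C * (a +i* b) = (r * a) +i* (r * b).
Proof. by apply/eqP; rewrite eq_complex /=; apply/andP; split; apply/eqP; ring. Qed.

Lemma sumcE (I : finType) (a b : I -> R) :
  \sum_i (a i +i* b i) = (\sum_i a i) +i* (\sum_i b i).
Proof.
by rewrite -[LHS]/(\sum_i (a i +i* b i)); elim/big_rec3 : _ => // i x y z _ ->.
Qed.

End ComplexPartial.

Section HeatEquation.
Context {R : realType} {g : vectType R}.
Variables (br : {bilinear g -> g -> g}) (ip : {dot g for idfun}).
Variables (V1 V2 : {vspace g}).
Hypothesis br_alt : forall x, br x x = 0.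
Variables (J : subvs_of V2 -> 'End(subvs_of V1)).
Hypothesis hJ : kaplan_map br ip J.
Hypothesis hH : heisenberg_type ip J.
Context {m k : nat}.
Variables (e : m.-tuple (subvs_of V1)) (eps : k.-tuple (subvs_of V2)).
Hypotheses (he : orthonormal_basis ip e) (heps : orthonormal_basis ip eps).
Variable s : R.
Let beta : R := m%:R / 2 + 1 - s.
Hypothesis beta_gt0 : 0 < beta.
Local Notation pt := (pt R m k).
Local Notation wi := (waveint beta).
Local Notation dr := (drift ip J e eps).
Implicit Types (x : pt) (h : k.-tuple (measurableTypeR R) -> R) (th : R).

Variable t : R.
Hypothesis t_gt0 : 0 < t.

Local Notation coth := (coth_symbol t).
Local Notation freq l := (fun mu : k.-tuple (measurableTypeR R) => tnth mu l).

Lemma wi0 th x : wi t (fun mu => 0) th x = 0.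
Proof.
rewrite -[RHS](mul0r (wi t (fun mu => 0) th x)) -waveintZ//.
  by apply: waveint_eq => mu; rewrite mul0r.
exact: tame_cst.
Qed.

Lemma wi_mul0 h th x : wi t (fun mu => h mu * 0) th x = 0.
Proof.
rewrite -[RHS](wi0 th x).
by apply: waveint_eq => mu; rewrite mulr0.
Qed.

Lemma is_derive_wi_z h th j x : tame h ->
  is_derive x (dirv (cz j)) (wi t h th)
    (- (x.1.1 0 j / 2) * wi t (fun mu => h mu * coth mu) th x).
Proof.
move=> hh; apply: (is_derive_congr (is_derive_waveint beta_gt0 th (cz j) x t_gt0 hh)) => //=.
by rewrite wi_mul0 addr0.
Qed.

Lemma is_derive_wi_y h th x : tame h ->
  is_derive x (dirv cy) (wi t h th)
    (- (x.2 / 2) * wi t (fun mu => h mu * coth mu) th x).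
Proof.
move=> hh; apply: (is_derive_congr (is_derive_waveint beta_gt0 th cy x t_gt0 hh)) => //=.
by rewrite wi_mul0 addr0.
Qed.

Lemma is_derive_wi_s h th l x : tame h ->
  is_derive x (dirv (cs l)) (wi t h th)
    (wi t (fun mu => h mu * tnth mu l) (th + pi / 2) x).
Proof.
move=> hh; apply: (is_derive_congr (is_derive_waveint beta_gt0 th (cs l) x t_gt0 hh)) => //=.
by rewrite mul0r oppr0 mul0r add0r.
Qed.

Lemma wi_pi h th x : tame h -> wi t h (th + pi / 2 + pi / 2) x = - wi t h th x.
Proof.
move=> hh; rewrite -mulN1r -waveintZ//; apply: eq_Rintegral => mu _.
by rewrite /wave !addrA !cosDpihalf sinDpihalf; ring.
Qed.

(** The [j]-th horizontal field applied to a real wave integral; [hfield2] is the result of applying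
    the field twice. *)
Definition hfield1 (j : 'I_m) h th x : R :=
  - (x.1.1 0 j / 2) * wi t (fun mu => h mu * coth mu) th x +
  2^-1 * \sum_(l < k) dr l j x.1.1 * wi t (fun mu => h mu * tnth mu l) (th + pi / 2) x.

Lemma is_derive_drift l j i x : is_derive x (dirv i) (fun x : pt => dr l j x.1.1)
  (dr l j (dirv i : pt).1.1).
Proof.
apply: is_derive_affine_dir => r.
by rewrite mulrC -drift_line.
Qed.

Lemma is_derive_sumr n (f : 'I_n -> pt -> R) x v (df : 'I_n -> R) :
  (forall i, is_derive x v (f i) (df i)) ->
  is_derive x v (fun y => \sum_(i < n) f i y) (\sum_(i < n) df i).
Proof.
move=> fd; apply: (is_derive_congr (is_derive_sum fd)) => // y.
by rewrite fct_sumE.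
Qed.

Lemma tame_coth_mul h : tame h -> tame (fun mu => h mu * coth mu).
Proof. by move=> hh; apply: tameM => //; exact: tame_coth. Qed.

Lemma tame_freq_mul h l : tame h -> tame (fun mu => h mu * tnth mu l).
Proof. by move=> hh; apply: tameM => //; exact: tame_tnth. Qed.

Lemma is_derive_coord_z j (x : pt) :
  is_derive x (dirv (cz j)) (fun x : pt => x.1.1 0 j) 1.
Proof.
by apply: is_derive_affine_dir => r /=; rewrite !mxE !eqxx mulr1 mul1r.
Qed.

Lemma is_derive_hfield1_z j h th x : tame h ->
  is_derive x (dirv (cz j)) (hfield1 j h th)
   (- 2^-1 * wi t (fun mu => h mu * coth mu) th x
    + x.1.1 0 j ^+ 2 / 4 * wi t (fun mu => h mu * coth mu * coth mu) th x
    + 2^-1 * \sum_(l < k) dr l j x.1.1 * (- (x.1.1 0 j / 2) *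
        wi t (fun mu => h mu * tnth mu l * coth mu) (th + pi / 2) x)).
Proof.
move=> hh.
have d1 := is_derive_mul (is_derive_opp (is_derive_mulr 2^-1 (is_derive_coord_z j x)))
  (is_derive_wi_z th j x (tame_coth_mul hh)).
have d2 := is_derive_mull 2^-1 (is_derive_sumr (fun l : 'I_k => is_derive_mul
  (is_derive_drift l j (cz j) x) (is_derive_wi_z (th + pi / 2) j x (tame_freq_mul l hh)))).
apply: (is_derive_congr (is_derive_add d1 d2)) => //.
congr (_ + _ * _); first by field.
apply: eq_bigr => l _ /=; rewrite (drift_delta br_alt hJ) mul0r addr0//.
Qed.

Lemma is_derive_hfield1_s j l h th x : tame h ->
  is_derive x (dirv (cs l)) (hfield1 j h th)
   (- (x.1.1 0 j / 2) * wi t (fun mu => h mu * tnth mu l * coth mu) (th + pi / 2) x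
    + 2^-1 * \sum_(l' < k) dr l' j x.1.1 *
        wi t (fun mu => h mu * tnth mu l' * tnth mu l) (th + pi / 2 + pi / 2) x).
Proof.
move=> hh.
have d0 : is_derive x (dirv (cs l)) (fun x : pt => x.1.1 0 j) 0.
  by apply: is_derive_affine_dir => r /=; rewrite scaler0 add0r mul0r add0r.
have d1 := is_derive_mul (is_derive_opp (is_derive_mulr 2^-1 d0))
  (is_derive_wi_s th l x (tame_coth_mul hh)).
have d2 := is_derive_mull 2^-1 (is_derive_sumr (fun l' : 'I_k => is_derive_mul
  (is_derive_drift l' j (cs l) x) (is_derive_wi_s (th + pi / 2) l x (tame_freq_mul l' hh)))).
apply: (is_derive_congr (is_derive_add d1 d2)) => //.
rewrite mul0r oppr0 mul0r addr0; congr (_ * _ + _ * _).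
  by apply: waveint_eq => mu; rewrite mulrAC.
apply: eq_bigr => l' _ /=; rewrite (drift0 ip J e eps l' j) mul0r addr0//.
Qed.

Definition hfield2 (j : 'I_m) h th x : R :=
  - 2^-1 * wi t (fun mu => h mu * coth mu) th x
  + x.1.1 0 j ^+ 2 / 4 * wi t (fun mu => h mu * coth mu * coth mu) th x
  + 2^-1 * \sum_(l < k) dr l j x.1.1 * (- (x.1.1 0 j / 2) *
      wi t (fun mu => h mu * tnth mu l * coth mu) (th + pi / 2) x)
  + 2^-1 * \sum_(l < k) dr l j x.1.1 *
    (- (x.1.1 0 j / 2) * wi t (fun mu => h mu * tnth mu l * coth mu) (th + pi / 2) x
    + 2^-1 * \sum_(l' < k) dr l' j x.1.1 *
        wi t (fun mu => h mu * tnth mu l' * tnth mu l) (th + pi / 2 + pi / 2) x).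

Lemma sum_hfield2 h th x : tame h ->
  \sum_(j < m) hfield2 j h th x =
  - (m%:R / 2) * wi t (fun mu => h mu * coth mu) th x
  + enorm x.1.1 ^+ 2 / 4 * (wi t (fun mu => h mu * coth mu * coth mu) th x
    - \sum_(l < k) wi t (fun mu => h mu * tnth mu l * tnth mu l) th x).
Proof.
move=> hh; rewrite sqr_enorm /hfield2.
set P := wi t _ th x; set Q := wi t _ th x.
pose S l := wi t (fun mu => h mu * tnth mu l * coth mu) (th + pi / 2) x.
pose W l' l := wi t (fun mu => h mu * tnth mu l' * tnth mu l) (th + pi / 2 + pi / 2) x.
(* The terms mixing [z] and [sigma] cancel in the sum over [j], since [J(eps_l) z] is orthogonal to
   [z]. *)
have SE : \sum_(j < m) \sum_(l < k) dr l j x.1.1 * (- (x.1.1 0 j / 2) * S l) = 0.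
  rewrite exchange_big big1//= => l _.
  transitivity (- 2^-1 * S l * \sum_(j < m) dr l j x.1.1 * x.1.1 0 j).
    by rewrite mulr_sumr; apply: eq_bigr => j _; ring.
  by rewrite (sum_drift_coord br_alt hJ eps he) mulr0.
(* Only the diagonal second derivatives in [sigma] survive, each with the factor [|z|^2]. *)
have WE : \sum_(j < m) \sum_(l < k) dr l j x.1.1 *
    (2^-1 * \sum_(l' < k) dr l' j x.1.1 * W l' l) =
    2^-1 * (\sum_(j < m) x.1.1 0 j ^+ 2) * \sum_(l < k) W l l.
  rewrite exchange_big/= mulr_sumr; apply: eq_bigr => l _.
  transitivity (2^-1 * \sum_(l' < k) (\sum_(j < m) dr l j x.1.1 * dr l' j x.1.1) * W l' l).
    under [in RHS]eq_bigr => l' _ do rewrite mulr_suml.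
    rewrite exchange_big/= mulr_sumr; apply: eq_bigr => j _.
    rewrite !mulr_sumr; apply: eq_bigr => l' _; ring.
  rewrite (bigD1 l)//= [X in _ * (_ + X)]big1 ?addr0.
    by rewrite (sum_drift2 br_alt hJ hH he heps) eqxx mul1r mulrA.
  move=> l' ll'; rewrite (sum_drift2 br_alt hJ hH he heps).
  by rewrite eq_sym (negPf ll') !mul0r.
rewrite !big_split/= -!mulr_sumr -!mulr_suml.
under [X in _ + _ * X = _]eq_bigr => j _.
  under eq_bigr => l _ do rewrite mulrDr.
  rewrite big_split/=; over.
rewrite big_split/= SE WE sumr_const card_ord.
have -> : \sum_(l < k) W l l = - \sum_(l < k) wi t (fun mu => h mu * tnth mu l * tnth mu l) th x.
  rewrite -sumrN; apply: eq_bigr => l _; apply: wi_pi.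
  by do 2 apply: tame_freq_mul.
by rewrite -mulr_natr; field.
Qed.

(** The variable [y] behaves like a radius in dimension [2 - 2 s]: the first-order contributions
    [-1/2], [-(1 - 2 s)/2] and [-m/2] add up to [- beta], while [y^2] and [|z|^2] combine into
    [sqr_radius]. This is how the exponent [beta] is forced. *)
Lemma heat_equation_real h th x : tame h -> x.2 != 0 ->
  (- 2^-1 * wi t (fun mu => h mu * coth mu) th x
   + x.2 ^+ 2 / 4 * wi t (fun mu => h mu * coth mu * coth mu) th x)
  + (1 - 2 * s) / x.2 * (- (x.2 / 2) * wi t (fun mu => h mu * coth mu) th x)
  + x.2 ^+ 2 / 4 * (\sum_(l < k)
      wi t (fun mu => h mu * tnth mu l * tnth mu l) (th + pi / 2 + pi / 2) x)
  + \sum_(j < m) hfield2 j h th x =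
  wi t (fun mu => h mu * heat_symbol beta t x mu) th x.
Proof.
move=> hh y0; rewrite sum_hfield2//.
have -> : \sum_(l < k) wi t (fun mu => h mu * tnth mu l * tnth mu l) (th + pi / 2 + pi / 2) x
    = - \sum_(l < k) wi t (fun mu => h mu * tnth mu l * tnth mu l) th x.
  rewrite -sumrN; apply: eq_bigr => l _; apply: wi_pi.
  by do 2 apply: tame_freq_mul.
set P := wi t _ th x; set Q := wi t _ th x; set Z := \sum_(l < k) _.
transitivity (- beta * P + sqr_radius x / 4 * (Q - Z)).
  by rewrite /sqr_radius /beta; field.
have hc := tame_coth_mul hh; have hcc := tame_coth_mul hc.
have hf l : tame (fun mu => h mu * tnth mu l * tnth mu l) by do 2 apply: tame_freq_mul.
(* Additivity of [waveint] is available for two tame symbols at a time, so tameness of the partial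
   sums is carried through the induction. *)
have Zt : tame (fun mu => h mu * nrm mu ^+ 2) /\ Z = wi t (fun mu => h mu * nrm mu ^+ 2) th x.
  have : tame (fun mu => \sum_(l < k) h mu * tnth mu l * tnth mu l) /\
    Z = wi t (fun mu => \sum_(l < k) h mu * tnth mu l * tnth mu l) th x.
    rewrite /Z; elim: (index_enum _) => [|l r [IH1 IH2]].
      split; first by under eq_fun do rewrite big_nil; exact: tame_cst.
      by rewrite big_nil; under [X in _ = wi t X _ _]eq_fun do rewrite big_nil; rewrite wi0.
    split; first by under eq_fun do rewrite big_cons; exact: tameD.
    rewrite big_cons IH2 -waveintD//.
    by apply: waveint_eq => mu; rewrite big_cons.
  rewrite (_ : (fun mu => \sum_(l < k) _) = (fun mu => h mu * nrm mu ^+ 2))//.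
  apply/funext => mu; rewrite sqr_nrm mulr_sumr.
  by apply: eq_bigr => l _; rewrite -mulrA expr2.
case: Zt => tZ ->.
transitivity (wi t (fun mu => - beta * (h mu * coth mu) +
   sqr_radius x / 4 * (h mu * coth mu * coth mu + - 1 * (h mu * nrm mu ^+ 2))) th x).
  have t1 : tame (fun mu => -1 * (h mu * nrm mu ^+ 2)) by apply: tameM => //; exact: tame_cst.
  have t2 := tameD hcc t1.
  rewrite waveintD//; last 2 first.
    by apply: tameM => //; exact: tame_cst.
    by apply: (tameM (tame_cst _) t2).
  by rewrite !waveintZ// waveintD// waveintZ// mulN1r.
apply: waveint_eq => mu; rewrite /heat_symbol mulrDr.
have S0 := shc_gt0 (nrm mu) t_gt0; have := sqr_cosh_shc t (nrm mu).
rewrite /coth_symbol; move: (cosh _) (shc _ _) S0 => C S S0 E.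
(* Eliminating [|mu|^2] by the hyperbolic identity leaves a rational identity in [C] and [S]. *)
have {E} -> : nrm mu ^+ 2 = (C ^+ 2 - 1) / S ^+ 2 by rewrite E; field; rewrite gt_eqF.
by field; rewrite gt_eqF.
Qed.

Definition cwave h x : R[i] := wi t h 0 x +i* wi t h (pi / 2) x.

Lemma horizontal_fieldE j (f0 f1 a0 a1 : pt -> R) (b0 b1 : 'I_k -> pt -> R) :
  (forall x, is_derive x (dirv (cz j)) f0 (a0 x)) ->
  (forall x, is_derive x (dirv (cz j)) f1 (a1 x)) ->
  (forall l x, is_derive x (dirv (cs l)) f0 (b0 l x)) ->
  (forall l x, is_derive x (dirv (cs l)) f1 (b1 l x)) ->
  horizontal_field ip J e eps j (fun x => f0 x +i* f1 x) =
  (fun x => (a0 x + 2^-1 * \sum_(l < k) dr l j x.1.1 * b0 l x) +i*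
            (a1 x + 2^-1 * \sum_(l < k) dr l j x.1.1 * b1 l x)).
Proof.
move=> fa0 fa1 fb0 fb1; apply/funext => x; rewrite /horizontal_field.
rewrite (cpartialE fa0 fa1).
have half : 2^-1 = (2^-1)%:C :> R[i] by rewrite fmorphV rmorph_nat.
under eq_bigr => l _ do rewrite (cpartialE (fb0 l) (fb1 l)) realcM.
by rewrite half sumcE realcM addcE.
Qed.

Lemma cwave_heat_operator h x : tame h -> x.2 != 0 ->
  extension_operator ip J e eps s (cwave h) x =
  cwave (fun mu => h mu * heat_symbol beta t x mu) x.
Proof.
move=> hh y0; have hc := tame_coth_mul hh.
have dyy th (y : pt) : is_derive y (dirv cy)
    (fun x0 => - (x0.2 / 2) * wi t (fun mu => h mu * coth mu) th x0)
    (- 2^-1 * wi t (fun mu => h mu * coth mu) th y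
     + y.2 ^+ 2 / 4 * wi t (fun mu => h mu * coth mu * coth mu) th y).
  have d2 : is_derive y (dirv cy) (fun y : pt => y.2) 1.
    by apply: is_derive_affine_dir => r /=; rewrite mul1r -[r *: 1]/(r * 1) mulr1.
  apply: (is_derive_congr (is_derive_mul (is_derive_opp (is_derive_mulr 2^-1 d2))
    (is_derive_wi_y th y hc))) => //.
  by field.
have hf1 j : horizontal_field ip J e eps j (cwave h) =
    (fun y => hfield1 j h 0 y +i* hfield1 j h (pi / 2) y).
  exact: (horizontal_fieldE (fun y => is_derive_wi_z 0 j y hh)
    (fun y => is_derive_wi_z (pi / 2) j y hh) (fun l y => is_derive_wi_s 0 l y hh)
    (fun l y => is_derive_wi_s (pi / 2) l y hh)).
have hf2 j : horizontal_field ip J e eps j (horizontal_field ip J e eps j (cwave h)) =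
    (fun y => hfield2 j h 0 y +i* hfield2 j h (pi / 2) y).
  rewrite hf1.
  exact: (horizontal_fieldE (fun y => is_derive_hfield1_z j 0 y hh)
    (fun y => is_derive_hfield1_z j (pi / 2) y hh) (fun l y => is_derive_hfield1_s j l 0 y hh)
    (fun l y => is_derive_hfield1_s j l (pi / 2) y hh)).
rewrite /extension_operator /horizontal_laplacian.
under [X in _ + X = _]eq_bigr => j _ do rewrite hf2.
rewrite (cpartialE (fun y => is_derive_wi_y 0 y hh) (fun y => is_derive_wi_y (pi / 2) y hh)).
rewrite (cpartialE (dyy 0) (dyy (pi / 2))).
under [X in _ + _ * X + _ = _]eq_bigr => l _.
  rewrite (cpartialE (fun y => is_derive_wi_s 0 l y hh) (fun y => is_derive_wi_s (pi / 2) l y hh)).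
  rewrite (cpartialE (fun y => is_derive_wi_s _ l y (tame_freq_mul l hh))
    (fun y => is_derive_wi_s _ l y (tame_freq_mul l hh))).
  over.
rewrite !sumcE !realcM !addcE /cwave -!heat_equation_real//.
Qed.

Lemma is_derive_radial_coord (i j : @coordinate m k) x :
  is_derive x (dirv i) (radial_coord j) (radial_coord j (dirv i)).
Proof.
apply: is_derive_affine_dir => r.
by case: j => [[j|l]|[]] /=; [rewrite !mxE mulrC|rewrite mul0r addr0|rewrite mulrC].
Qed.

Lemma cwave_cderivable h i x : tame h -> cderivable i (cwave h) x.
Proof.
move=> hh; apply: cderivableE.
  exact: (is_derive_waveint beta_gt0 0 i x t_gt0 hh).
exact: (is_derive_waveint beta_gt0 (pi / 2) i x t_gt0 hh).
Qed.

Lemma cwave_cderivable2 h i j x : tame h -> cderivable i (cpartial j (cwave h)) x.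
Proof.
move=> hh; have hc := tame_coth_mul hh; have hf := tameM hh (tame_frequency j).
rewrite (cpartialE (fun y => is_derive_waveint beta_gt0 0 j y t_gt0 hh)
  (fun y => is_derive_waveint beta_gt0 (pi / 2) j y t_gt0 hh)).
by apply: cderivableE; apply: is_derive_add;
  [apply: is_derive_mul; [apply/is_derive_opp/is_derive_mulr/is_derive_radial_coord
    |exact: (is_derive_waveint beta_gt0 _ i x t_gt0 hc)]
  |exact: (is_derive_waveint beta_gt0 _ i x t_gt0 hf)
  |apply: is_derive_mul; [apply/is_derive_opp/is_derive_mulr/is_derive_radial_coord
    |exact: (is_derive_waveint beta_gt0 _ i x t_gt0 hc)]
  |exact: (is_derive_waveint beta_gt0 _ i x t_gt0 hf)].
Qed.

End HeatEquation.

(** * The kernel as a wave integral *)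

Section KernelWave.
Context {R : realType} {m k : nat}.
Variable s : R.
Local Notation T := (measurableTypeR R).
Local Notation pt := (pt R m k).
Let beta : R := m%:R / 2 + 1 - s.
Hypothesis beta_gt0 : 0 < beta.

Lemma kernel_integrandE t (x : pt) (la : k.-tuple T) :
  kernel_integrand s t x (rv_of la) =
  (over_sinh (nrm la) `^ beta *
   expR (- (sqr_radius x / (4 * t) * over_tanh (nrm la))))%:C *
  (cos (dotp x.1.2 la / t + 0) +i* cos (dotp x.1.2 la / t + pi / 2)).
Proof.
rewrite /kernel_integrand /expi addr0 cosDpihalf cosN sinN [t^-1 * _]mulrC.
by apply/eqP; rewrite eq_complex /=; apply/andP; split; apply/eqP;
  rewrite /nrm /dotp /sqr_radius /beta; ring.
Qed.

Lemma over_sinh_weight t (la : k.-tuple T) : 0 < t ->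
  over_sinh (t * nrm la) `^ beta = t `^ beta * weight beta t la.
Proof.
move=> t0; have S0 := shc_gt0 (nrm la) t0.
rewrite over_sinhE// powRM ?invr_ge0 ?(ltW t0) ?(ltW S0)//.
by rewrite /weight -powR_inv1 ?(ltW S0)// -powRrM mulN1r.
Qed.

(** What is left of [2^k / (4 pi t)^(beta + k)] after the substitution [lambda = t mu] has supplied
    [t^k] and [over_sinh (t |mu|)^beta] has supplied [t^beta]. *)
Definition wave_const : R := 2 ^+ k / (4 * pi) `^ (beta + k%:R).

(** Before the frequency is scaled, the hyperbolic factors are [weight beta 1] and [coth_symbol 1]
    for every [t], so the weight at time [1] dominates. *)
Lemma integrable_kernel_part t (x : pt) th : 0 < t ->
  (@lebesgue_rn R k).-integrable setT (EFin \o (fun la : k.-tuple T =>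
    over_sinh (nrm la) `^ beta *
    expR (- (sqr_radius x / (4 * t) * over_tanh (nrm la))) *
    cos (dotp x.1.2 la / t + th))).
Proof.
move=> t0.
have h1 : @tame R k (fun=> 1) := tame_cst 1.
have wE (la : k.-tuple T) : over_sinh (nrm la) `^ beta = weight beta 1 la.
  by rewrite -[nrm la]mul1r over_sinh_weight// powR1 !mul1r.
have cE (la : k.-tuple T) : over_tanh (nrm la) = coth_symbol 1 la.
  by rewrite -[nrm la]mul1r over_tanhE// mul1r /coth_symbol mul1r.
apply: (integrable_dominated measurableT _ (integrable_weight beta_gt0 ltr01 h1)).
- apply: measurable_funM.
    apply: measurable_funM.
      rewrite (_ : (fun _ => _) = @weight _ k beta 1); first exact: measurable_weight.
      by apply/funext => la; exact: wE.
    apply: measurable_fun_expR; apply: measurableT_comp => //.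
    apply: measurable_funM => //.
    rewrite (_ : (fun _ => _) = @coth_symbol _ k 1); first exact: measurable_coth_symbol.
    by apply/funext => la; exact: cE.
  apply: measurable_fun_cos; apply: measurable_funD => //; apply: measurable_funM => //.
  exact: measurable_dotp.
- move=> la _; rewrite wE cE normr1 mul1r normrM.
  rewrite ger0_norm ?mulr_ge0 ?weight_ge0 ?expR_ge0//.
  rewrite (le_trans (ler_piMr _ (cos_max _))) ?mulr_ge0 ?weight_ge0 ?expR_ge0//.
  rewrite ler_piMr ?weight_ge0// expR_le1 oppr_le0 mulr_ge0//.
    by rewrite divr_ge0 ?sqr_radius_ge0// mulr_ge0// ltW.
  exact: coth_symbol_ge0.
Qed.

Lemma Rintegral_kernel_part t (x : pt) th : 0 < t ->
  \int[@lebesgue_rn R k]_la (over_sinh (nrm la) `^ beta *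
    expR (- (sqr_radius x / (4 * t) * over_tanh (nrm la))) *
    cos (dotp x.1.2 la / t + th)) =
  t ^+ k * t `^ beta * waveint beta t (fun=> 1) th x.
Proof.
move=> t0; rewrite (Rintegral_rn_affine (fun=> 0) t0); last exact: integrable_kernel_part.
rewrite -mulrA; congr (_ * _).
rewrite /waveint -RintegralZl//; last exact: (integrable_wave beta_gt0 _ _ t0 (tame_cst 1)).
apply: eq_Rintegral => mu _; rewrite /wave /modulus nrm_scale ?(ltW t0)// over_sinh_weight//.
rewrite over_tanhE// dotp_scale mul1r !mulrA; congr (_ * expR _ * cos (_ + _)).
  by rewrite /coth_symbol; field; rewrite !gt_eqF// shc_gt0.
by rewrite mulrAC divff ?mul1r// gt_eqF.
Qed.

Lemma q_kernelE t (x : pt) : 0 < t -> q_kernel s t x = cwave s t (fun=> wave_const) x.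
Proof.
move=> t0; rewrite /q_kernel /cintegral.
have -> : \int[lebesgue_rn k]_la complex.Re ((kernel_integrand s t x \o @rv_of R k) la) =
    t ^+ k * t `^ beta * waveint beta t (fun=> 1) 0 x.
  rewrite -Rintegral_kernel_part//; apply: eq_Rintegral => la _.
  by rewrite /comp kernel_integrandE realcM.
have -> : \int[lebesgue_rn k]_la complex.Im ((kernel_integrand s t x \o @rv_of R k) la) =
    t ^+ k * t `^ beta * waveint beta t (fun=> 1) (pi / 2) x.
  rewrite -Rintegral_kernel_part//; apply: eq_Rintegral => la _.
  by rewrite /comp kernel_integrandE realcM.
rewrite realcM /cwave.
have E : 2 ^+ k / (4 * pi * t) `^ (m%:R / 2 + k%:R + 1 - s) * (t ^+ k * t `^ beta) = wave_const.
  rewrite (_ : m%:R / 2 + k%:R + 1 - s = beta + k%:R); last by rewrite /beta; ring.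
  have p0 : 0 < 4 * pi :> R by rewrite mulr_gt0// pi_gt0.
  rewrite powRM ?(ltW p0) ?(ltW t0)// [t `^ (_ + _)]powRD; last by rewrite (gt_eqF t0) implybT.
  rewrite powR_mulrn ?(ltW t0)// /wave_const.
  by field; rewrite !gt_eqF ?powR_gt0 ?exprn_gt0.
have W th : waveint beta t (fun=> wave_const) th x = wave_const * waveint beta t (fun=> 1) th x.
  rewrite -(waveintZ beta_gt0)//; last exact: tame_cst.
  by apply: waveint_eq => mu; rewrite mulr1.
by rewrite -/beta !W -E !mulrA.
Qed.

Lemma kernel_cintegrable t (x : pt) : 0 < t ->
  cintegrable (lebesgue_rn k) setT (kernel_integrand s t x \o @rv_of R k).
Proof.
move=> t0; split.
  apply: eq_integrable (integrable_kernel_part x 0 t0) => // la _.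
  by rewrite /comp kernel_integrandE realcM.
apply: eq_integrable (integrable_kernel_part x (pi / 2) t0) => // la _.
by rewrite /comp kernel_integrandE realcM.
Qed.

End KernelWave.

Section SolvesHeat.
Context {R : realType} {g : vectType R}.
Variables (br : {bilinear g -> g -> g}) (ip : {dot g for idfun}).
Variables (V1 V2 : {vspace g}).
Hypothesis br_alt : forall x, br x x = 0.
Variables (J : subvs_of V2 -> 'End(subvs_of V1)).
Hypothesis hJ : kaplan_map br ip J.
Hypothesis hH : heisenberg_type ip J.
Context {m k : nat}.
Variables (e : m.-tuple (subvs_of V1)) (eps : k.-tuple (subvs_of V2)).
Hypotheses (he : orthonormal_basis ip e) (heps : orthonormal_basis ip eps).
Variable s : R.
Hypothesis s_lt1 : s < 1.

Lemma q_kernel_solves : solves_extension_heat ip J e eps s (q_kernel s).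
Proof.
move=> t x t0 y0.
have b0 : 0 < m%:R / 2 + 1 - s by rewrite -addrA ltr_wpDl ?subr_gt0// divr_ge0.
set beta := m%:R / 2 + 1 - s in b0.
have tc : @tame R k (fun=> @wave_const R m k s) := tame_cst _.
have t1 : @tame R k (fun=> 1) := tame_cst _.
have qE : @q_kernel R m k s t = cwave s t (fun=> @wave_const R m k s).
  by apply/funext => y; exact: q_kernelE.
have WE r th : 0 < r -> waveint beta r (fun=> @wave_const R m k s) th x =
    @wave_const R m k s * waveint beta r (fun=> 1) th x.
  move=> r0; rewrite -waveintZ//.
  by apply: waveint_eq => mu; rewrite mulr1.
have dW th : is_derive t 1 (fun r => @wave_const R m k s * waveint beta r (fun=> 1) th x)
    (@wave_const R m k s * waveint beta t (heat_symbol beta t x) th x).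
  exact/is_derive_mull/is_derive_waveint_time.
have dRe : is_derive t 1 (fun r => complex.Re (q_kernel s r x))
    (@wave_const R m k s * waveint beta t (heat_symbol beta t x) 0 x).
  apply: near_eq_is_derive (dW 0).
  (* The formula [q_kernelE] holds at positive times, so the two functions of [r] are compared only
     in a neighbourhood of [t]. *)
  near=> r; have r0 : 0 < r by near: r; exact: lt_nbhsr.
  by rewrite q_kernelE//= -WE.
have dIm : is_derive t 1 (fun r => complex.Im (q_kernel s r x))
    (@wave_const R m k s * waveint beta t (heat_symbol beta t x) (pi / 2) x).
  apply: near_eq_is_derive (dW (pi / 2)).
  near=> r; have r0 : 0 < r by near: r; exact: lt_nbhsr.
  by rewrite q_kernelE//= -WE.
split.
- by split; [case: dRe|case: dIm].
- by move=> i; rewrite qE; exact: cwave_cderivable.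
- by move=> i j; rewrite qE; exact: cwave_cderivable2.
- rewrite qE (cwave_heat_operator br_alt hJ hH he heps b0 t0 tc (lt0r_neq0 y0)).
  rewrite /ctime_derivative !derive1E.
  have [_ ->] := dRe; have [_ ->] := dIm.
  apply/eqP; rewrite subr_eq0; apply/eqP; rewrite /cwave.
  by congr (_ +i* _); rewrite waveintZ//; exact: tame_heat_symbol.
Unshelve. all: by end_near. Qed.

End SolvesHeat.

(** * Partial Fourier transform *)

Section ParametrizedIntegral.
Context d1 d2 (T1 : measurableType d1) (T2 : measurableType d2) (R : realType).
Variable m2 : {sigma_finite_measure set T2 -> \bar R}.

(** Tonelli makes the integrals of the positive and negative parts measurable in the parameter, and
    [fine] of their difference is measurable again. *)
Lemma measurable_Rintegral_section (f : T1 * T2 -> R) : measurable_fun setT f ->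
  measurable_fun setT (fun x => \int[m2]_y f (x, y)).
Proof.
move=> mf; have mF : measurable_fun setT (EFin \o f) by exact/measurable_EFinP.
rewrite /Rintegral; apply: measurableT_comp; first exact: fine_measurable.
rewrite (_ : (fun x => _) = (fun x => \int[m2]_y (EFin \o f)^\+ (x, y) -
    \int[m2]_y (EFin \o f)^\- (x, y))%E).
  apply: emeasurable_funB.
    exact: (measurable_fun_fubini_tonelli_F (EFin \o f)^\+%E (measurable_funepos mF)).
  exact: (measurable_fun_fubini_tonelli_F (EFin \o f)^\-%E (measurable_funeneg mF)).
apply/funext => x.
have hp : (((EFin \o f) \o pair x)^\+ = (EFin \o f)^\+ \o pair x)%E by exact: funepos_comp.
have hn : (((EFin \o f) \o pair x)^\- = (EFin \o f)^\- \o pair x)%E by exact: funeneg_comp.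
transitivity (\int[m2]_y ((EFin \o f) \o pair x) y)%E => //.
by rewrite integralE hp hn.
Qed.

Variable m1 : {sigma_finite_measure set T1 -> \bar R}.

Lemma integrable_tensor (f : T1 -> R) (g : T2 -> R) :
  m1.-integrable setT (EFin \o f) -> m2.-integrable setT (EFin \o g) ->
  (m1 \x m2)%E.-integrable setT (EFin \o (fun p => f p.1 * g p.2)).
Proof.
move=> fi gi; have [mf _] := integrableP _ _ _ fi; have [mg _] := integrableP _ _ _ gi.
have mf' : measurable_fun setT f by exact/measurable_EFinP.
have mg' : measurable_fun setT g by exact/measurable_EFinP.
apply/integrable12ltyP.
  apply/measurable_EFinP; apply: measurable_funM.
    exact: (measurableT_comp mf').
  exact: (measurableT_comp mg').
have [c gc] : exists c : R, (\int[m2]_y `|(g y)%:E| = c%:E)%E.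
  exists (fine (\int[m2]_y `|(g y)%:E|)%E); rewrite fineK//.
  by have := integrable_fin_num measurableT (integrable_abse gi).
rewrite (_ : (\int[m1]_x _)%E = (\int[m1]_x (`|(f x)%:E| * c%:E))%E); last first.
  apply: eq_integral => x _ /=.
  under eq_integral do rewrite normrM EFinM.
  rewrite ge0_integralZl//= ?lee_fin//; last first.
    by apply: measurableT_comp => //; exact: measurableT_comp.
  by rewrite -gc.
rewrite ge0_integralZr//; last 2 first.
- by apply: measurableT_comp.
- by rewrite -gc; exact: integral_ge0.
have /fineK <- := integrable_fin_num measurableT (integrable_abse fi).
by rewrite -EFinM ltry.
Qed.

End ParametrizedIntegral.

(* Unification does not find the library's sigma-finite structure on [m1 \x m2]: the instance
   for pairs of subprobabilities takes precedence. *)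
Section SigmaFiniteProduct.
Context d1 d2 (T1 : measurableType d1) (T2 : measurableType d2) (R : realType).
Variables (m1 : {sigma_finite_measure set T1 -> \bar R})
          (m2 : {sigma_finite_measure set T2 -> \bar R}).

Definition sf_product : set (T1 * T2) -> \bar R := (m1 \x m2)%E.

HB.instance Definition _ := Measure.copy sf_product (m1 \x m2)%E.

Let sf_product_sigma_finite : sigma_finite setT sf_product.
Proof.
have /sigma_finiteP[F [FT ndF Foo]] := sigma_finiteT m1.
have /sigma_finiteP[G [GT ndG Goo]] := sigma_finiteT m2.
exists (fun n => F n `*` G n).
  apply/seteqP; split => // -[x y] _.
  have [i _ Fx] : (\bigcup_i F i) x by rewrite -FT.
  have [j _ Gy] : (\bigcup_j G j) y by rewrite -GT.
  exists (maxn i j) => //; split => /=.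
    exact: (subsetPset _ _ (ndF _ _ (leq_maxl i j))).
  exact: (subsetPset _ _ (ndG _ _ (leq_maxr i j))).
move=> n; have [mF Fn] := Foo n; have [mG Gn] := Goo n.
split; first exact: measurableX.
by rewrite /sf_product product_measure1E// lte_mul_pinfty// ge0_fin_numE.
Qed.

HB.instance Definition _ := Measure_isSigmaFinite.Build _ _ _ sf_product sf_product_sigma_finite.

Definition product_sigma_finite : {sigma_finite_measure set (T1 * T2)%type -> \bar R} := sf_product.

End SigmaFiniteProduct.

(** * Measurability of continuous functions on tuples *)

Section GridMeasurability.
Context {R : realType}.

(** A preimage is a countable union of fibres of [idx]. *)
Lemma measurable_countable_factor d (T : measurableType d) (I : countType)
    (idx : T -> I) (F : I -> R) :
  (forall i, measurable (idx @^-1` [set i])) -> measurable_fun setT (F \o idx).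
Proof.
move=> mi _ A mA; rewrite setTI.
rewrite (_ : _ @^-1` _ = \bigcup_n (if unpickle n is Some i then
    (if `[< A (F i) >] then idx @^-1` [set i] else set0) else set0)).
  apply: bigcup_measurable => n _; case: unpickle => [i|]; last exact: measurable0.
  by case: ifPn => _; [exact: mi|exact: measurable0].
apply/seteqP; split => [x /= Ax|x [n _]].
  by exists (pickle (idx x)) => //; rewrite pickleK; case: asboolP.
by case: unpickle => // i; case: asboolP => //= AFi xi; rewrite xi.
Qed.

Definition grid (n : nat) (x : R) : int := Num.floor (n.+1%:R * x).

Lemma grid_le n x : `|(grid n x)%:~R / n.+1%:R - x| <= n.+1%:R^-1.
Proof.
have n0 : 0 < n.+1%:R :> R by [].
rewrite -(@ler_pM2r _ n.+1%:R)// -[X in _ * X](gtr0_norm n0) -normrM mulVf ?gt_eqF//.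
rewrite mulrBl divfK ?gt_eqF// [x * _]mulrC.
have := floor_le (n.+1%:R * x); have := floorD1_gt (n.+1%:R * x).
rewrite -/(grid n x) intrD => h1 h2.
by rewrite ler_norml; apply/andP; split; lra.
Qed.

Lemma measurable_grid d (T : measurableType d) n (f : T -> R) (j : int) :
  measurable_fun setT f -> measurable [set t | grid n (f t) = j].
Proof.
move=> mf; rewrite (_ : mkset _ = setT `&` (fun t => n.+1%:R * f t) @^-1` `[j%:~R, (j + 1)%:~R[%classic).
  apply: measurable_funM => //.
rewrite setTI; apply/seteqP; split => t /=; rewrite in_itv/=.
  by move=> <-; rewrite /grid floor_le floorD1_gt.
by move=> h; apply/eqP; rewrite floor_eq//.
Qed.

Context {m k : nat}.
Local Notation T := (measurableTypeR R).
Local Notation X := (m.-tuple T * k.-tuple T * T)%type.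

(** Continuity refers to the topology of row vectors, measurability to the product sigma-algebra on
    tuples. The bridge is a pointwise limit: [u] evaluated at the lower corner of the cell of mesh
    [1 / (n+1)] factors through a countable set of indices. *)
Lemma measurable_continuous_pt (u : pt R m k -> R) : continuous u ->
  measurable_fun setT (u \o @pt_of R m k).
Proof.
move=> cu.
pose I := ({ffun 'I_m -> int} * {ffun 'I_k -> int} * int)%type.
pose idx n (p : X) : I := ([ffun i => grid n (tnth p.1.1 i)],
  [ffun i => grid n (tnth p.1.2 i)], grid n p.2).
pose pnt n (i : I) : pt R m k := (\row_j ((i.1.1 j)%:~R / n.+1%:R),
  \row_j ((i.1.2 j)%:~R / n.+1%:R), i.2%:~R / n.+1%:R).
apply/measurable_EFinP.
apply: (emeasurable_fun_cvg (fun n => EFin \o (u \o pnt n \o idx n))) => [n|p _].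
  apply/measurable_EFinP; apply: measurable_countable_factor => -[[a b] c].
  rewrite (_ : _ @^-1` _ =
     (\bigcap_(i in [set: 'I_m]) [set p : X | grid n (tnth p.1.1 i) = a i]) `&`
     (\bigcap_(i in [set: 'I_k]) [set p : X | grid n (tnth p.1.2 i) = b i]) `&`
     [set p : X | grid n p.2 = c]).
    apply: measurableI; last exact: measurable_grid.
    apply: measurableI; apply: fin_bigcap_measurable => // i _; apply: measurable_grid.
      by apply: (measurableT_comp (measurable_tnth i)); apply: measurableT_comp.
    by apply: (measurableT_comp (measurable_tnth i)); apply: measurableT_comp.
  apply/seteqP; split => [p [<- <- <-]|p [[pa pb] pc]].
    by split => //; split => i _ /=; rewrite ffunE.
  congr (_, _, _) => //; apply/ffunP => i; rewrite ffunE; [exact: pa|exact: pb].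
apply: cvg_EFin; first exact: nearW.
apply: (@cvg_comp _ _ _ (fun n => pnt n (idx n p)) u _ (nbhs (pt_of p))); last exact: cu.
apply/cvg_ballP => e e0.
near=> n.
have ne : n.+1%:R^-1 < e by near: n; exact: near_infty_natSinv_lt (PosNum e0).
have ge x : `|x - (grid n x)%:~R / n.+1%:R| < e.
  by rewrite distrC (le_lt_trans (grid_le n x)).
split; first split.
- by split => // i j; rewrite !mxE /= ffunE; exact: ge.
- by split => // i j; rewrite !mxE /= ffunE; exact: ge.
- exact: ge.
Unshelve. all: by end_near. Qed.

Lemma measurable_continuous_comp d (Y : measurableType d) (u : pt R m k -> R)
    (a : Y -> m.-tuple T) (b : Y -> k.-tuple T) (c : Y -> T) : continuous u ->
  measurable_fun setT a -> measurable_fun setT b -> measurable_fun setT c ->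
  measurable_fun setT (fun y => u (rv_of (a y), rv_of (b y), c y)).
Proof.
move=> cu ma mb mc.
apply: (measurableT_comp (measurable_continuous_pt cu)
  (_ : measurable_fun setT (fun y => ((a y, b y), c y)))).
by do 2 apply: measurable_fun_pair => //.
Qed.

End GridMeasurability.

Section Fourier.
Context {R : realType} {m k : nat}.
Local Notation T := (measurableTypeR R).
Local Notation pt := (pt R m k).
Local Notation rn n := (@lebesgue_rn R n).
Implicit Types (z : m.-tuple T) (sg mu : k.-tuple T) (y : T) (th : R).

(** A product of one-dimensional weights, chosen so that integrability reduces to the line and a
    bound can be built up one coordinate at a time. *)
Definition decay sg : R := \prod_(l < k) (1 + tnth sg l ^+ 2)^-1.

Lemma onedsqr_gt0 (x : R) : 0 < 1 + x ^+ 2.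
Proof. by rewrite ltr_pwDl// sqr_ge0. Qed.

Lemma decay_gt0 sg : 0 < decay sg.
Proof. by apply: prodr_gt0 => l _; rewrite invr_gt0 onedsqr_gt0. Qed.

Lemma integrable_decay : (rn k).-integrable setT (EFin \o decay).
Proof.
apply: (integrable_rn_prod k measurable_onedsqrV _ integrable_onedsqrV).
by move=> x; rewrite invr_ge0 ltW// onedsqr_gt0.
Qed.

Lemma measurable_decay : measurable_fun setT decay.
Proof. exact: measurable_prod_tnth measurable_onedsqrV. Qed.

(** The properties of test functions that enter the limit. A class stable under derivatives in
    [sigma] is used, rather than one function with a number of derivatives, so that inductions over
    coordinates may replace a function by its derivative. *)
Record vertical_schwartz (S : set (pt -> R)) : Prop := VerticalSchwartz {
  vs_continuous : forall u, S u -> continuous u;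
  vs_bound : forall u, S u -> exists2 C, 0 <= C &
    forall z sg y, `|u (rv_of z, rv_of sg, y)| <= C * decay sg;
  vs_derive : forall u l, S u -> exists2 u', S u' &
    forall x, is_derive x (dirv (cs l)) u (u' x) }.

Variable S : set (pt -> R).
Hypothesis hS : vertical_schwartz S.
Implicit Types u : pt -> R.

(** The real form, with free phase, of the partial Fourier transform in [sigma]. *)
Definition vfourier u th z mu y : R :=
  \int[rn k]_sg (u (rv_of z, rv_of sg, y) * cos (dotp (rv_of sg) mu + th)).

Lemma dotp_tnth sg mu : dotp (rv_of sg) mu = \sum_(l < k) tnth sg l * tnth mu l.
Proof. by rewrite dotpE; apply: eq_bigr => l _; rewrite mxE. Qed.

Lemma measurable_dotp2 d (Y : measurableType d) (a b : Y -> k.-tuple T) :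
  measurable_fun setT a -> measurable_fun setT b ->
  measurable_fun setT (fun w => dotp (rv_of (a w)) (b w)).
Proof.
move=> ma mb; under eq_fun do rewrite dotp_tnth.
apply: measurable_sum => l; apply: measurable_funM.
  exact: (measurableT_comp (measurable_tnth l) ma).
exact: (measurableT_comp (measurable_tnth l) mb).
Qed.

Lemma measurable_slice u z y : S u ->
  measurable_fun setT (fun sg => u (rv_of z, rv_of sg, y)).
Proof.
by move=> Su; apply: measurable_continuous_comp => //; exact: vs_continuous hS _ Su.
Qed.

Lemma measurable_cos_dotp mu th :
  measurable_fun setT (fun sg => cos (dotp (rv_of sg) mu + th)).
Proof.
apply: measurable_fun_cos; apply: measurable_funD => //.
exact: measurable_dotp2.
Qed.

Lemma integrable_slice_cos u z y mu th : S u ->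
  (rn k).-integrable setT
    (EFin \o (fun sg => u (rv_of z, rv_of sg, y) * cos (dotp (rv_of sg) mu + th))).
Proof.
move=> Su; have [C C0 hC] := vs_bound hS Su.
apply: (@integrable_dominated _ _ _ _ _ _ (fun sg => C * decay sg)) => //.
- by apply: measurable_funM; [exact: measurable_slice|exact: measurable_cos_dotp].
- by apply: integrable_mull => //; exact: integrable_decay.
- move=> sg _; rewrite normrM (le_trans _ (hC z sg y))//.
  by rewrite ler_piMr// cos_max.
Qed.

Definition shift_l (l : 'I_k) (r : R) sg : k.-tuple T :=
  affine 1 (fun i => r * (i == l)%:R) sg.

Lemma rv_of_shift l r sg : rv_of (shift_l l r sg) = r *: delta_mx 0 l + rv_of sg.
Proof. by apply/rowP => i; rewrite !mxE tnth_mktuple mul1r eqxx addrC. Qed.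

Lemma decay_shift l r sg : `|r| <= 1 -> decay (shift_l l r sg) <= 3 * decay sg.
Proof.
move=> r1; rewrite /decay (bigD1 l)//= [in leRHS](bigD1 l)//= mulrA.
rewrite [X in _ * X <= _](_ : _ = \prod_(i < k | i != l) (1 + tnth sg i ^+ 2)^-1); last first.
  by apply: eq_bigr => i il; rewrite tnth_mktuple (negPf il) mulr0 addr0 mul1r.
rewrite ler_wpM2r//.
  by apply: prodr_ge0 => i _; rewrite invr_ge0 ltW// onedsqr_gt0.
rewrite tnth_mktuple eqxx mulr1 mul1r; set x := tnth sg l.
rewrite ler_pdivlMr ?onedsqr_gt0// mulrC ler_pdivrMr ?onedsqr_gt0//.
have : r ^+ 2 <= 1 by rewrite -real_normK ?num_real// expr_le1.
(* Indeed [3 (1 + (x + r)^2) - (1 + x^2) = 2 (x + 3r/2)^2 + 2 - 3r^2/2], which is nonnegative for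
   [r^2 <= 1]. *)
have := sqr_ge0 (x + 3 / 2 * r); nra.
Qed.

(* Differentiate at [r = 0] the integral of [u(z, sigma + r e_l, y) cos(<sigma, mu> + th)], once
   directly and once after translating [sigma]. *)
Lemma vfourier_derive u u' l z mu y th : S u -> S u' ->
  (forall x, is_derive x (dirv (cs l)) u (u' x)) ->
  tnth mu l * vfourier u (th - pi / 2) z mu y = vfourier u' th z mu y.
Proof.
move=> Su Su' du.
have [C C0 hC] := vs_bound hS Su'.
pose g (r : R) := \int[rn k]_sg (u (rv_of z, rv_of (shift_l l r sg), y) *
  cos (dotp (rv_of sg) mu + th)).
have shE (r : R) sg : (rv_of z, rv_of (shift_l l r sg), y) =
    r *: dirv (cs l) + (rv_of z, rv_of sg, y) :> pt.
  rewrite rv_of_shift.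
  rewrite -[RHS]/(r *: 0 + rv_of z, r *: delta_mx 0 l + rv_of sg, r *: 0 + y).
  by rewrite !scaler0 !add0r.
have msh r : measurable_fun setT (fun sg => u (rv_of z, rv_of (shift_l l r sg), y)).
  apply: measurable_continuous_comp => //; first exact: vs_continuous hS _ Su.
  exact: measurable_affine_tuple.
have [Cu Cu0 hCu] := vs_bound hS Su.
have d1 : is_derive (0 : R) (1 : R) g (vfourier u' th z mu y).
  rewrite (_ : vfourier _ _ _ _ _ = \int[rn k]_sg
      (u' ((0 : R) *: dirv (cs l) + (rv_of z, rv_of sg, y)) * cos (dotp (rv_of sg) mu + th))); last first.
    by apply: eq_Rintegral => sg _; rewrite scale0r add0r.
  apply: (@is_derive_under_integral _ _ _ _ _
    (fun r sg => u (rv_of z, rv_of (shift_l l r sg), y) * cos (dotp (rv_of sg) mu + th)) 0 1 1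
    (fun r sg => u' (r *: dirv (cs l) + (rv_of z, rv_of sg, y)) * cos (dotp (rv_of sg) mu + th))
    (fun sg => C * (3 * decay sg))) => //.
  - move=> h h1 h2; rewrite addr0 -[h *: 1]/(h * 1) mulr1.
    apply: (@integrable_dominated _ _ _ _ _ _ (fun sg => Cu * (3 * decay sg))) => //.
    + by apply: measurable_funM; [exact: msh|exact: measurable_cos_dotp].
    + by do 2 apply: integrable_mull => //; exact: integrable_decay.
    + move=> sg _; rewrite normrM (le_trans (ler_piMr _ (cos_max _)))//.
      rewrite (le_trans (hCu _ _ _))// ler_wpM2l// decay_shift// ltW//.
      by rewrite ltr_norml h1 h2.
  - move=> h sg _ _; apply: is_derive_mulr.
    apply: (is_derive_congr (is_derive_along (rv_of z, rv_of sg, y) h du)) => // r.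
    by rewrite addr0 -[r *: 1]/(r * 1) mulr1 shE.
  - by do 2 apply: integrable_mull => //; exact: integrable_decay.
  - move=> h sg h1 h2; rewrite -shE normrM (le_trans (ler_piMr _ (cos_max _)))//.
    rewrite (le_trans (hC _ _ _))// ler_wpM2l// decay_shift// ltW//.
    by rewrite ltr_norml h1 h2.
(* After the translation the increment occurs only in the phase, and the addition formula takes it
   out of the integral. *)
have gE r : g r = cos (tnth mu l * r + 0) * vfourier u th z mu y +
    sin (tnth mu l * r + 0) * vfourier u (th - pi / 2) z mu y.
  pose h sg := u (rv_of z, rv_of sg, y) * cos (dotp (rv_of (shift_l l (- r) sg)) mu + th).
  have hE sg : h sg = cos (tnth mu l * r + 0) * (u (rv_of z, rv_of sg, y) * cos (dotp (rv_of sg) mu + th)) +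
      sin (tnth mu l * r + 0) * (u (rv_of z, rv_of sg, y) * cos (dotp (rv_of sg) mu + (th - pi / 2))).
    rewrite /h rv_of_shift addr0.
    have -> : dotp (- r *: delta_mx 0 l + rv_of sg) mu = dotp (rv_of sg) mu - tnth mu l * r.
      rewrite !dotpE (bigD1 l)//= [in RHS](bigD1 l)//= !mxE !eqxx/=.
      under eq_bigr => i il do rewrite !mxE eqxx/= (negPf il) mulr0 add0r.
      under [in RHS]eq_bigr => i il do rewrite mxE.
      by ring.
    rewrite addrAC cosB addrA cosBpihalf; ring.
  have i1 := integrable_slice_cos z y mu th Su.
  have i2 := integrable_slice_cos z y mu (th - pi / 2) Su.
  have hi : (rn k).-integrable setT (EFin \o h).
    have := integrable_add measurableT (integrable_mull (cos (tnth mu l * r + 0)) measurableT i1)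
      (integrable_mull (sin (tnth mu l * r + 0)) measurableT i2).
    by apply: eq_integrable => // sg _; rewrite /comp hE.
  rewrite /vfourier -!RintegralZl// -RintegralD//; [|exact: integrable_mull|exact: integrable_mull].
  transitivity (\int[rn k]_sg h sg); last by apply: eq_Rintegral => sg _; exact: hE.
  rewrite (Rintegral_rn_affine (fun i => r * (i == l)%:R) ltr01 hi) expr1n mul1r.
  apply: eq_Rintegral => sg _; rewrite /h -/(shift_l l r sg); congr (_ * cos (dotp _ _ + _)).
  by rewrite !rv_of_shift addrA -scalerDl addNr scale0r add0r.
have d2 : is_derive (0 : R) (1 : R) g (tnth mu l * vfourier u (th - pi / 2) z mu y).
  have dl := is_derive_linear 0 (tnth mu l) 0.
  apply: (is_derive_congr (is_derive_add
    (is_derive_mulr (vfourier u th z mu y) (is_derive_comp1 (is_derive_cos _) dl))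
    (is_derive_mulr (vfourier u (th - pi / 2) z mu y) (is_derive_comp1 (is_derive_sin _) dl)))).
    by move=> r; rewrite gE.
  by rewrite mulr0 addr0 sin0 cos0; ring.
by have [_ <-] := d1; have [_ <-] := d2.
Qed.

Lemma vfourier_le u : S u -> exists2 C, 0 <= C &
  forall th z mu y, `|vfourier u th z mu y| <= C.
Proof.
move=> Su; have [C C0 hC] := vs_bound hS Su.
exists (C * \int[rn k]_sg decay sg).
  by rewrite mulr_ge0// Rintegral_ge0// => sg _; rewrite ltW// decay_gt0.
move=> th z mu y; have i1 := integrable_slice_cos z y mu th Su.
rewrite (le_trans (le_normr_Rintegral measurableT i1))//.
rewrite -RintegralZl//; last exact: integrable_decay.
apply: le_Rintegral => //.
- exact: (integrable_norm i1).
- by apply: integrable_mull => //; exact: integrable_decay.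
- move=> sg _; rewrite normrM (le_trans _ (hC z sg y))//.
  by rewrite ler_piMr// cos_max.
Qed.

(** Induction over a list of coordinates: the factor [1 + mu_l^2] splits into the bound for [u] and
    the bound for its second derivative in [sigma_l], both again in [S]. *)
Lemma vfourier_decay u : S u -> exists2 C, 0 <= C &
  forall th z mu y, `|vfourier u th z mu y| <= C * decay mu.
Proof.
move=> Su.
suff H (L : seq 'I_k) : forall u, S u -> exists2 C, 0 <= C & forall th z mu y,
    `|vfourier u th z mu y| * \prod_(l <- L) (1 + tnth mu l ^+ 2) <= C.
  have [C C0 hC] := H (index_enum _) u Su; exists C => // th z mu y.
  by rewrite /decay prodfV -ler_pdivrMr ?invrK// invr_gt0 prodr_gt0// => l _; exact: onedsqr_gt0.
elim: L => [|l L IH] {Su}u Su.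
  have [C C0 hC] := vfourier_le Su; exists C => // th z mu y.
  by rewrite big_nil mulr1.
have [u1 Su1 du1] := vs_derive hS l Su.
have [u2 Su2 du2] := vs_derive hS l Su1.
have [C1 C10 hC1] := IH _ Su; have [C2 C20 hC2] := IH _ Su2.
exists (C1 + C2); first exact: addr_ge0.
move=> th z mu y; rewrite big_cons.
(* Two integrations by parts; the phase advances by [pi], which is harmless because the bounds hold
   for every phase. *)
have E : tnth mu l ^+ 2 * vfourier u th z mu y = vfourier u2 (th + pi / 2 + pi / 2) z mu y.
  rewrite -(vfourier_derive z mu y _ Su1 Su2 du2) addrK.
  by rewrite -(vfourier_derive z mu y _ Su Su1 du1) addrK mulrA.
rewrite mulrA mulrDr mulr1 mulrDl lerD ?hC1//.
rewrite (le_trans _ (hC2 (th + pi / 2 + pi / 2) z mu y))// -E normrM.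
by rewrite [`|_ ^+ 2|]ger0_norm ?sqr_ge0// [X in X * _]mulrC.
Qed.

Lemma vfourier_cvg0 u th z mu y : S u ->
  vfourier u th (affine (Num.sqrt t) (fun=> 0) z) mu (Num.sqrt t * y) @[t --> 0^'+] -->
  vfourier u th [tuple of nseq m 0] mu 0.
Proof.
move=> Su; have [C C0 hC] := vs_bound hS Su.
apply: (@dominated_Rintegral_cvg_right _ _ _ _ _
  (fun t sg => u (rv_of (affine (Num.sqrt t) (fun=> 0) z), rv_of sg, Num.sqrt t * y) *
    cos (dotp (rv_of sg) mu + th)) 0 _ (fun sg => C * decay sg)) => //.
- move=> t _; apply: measurable_funM; first exact: measurable_slice.
  exact: measurable_cos_dotp.
- move=> sg _; apply: cvgM; last exact: cvg_cst.
  apply: (@cvg_comp _ _ _ (fun t : R => (rv_of (affine (Num.sqrt t) (fun=> 0) z), rv_of sg,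
    Num.sqrt t * y) : pt) u _ (nbhs (rv_of [tuple of nseq m 0], rv_of sg, 0 : T))); last first.
    exact: (vs_continuous hS Su).
  have sq0 : Num.sqrt t @[t --> 0^'+] --> (0 : R).
    by rewrite -{2}sqrtr0; apply: cvg_at_right_filter; exact: sqrt_continuous.
  have zE : (fun t : R => rv_of (affine (Num.sqrt t) (fun=> 0) z)) =
     (fun t => Num.sqrt t *: rv_of z).
    by apply/funext => t; apply/rowP => i; rewrite !mxE tnth_mktuple addr0.
  have z0E : rv_of [tuple of nseq m 0] = 0 *: rv_of z :> 'rV[R]_m.
    by apply/rowP => i; rewrite !mxE mul0r (tnth_nth 0) nth_nseq if_same.
  have h1 : rv_of (affine (Num.sqrt t) (fun=> 0) z) @[t --> 0^'+] -->
      (rv_of [tuple of nseq m 0] : 'rV[R]_m).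
    rewrite zE z0E; apply: cvgZ => //; exact: cvg_cst.
  have h2 : (fun=> rv_of sg) t @[t --> (0 : R)^'+] --> (rv_of sg : 'rV[R]_k).
    exact: cvg_cst.
  have h3 : Num.sqrt t * y @[t --> 0^'+] --> (0 : R).
    by rewrite -[X in _ --> X](mul0r y); apply: cvgM => //; exact: cvg_cst.
  exact: (cvg_pair (cvg_pair h1 h2) h3).
- by apply: integrable_mull => //; exact: integrable_decay.
- move=> t sg _ _; rewrite normrM (le_trans _ (hC (affine (Num.sqrt t) (fun=> 0) z) sg (Num.sqrt t * y)))//.
  by rewrite ler_piMr// cos_max.
Qed.

End Fourier.

(** * Fourier inversion at the origin of [sigma] *)

Section Inversion.
Context {R : realType} {m k : nat}.
Local Notation T := (measurableTypeR R).
Local Notation pt := (pt R m k).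
Local Notation rn n := (@lebesgue_rn R n).
Implicit Types (z : m.-tuple T) (sg mu : k.-tuple T) (y : T) (th : R).

Variable S : set (pt -> R).
Hypothesis hS : vertical_schwartz S.
Implicit Types u : pt -> R.

Lemma measurable_vfourier u th d (Y : measurableType d) (a : Y -> m.-tuple T)
    (b : Y -> k.-tuple T) (c : Y -> T) : S u ->
  measurable_fun setT a -> measurable_fun setT b -> measurable_fun setT c ->
  measurable_fun setT (fun w => vfourier u th (a w) (b w) (c w)).
Proof.
move=> Su ma mb mc.
apply: (@measurable_Rintegral_section _ _ _ _ _ (rn k)
  (fun p => u (rv_of (a p.1), rv_of p.2, c p.1) * cos (dotp (rv_of p.2) (b p.1) + th))).
apply: measurable_funM.
  apply: measurable_continuous_comp => //; first exact: vs_continuous hS _ Su.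
    exact: (measurableT_comp ma).
  exact: (measurableT_comp mc).
apply: measurable_fun_cos; apply: measurable_funD => //.
by apply: measurable_dotp2 => //; exact: (measurableT_comp mb).
Qed.

Lemma integrable_vfourier u th z y : S u ->
  (rn k).-integrable setT (EFin \o (fun mu => vfourier u th z mu y)).
Proof.
move=> Su; have [C C0 hC] := vfourier_decay hS Su.
apply: (@integrable_dominated _ _ _ _ _ _ (fun mu => C * decay mu)) => //.
- exact: measurable_vfourier.
- by apply: integrable_mull => //; exact: integrable_decay.
Qed.

(* Abel summation factor: it makes the inversion integral absolutely convergent, so that
   Fubini applies. *)
Definition damp (eps : R) mu : R := \prod_(l < k) expR (- (eps * `|tnth mu l|)).

Lemma damp_ge0 eps mu : 0 <= damp eps mu.
Proof. by apply: prodr_ge0 => l _; exact: expR_ge0. Qed.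

Lemma damp_le1 eps mu : 0 <= eps -> damp eps mu <= 1.
Proof.
move=> e0; apply: prodr_ile1 => l; rewrite expR_ge0/= -[leRHS]expR0 ler_expR.
by rewrite oppr_le0 mulr_ge0.
Qed.

Lemma integrable_damp eps : 0 < eps -> (rn k).-integrable setT (EFin \o damp eps).
Proof.
move=> e0; apply: (integrable_rn_prod k (measurable_expR_abs eps)).
  by move=> x; exact: expR_ge0.
exact: integrable_expR_abs.
Qed.

Lemma measurable_damp eps : measurable_fun setT (damp eps).
Proof. exact: measurable_prod_tnth (measurable_expR_abs eps). Qed.

Lemma damp_cvg1 mu : damp eps mu @[eps --> 0^'+] --> (1 : R).
Proof.
have h : continuous (fun eps : R => damp eps mu).
  rewrite (_ : (fun eps => _) = (fun eps : R => expR (- (eps * \sum_(l < k) `|tnth mu l|)))).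
    move=> eps; apply: (@continuous_comp _ _ _ (fun e : R => - (e * \sum_(l < k) `|tnth mu l|)) expR).
      by apply: cvgN; apply: cvgMr_tmp; exact: cvg_id.
    exact: continuous_expR.
  by apply/funext => eps; rewrite mulr_sumr -sumrN expR_sum.
apply: cvg_at_right_filter.
have -> : (1 : R) = damp 0 mu by rewrite /damp big1// => l _; rewrite mul0r oppr0 expR0.
exact: h.
Qed.

(** Fubini leaves the Fourier transform of the damping factor, the product of the Cauchy kernels
    [2 eps / (eps^2 + sigma_l^2)]; as the damping is even, the phase survives only as [cos th].
    Scaling [sigma] by [eps] then moves [eps] into the argument of [u]. *)
Lemma Rintegral_damp_vfourier u th z y eps : S u -> 0 < eps ->
  \int[rn k]_mu (damp eps mu * vfourier u th z mu y) =
  cos th * \int[rn k]_sg (u (rv_of z, rv_of (affine eps (fun=> 0) sg), y) *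
    \prod_(l < k) (2 * (1 + tnth sg l ^+ 2)^-1)).
Proof.
move=> Su e0.
pose F (p : k.-tuple T * k.-tuple T) : R := damp eps p.1 *
  (u (rv_of z, rv_of p.2, y) * cos (dotp (rv_of p.2) p.1 + th)).
have mF : measurable_fun setT F.
  apply: measurable_funM; first exact: (measurableT_comp (measurable_damp eps)).
  apply: measurable_funM.
    by apply: measurable_continuous_comp => //; exact: vs_continuous hS _ Su.
  by apply: measurable_fun_cos; apply: measurable_funD => //; exact: measurable_dotp2.
have [C C0 hC] := vs_bound hS Su.
have Fi : (rn k \x rn k)%E.-integrable setT (EFin \o F).
  apply: (@integrable_dominated _ _ _ _ _ _ (fun p => damp eps p.1 * (C * decay p.2))) => //.
    apply: (@integrable_tensor _ _ _ _ R (rn k) (rn k) (damp eps) (fun s => C * decay s)).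
      exact: integrable_damp.
    by apply: integrable_mull => //; exact: integrable_decay.
  move=> [mu sg] _; rewrite /F/= normrM ger0_norm ?damp_ge0// ler_wpM2l ?damp_ge0//.
  by rewrite normrM (le_trans (ler_piMr _ (cos_max _))).
have E1 := Rintegral_fubini1 Fi.
have E2 := Rintegral_fubini2 Fi.
transitivity (\int[rn k]_mu \int[rn k]_sg F (mu, sg)).
  apply: eq_Rintegral => mu _; rewrite /vfourier -RintegralZl//.
  exact: (integrable_slice_cos hS).
rewrite -E1; last first.
  by move=> mu; exact: (integrable_mull (damp eps mu) measurableT
    (integrable_slice_cos hS z y mu th Su)).
have hs sg : (rn k).-integrable setT (fun mu => (F (mu, sg))%:E).
  apply: (@integrable_dominated _ _ _ _ _ _ (fun mu => C * decay sg * damp eps mu)) => //.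
  - exact: (measurableT_comp mF).
  - by apply: integrable_mull => //; exact: integrable_damp.
  - move=> mu _; rewrite /F/= normrM ger0_norm ?damp_ge0// mulrC ler_wpM2r ?damp_ge0//.
    by rewrite normrM (le_trans (ler_piMr _ (cos_max _))).
rewrite E2//.
pose G sg := u (rv_of z, rv_of sg, y) * \prod_(l < k) (2 * eps / (eps ^+ 2 + tnth sg l ^+ 2)).
have GE sg : \int[rn k]_mu F (mu, sg) = cos th * G sg.
  have := Rintegral_rn_prod_cos (fun l => tnth sg l) th (measurable_expR_abs eps)
    (fun x => expR_ge0 _) (integrable_expR_abs e0)
    (fun b th' => Rintegral_laplace_cos b th' e0).
  rewrite /G => H.
  transitivity (u (rv_of z, rv_of sg, y) *
    ((\prod_(l < k) (2 * eps / (eps ^+ 2 + tnth sg l ^+ 2))) * cos th)); last by ring.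
  rewrite -H -RintegralZl//; last first.
    apply: (@integrable_dominated _ _ _ _ _ _ (damp eps)) => //.
    - apply: measurable_funM; first exact: measurable_damp.
      apply: measurable_fun_cos; apply: measurable_funD => //.
      apply: measurable_sum => l; apply: measurable_funM => //.
      exact: measurable_tnth.
    - exact: integrable_damp.
    - move=> mu _; rewrite normrM -/(damp eps mu) ger0_norm ?damp_ge0//.
      by rewrite ler_piMr ?damp_ge0// cos_max.
  by apply: eq_Rintegral => mu _; rewrite /F dotp_tnth /= -/(damp eps mu); ring.
have Gi : (rn k).-integrable setT (EFin \o G).
  have p0 : 0 < eps ^+ 2 by rewrite exprn_gt0.
  pose g (x : T) : R := 2 * eps / (eps ^+ 2 + x ^+ 2).
  have mg : measurable_fun setT g.
    apply: measurable_funM => //; apply: measurable_fun_inv.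
    by apply: measurable_funD => //; exact: exprn_measurable.
  (* Each Cauchy kernel is at most its value [2 / eps] at the origin. *)
  apply: (@integrable_dominated _ _ _ _ _ _ (fun sg => (2 / eps) ^+ k * (C * decay sg))) => //.
  - apply: measurable_funM; first exact: (measurable_slice hS).
    exact: measurable_prod_tnth mg.
  - by do 2 apply: integrable_mull => //; exact: integrable_decay.
  - move=> sg _; rewrite normrM mulrC ler_pM//.
    have g0 x : 0 <= g x.
      by rewrite divr_ge0// ?mulr_ge0 ?(ltW e0)// addr_ge0 ?sqr_ge0.
    rewrite ger0_norm; last by apply: prodr_ge0 => l _; exact: g0.
    rewrite -[k in X in _ <= X]card_ord -prodr_const ler_prod// => l _.
    rewrite g0/= ler_pdivrMr ?ltr_pwDl ?sqr_ge0//.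
    rewrite -[X in X <= _]addr0 mulrDr; apply: lerD.
      by rewrite expr2 mulrA divfK ?gt_eqF.
    by rewrite mulr_ge0 ?sqr_ge0// divr_ge0// ltW.
transitivity (\int[rn k]_sg (cos th * G sg)); first by apply: eq_Rintegral => sg _; exact: GE.
rewrite RintegralZl// (Rintegral_rn_affine (fun=> 0) e0 Gi); congr (_ * _).
rewrite -RintegralZl//; last exact: (@integrable_rn_affine _ _ eps (fun=> 0) G e0 Gi).
apply: eq_Rintegral => sg _; rewrite /G mulrCA; congr (_ * _).
rewrite -[k in X in X * _]card_ord -prodr_const -big_split/=; apply: eq_bigr => l _.
rewrite tnth_mktuple addr0; have := onedsqr_gt0 (tnth sg l) => h.
have -> : eps ^+ 2 + (eps * tnth sg l) ^+ 2 = eps ^+ 2 * (1 + tnth sg l ^+ 2) by ring.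
by field; rewrite !gt_eqF.
Qed.

Lemma Rintegral_cauchy_prod :
  \int[rn k]_sg (\prod_(l < k) (2 * (1 + tnth sg l ^+ 2)^-1)) = (2 * pi) ^+ k :> R.
Proof.
rewrite /Rintegral (ge0_integral_rn_prod (g := fun x : T => 2 * (1 + x ^+ 2)^-1) k (c := 2 * pi))//.
- by apply: measurable_funM => //; exact: measurable_onedsqrV.
- by move=> x; rewrite mulr_ge0// invr_ge0 ltW// onedsqr_gt0.
- under eq_integral do rewrite EFinM.
  rewrite ge0_integralZl//=; last 2 first.
  + by apply/measurable_EFinP; exact: measurable_onedsqrV.
  + by move=> x _; rewrite lee_fin invr_ge0 ltW// onedsqr_gt0.
  by rewrite integral_onedsqrV EFinM.
Qed.

(** The limit of the damped integral is computed twice: the damping tends to [1] under the bound of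
    [vfourier_decay], and the Cauchy kernels, of total mass [(2 pi)^k], concentrate at
    [sigma = 0]. *)
Lemma Rintegral_vfourier u th z y : S u ->
  \int[rn k]_mu vfourier u th z mu y = (2 * pi) ^+ k * (cos th * u (rv_of z, 0, y)).
Proof.
move=> Su; have [C C0 hC] := vfourier_decay hS Su.
have h1 : \int[rn k]_mu (damp eps mu * vfourier u th z mu y) @[eps --> 0^'+] -->
    \int[rn k]_mu vfourier u th z mu y.
  apply: (@dominated_Rintegral_cvg_right _ _ _ _ _
    (fun eps mu => damp eps mu * vfourier u th z mu y) 0 _ (fun mu => C * decay mu)) => //.
  - move=> eps _; apply: measurable_funM; first exact: measurable_damp.
    exact: measurable_vfourier.
  - move=> mu _; rewrite -[X in _ --> X]mul1r; apply: cvgMr_tmp; exact: damp_cvg1.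
  - by apply: integrable_mull => //; exact: integrable_decay.
  - move=> eps mu e0 _; rewrite normrM (le_trans _ (hC th z mu y))//.
    by rewrite ler_piMl// ger0_norm ?damp_ge0// damp_le1// ltW.
have [D D0 hD] := vs_bound hS Su.
pose q sg : R := \prod_(l < k) (2 * (1 + tnth sg l ^+ 2)^-1).
have qE sg : q sg = 2 ^+ k * decay sg by rewrite /q big_split prodr_const card_ord.
have q0 sg : 0 <= q sg by rewrite qE mulr_ge0// ltW// decay_gt0.
have mq : measurable_fun setT q.
  rewrite (_ : q = fun sg => 2 ^+ k * decay sg); last by apply/funext.
  by apply: measurable_funM => //; exact: measurable_decay.
have qi : (rn k).-integrable setT (EFin \o q).
  rewrite (_ : q = fun sg => 2 ^+ k * decay sg); last by apply/funext.
  by apply: integrable_mull => //; exact: integrable_decay.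
have decay1 sg : decay sg <= 1.
  apply: prodr_ile1 => l; rewrite invr_ge0 (ltW (onedsqr_gt0 _))/=.
  by rewrite invf_le1 ?onedsqr_gt0// lerDl sqr_ge0.
have h2 : cos th * \int[rn k]_sg (u (rv_of z, rv_of (affine eps (fun=> 0) sg), y) * q sg)
    @[eps --> 0^'+] --> cos th * \int[rn k]_sg (u (rv_of z, 0, y) * q sg).
  apply: cvgMl_tmp.
  apply: (@dominated_Rintegral_cvg_right _ _ _ _ _
    (fun eps sg => u (rv_of z, rv_of (affine eps (fun=> 0) sg), y) * q sg) 0 _
    (fun sg => D * q sg)) => //.
  - move=> eps _; apply: measurable_funM => //.
    apply: measurable_continuous_comp => //; first exact: vs_continuous hS _ Su.
    exact: measurable_affine_tuple.
  - move=> sg _; apply: cvgMr_tmp.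
    apply: (@cvg_comp _ _ _ (fun t : R => (rv_of z, rv_of (affine t (fun=> 0) sg), y) : pt)
      u _ (nbhs (rv_of z, 0 : 'rV[R]_k, y))); last exact: (vs_continuous hS Su).
    have zE : (fun t : R => rv_of (affine t (fun=> 0) sg)) = (fun t => t *: rv_of sg).
      by apply/funext => t; apply/rowP => i; rewrite !mxE tnth_mktuple addr0.
    have h3 : rv_of (affine t (fun=> 0) sg) @[t --> (0 : R)^'+] --> (0 : 'rV[R]_k).
      rewrite zE -[X in _ --> X](scale0r (rv_of sg)); apply: cvgZ; last exact: cvg_cst.
      exact: cvg_at_right_filter.
    have h4 : (fun=> rv_of z) t @[t --> (0 : R)^'+] --> (rv_of z : 'rV[R]_m) by exact: cvg_cst.
    have h5 : (fun=> y) t @[t --> (0 : R)^'+] --> (y : R) by exact: cvg_cst.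
    exact: (cvg_pair (cvg_pair h4 h3) h5).
  - exact: integrable_mull.
  - move=> eps sg _ _; rewrite normrM [`|q _|]ger0_norm// ler_wpM2r//.
    by rewrite (le_trans (hD _ _ _))// ler_piMr.
have h3 : \int[rn k]_mu (damp eps mu * vfourier u th z mu y) @[eps --> 0^'+] -->
    cos th * \int[rn k]_sg (u (rv_of z, 0, y) * q sg).
  apply: cvg_trans h2; apply: near_eq_cvg; near=> eps.
  by rewrite Rintegral_damp_vfourier.
rewrite (cvg_unique _ h1 h3).
have -> : \int[rn k]_sg (u (rv_of z, 0, y) * q sg) = u (rv_of z, 0, y) * \int[rn k]_sg q sg.
  exact: RintegralZl.
by rewrite Rintegral_cauchy_prod; ring.
Unshelve. all: by end_near. Qed.

End Inversion.

(** * Schwartz functions form a vertical Schwartz class *)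

Section SchwartzClass.
Context {R : realType} {m k : nat}.
Local Notation T := (measurableTypeR R).
Local Notation pt := (pt R m k).
Variable psi : pt -> R[i].
Hypothesis psiS : schwartz psi.

(** All iterated derivatives are taken together because the class has to be stable under derivatives
    in [sigma]. *)
Definition partials : set (pt -> R) := [set u | exists ds,
  u = @complex.Re R \o iter_cpartial ds psi \/ u = @complex.Im R \o iter_cpartial ds psi].

Lemma norm_Re_Im_le (c : R[i]) (C : R) :
  `|c| <= C%:C -> `|complex.Re c| <= C /\ `|complex.Im c| <= C.
Proof.
case: c => a b; rewrite normc_def lecE/= eqxx/= => h.
have [a2 b2] : `|a| ^+ 2 = a ^+ 2 /\ `|b| ^+ 2 = b ^+ 2 by rewrite !real_normK ?num_real.
split; apply: (le_trans _ h).
- by rewrite -sqrtr_sqr ler_wsqrtr// lerDl sqr_ge0.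
- by rewrite -sqrtr_sqr ler_wsqrtr// lerDr sqr_ge0.
Qed.

Lemma partials_monomial_bound u (a : @coordinate m k -> nat) (L : seq 'I_k) : partials u ->
  exists C, forall x, `|(\prod_i coordv i x ^+ a i) * u x| *
    \prod_(l <- L) (1 + x.1.2 0 l ^+ 2) <= C.
Proof.
move=> [ds du]; elim: L a => [a|l L IH a].
  have [_ /(_ a ds)[C hC]] := psiS; exists C => x; rewrite big_nil mulr1.
  have := hC x; case: du => -> /=; case: (iter_cpartial ds psi x) => p q.
    by rewrite realcM => /norm_Re_Im_le[].
  by rewrite realcM => /norm_Re_Im_le[].
have [C1 h1] := IH a; have [C2 h2] := IH (fun i => a i + (i == cs l).*2)%N.
exists (C1 + C2) => x; rewrite big_cons mulrA mulrDr mulr1 mulrDl; apply: lerD => //.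
have := h2 x; congr (_ * _ <= _).
have -> : \prod_i coordv i x ^+ (a i + (i == cs l).*2) =
    (\prod_i coordv i x ^+ a i) * x.1.2 0 l ^+ 2.
  transitivity (\prod_i (coordv i x ^+ a i * coordv i x ^+ (i == cs l).*2)).
    by apply: eq_bigr => i _; rewrite exprD.
  rewrite big_split/=; congr (_ * _).
  rewrite (bigD1 (cs l))//= eqxx/= big1 ?mulr1// => i /negPf ->.
  by rewrite expr0.
by rewrite mulrAC normrM [`|x.1.2 0 l ^+ 2|]ger0_norm// sqr_ge0.
Qed.

Lemma partials_bound u : partials u -> exists2 C, 0 <= C &
  forall z sg y, `|u (rv_of z, rv_of sg, y)| <= C * decay sg.
Proof.
move=> hu; have [C hC] := partials_monomial_bound (fun=> 0%N) (index_enum _) hu.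
exists C.
  apply: le_trans (hC 0); rewrite mulr_ge0// prodr_ge0// => l _.
  exact: ltW (onedsqr_gt0 _).
move=> z sg y; have := hC (rv_of z, rv_of sg, y).
rewrite big1 ?mul1r; last by move=> i _; rewrite expr0.
rewrite /decay prodfV -ler_pdivlMr; last by apply: prodr_gt0 => l _; exact: onedsqr_gt0.
by move=> /le_trans; apply; rewrite (eq_bigr (fun l => 1 + tnth sg l ^+ 2))// => l _; rewrite mxE.
Qed.

Lemma vertical_schwartz_partials : vertical_schwartz partials.
Proof.
split.
- move=> u [ds du] x; apply: differentiable_continuous.
  by have [/(_ ds x)[h1 h2] _] := psiS; case: du => ->.
- exact: partials_bound.
- move=> u l [ds du].
  exists (fun x => 'D_(dirv (cs l)) u x).
    by exists (cs l :: ds); case: du => ->; [left|right].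
  move=> x; apply: DeriveDef => //.
  by apply: diff_derivable; have [/(_ ds x)[h1 h2] _] := psiS; case: du => ->.
Qed.

End SchwartzClass.

(** * The radial density *)

Section GammaIntegral.
Context {R : realType}.
Local Notation leb := (@lebesgue_measure R).

Definition gamma_integrand (a u : R) : R := u `^ (a - 1) * expR (- u).

Lemma bigcup_itv_pos (a b : nat -> R) : (forall n, 0 < a n <= n.+1%:R^-1) ->
  (forall n, n.+1%:R / 4 <= b n) ->
  \bigcup_n [set` `[a n, b n]] = [set` `]0, +oo[].
Proof.
move=> ha hb; apply/seteqP; split => [x [n _]/=|x/=].
  by rewrite !in_itv/= andbT => /andP[+ _]; apply: lt_le_trans; case/andP: (ha n).
rewrite in_itv/= andbT => x0; pose M := x^-1 + 4 * x.
have M0 : 0 <= M by rewrite addr_ge0 ?invr_ge0 ?mulr_ge0// ltW.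
have hM : M <= (Num.bound M).+1%:R.
  by rewrite (le_trans (ltW (archi_boundP M0)))// ler_nat.
exists (Num.bound M) => //=; rewrite in_itv/=; apply/andP; split.
  have /andP[_ /le_trans] := ha (Num.bound M); apply.
  rewrite invf_ple ?posrE// (le_trans _ hM)// lerDl mulr_ge0// ltW//.
apply: le_trans (hb _); rewrite ler_pdivlMr// (le_trans _ hM)// mulrC lerDr invr_ge0 ltW//.
Qed.

Lemma continuous_gamma_integrand a (u : R) : 0 < u -> {for u, continuous (gamma_integrand a)}.
Proof.
move=> u0; apply: cvgM.
  have [/derivable1_diffP/differentiable_continuous + _] := is_derive1_powR (a - 1) u0.
  exact.
by apply: (@continuous_comp _ _ _ -%R expR); [exact: continuousN|exact: continuous_expR].
Qed.

Lemma gamma_integrand_ge0 a u : 0 <= gamma_integrand a u.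
Proof. by rewrite mulr_ge0 ?powR_ge0 ?expR_ge0. Qed.

Lemma measurable_gamma_integrand a : measurable_fun setT (gamma_integrand a).
Proof.
apply: measurable_funM; first exact: measurable_powR.
by apply: measurable_fun_expR; exact: measurable_funN.
Qed.

Lemma gamma_substitution a :
  (\int[leb]_(u in `]0%R, +oo[) (gamma_integrand a u)%:E =
   \int[leb]_(y in `]0%R, +oo[) (gamma_integrand a (y ^+ 2 / 4) * (y / 2))%:E)%E.
Proof.
pose F (y : R) : R := y ^+ 2 / 4.
have dF (y : R) : is_derive y (1 : R) F (y / 2).
  apply: (is_derive_congr (is_derive_mulr 4^-1 (is_derive_mul (is_derive_id y 1) (is_derive_id y 1)))) => //.
  by field.
have F'E : (derive1 F) = (fun y => y / 2) by apply/funext => y; rewrite derive1E; have [_ ->] := dF y.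
have cF : continuous F by exact: is_derive_continuous dF.
have cF' : continuous (derive1 F).
  by rewrite F'E => y; apply: cvgM; [exact: cvg_id|exact: cvg_cst].
pose a_ n : R := n.+1%:R^-1; pose b_ n : R := n.+1%:R.
have a0 n : 0 < a_ n by rewrite invr_gt0.
have ab n : a_ n <= b_ n by rewrite (@le_trans _ _ 1)// ?invf_le1 ?ler1n.
have E n : (\int[leb]_(u in [set` `[F (a_ n), F (b_ n)]]) (gamma_integrand a u)%:E =
    \int[leb]_(y in [set` `[a_ n, b_ n]]) (gamma_integrand a (y ^+ 2 / 4) * (y / 2))%:E)%E.
  rewrite (@integration_by_substitution_increasing _ F).
  - by apply: eq_integral => y _; rewrite !fctE F'E.
  - exact: ab.
  - move=> x y; rewrite !in_itv/= => /andP[ax _] /andP[ay _] xy.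
    by rewrite /F ltr_pM2r// ltrXn2r// ?nnegrE ltW// (lt_le_trans (a0 n)).
  - by move=> x _; exact: cF'.
  - by apply/cvg_ex; exists (derive1 F (a_ n)); apply: cvg_at_right_filter; exact: cF'.
  - by apply/cvg_ex; exists (derive1 F (b_ n)); apply: cvg_at_left_filter; exact: cF'.
  - split; first by move=> x _; have [] := dF x.
      by apply: cvg_at_right_filter; exact: cF.
    by apply: cvg_at_left_filter; exact: cF.
  - apply: continuous_in_subspaceT => x; rewrite inE/= in_itv/= => /andP[Fx _].
    apply: continuous_gamma_integrand; apply: lt_le_trans Fx.
    by rewrite divr_gt0// exprn_gt0.
have ninc : {homo (fun n : nat => n.+1%:R : R) : i j / (i <= j)%N >-> i <= j}.
  by move=> i j ij; rewrite ler_nat.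
have ainc i j : (i <= j)%N -> a_ j <= a_ i.
  by move=> ij; rewrite lef_pV2 ?posrE// ninc.
have h1 : (\int[leb]_(u in [set` `[F (a_ n), F (b_ n)]]) (gamma_integrand a u)%:E @[n --> \oo] -->
    \int[leb]_(u in `]0%R, +oo[) (gamma_integrand a u)%:E)%E.
  rewrite -(@bigcup_itv_pos (F \o a_) (F \o b_)).
  - apply: ge0_nondecreasing_set_cvg_integral.
    + move=> i j ij; apply/subsetPset; apply: subset_itv; rewrite bnd_simp ler_pM2r//.
        by rewrite lerXn2r ?nnegrE ?ainc// ltW.
      by rewrite lerXn2r ?nnegrE ?ninc.
    + by [].
    + move=> n; apply/measurable_EFinP; apply: measurable_funTS.
      exact: measurable_gamma_integrand.
    + by move=> n x _; rewrite lee_fin gamma_integrand_ge0.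
  - move=> n; rewrite /F divr_gt0 ?exprn_gt0//=.
    have := a0 n; have : a_ n <= 1 by rewrite invf_le1 ?ler1n.
    rewrite -/(a_ n); nra.
  - by move=> n; rewrite /F ler_pM2r// expr2 ler_peMr// ler1n.
have h2 : (\int[leb]_(y in [set` `[a_ n, b_ n]]) (gamma_integrand a (y ^+ 2 / 4) * (y / 2))%:E
    @[n --> \oo] -->
    \int[leb]_(y in `]0%R, +oo[) (gamma_integrand a (y ^+ 2 / 4) * (y / 2))%:E)%E.
  rewrite -(@bigcup_itv_pos a_ b_).
  - apply: ge0_nondecreasing_set_cvg_integral.
    + move=> i j ij; apply/subsetPset; apply: subset_itv; rewrite bnd_simp.
        exact: ainc.
      exact: ninc.
    + by [].
    + move=> n; apply/measurable_EFinP; apply: measurable_funTS; apply: measurable_funM.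
        apply: (measurableT_comp (measurable_gamma_integrand a)).
        by apply: measurable_funM => //; exact: exprn_measurable.
      exact: measurable_funM.
    + move=> n x; rewrite /= in_itv/= => /andP[ax _]; rewrite lee_fin mulr_ge0 ?gamma_integrand_ge0//.
      by rewrite divr_ge0// (le_trans _ ax)// ltW.
  - by move=> n; rewrite a0/=.
  - by move=> n; rewrite ler_piMr// invf_le1// ler1n.
by rewrite (funext E) in h1; exact: (cvg_unique _ h1 h2).
Qed.

(* As [1 - e^-u <= u], the integrand is at most [(1 - e^-u)^(a-1) e^-u], whose primitive
   [(1 - e^-u)^a / a] is bounded by [1 / a]. *)
Lemma gamma_integrand_tail (a d : R) : 0 < a -> a < 1 -> 0 < d ->
  (\int[leb]_(u in `[d, +oo[) (gamma_integrand a u)%:E <= (a^-1)%:E)%E.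
Proof.
move=> a0 a1 d0.
pose F (u : R) : R := a^-1 * (1 - expR (- u)) `^ a.
pose f (u : R) : R := (1 - expR (- u)) `^ (a - 1) * expR (- u).
have e1 (u : R) : 0 < u -> 0 < 1 - expR (- u) by move=> u0; rewrite subr_gt0 expR_lt1 oppr_lt0.
have dE (u : R) : is_derive u (1 : R) (fun u : R => 1 - expR (- u)) (expR (- u)).
  have dn : is_derive u (1 : R) (fun u : R => -1 * u + 0) (-1) by exact: is_derive_linear.
  have de := @is_derive_comp1 _ expR (fun u => -1 * u + 0) u _ _ (is_derive_expR _) dn.
  apply: (is_derive_congr (is_derive_add (is_derive_cst (1 : R) u 1) (is_derive_opp de))).
    by move=> x; rewrite addr0 mulN1r.
  by rewrite addr0 mulN1r add0r mulrN1 opprK.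
have dF (u : R) : 0 < u -> is_derive u (1 : R) F (f u).
  move=> u0; have dp := is_derive1_powR a (e1 _ u0).
  have dc := @is_derive_comp1 _ (fun x : R => x `^ a) (fun u => 1 - expR (- u)) u _ _ dp (dE u).
  apply: (is_derive_congr (is_derive_mull a^-1 dc)) => //.
  by rewrite /f !mulrA mulVf ?gt_eqF// mul1r.
have cE : continuous (fun u : R => 1 - expR (- u)) by exact: is_derive_continuous dE.
have cp (u b : R) : 0 < u -> {for u, continuous (fun u => (1 - expR (- u)) `^ b)}.
  move=> u0; apply: (@continuous_comp _ _ _ (fun u => 1 - expR (- u)) (fun x : R => x `^ b)); first exact: cE.
  have [/derivable1_diffP/differentiable_continuous + _] := is_derive1_powR b (e1 _ u0).
  exact.
have cf (u : R) : 0 < u -> {for u, continuous f}.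
  move=> u0; apply: cvgM; first exact: cp.
  by apply: (@continuous_comp _ _ _ -%R expR); [exact: continuousN|exact: continuous_expR].
have F1 : F u @[u --> +oo%R] --> a^-1.
  have -> : a^-1 = a^-1 * (1 : R) `^ a by rewrite powR1 mulr1.
   apply: cvgMl_tmp.
  apply: (@cvg_comp _ _ _ (fun u : R => 1 - expR (- u)) (fun x : R => x `^ a) _ (nbhs (1 : R))).
    have : 1 - expR (- u) @[u --> +oo%R] --> (1 - 0 : R).
      by apply: cvgB; [exact: cvg_cst|exact: cvgr_expR].
    by rewrite subr0.
  have [/derivable1_diffP/differentiable_continuous + _] := is_derive1_powR a (@ltr01 R).
  exact.
apply: (@le_trans _ _ (\int[leb]_(u in `[d, +oo[) (f u)%:E)%E).
  apply: ge0_le_integral => //.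
  - by move=> u _; rewrite lee_fin gamma_integrand_ge0.
  - apply/measurable_EFinP; apply: measurable_funTS; exact: measurable_gamma_integrand.
  - apply/measurable_EFinP; apply: measurable_funTS; apply: measurable_funM.
      apply: (measurableT_comp (measurable_powR _)); apply: measurable_funB => //.
      by apply: measurable_fun_expR; exact: measurable_funN.
    by apply: measurable_fun_expR; exact: measurable_funN.
  - move=> u; rewrite /= in_itv/= andbT => du; have u0 := lt_le_trans d0 du.
    rewrite lee_fin /gamma_integrand ler_wpM2r ?expR_ge0//.
    rewrite -opprB; apply: (@powRN_anti R (1 - a)); rewrite ?e1 ?subr_gt0//.
    by rewrite lerBlDr -lerBlDl; exact: expR_ge1Dx.
rewrite (@ge0_continuous_FTC2y _ f F d a^-1) ?lee_fin//.
- by rewrite gerBl mulr_ge0 ?powR_ge0// invr_ge0 ltW.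
- by move=> u _; rewrite mulr_ge0 ?powR_ge0 ?expR_ge0.
- apply: continuous_in_subspaceT => u; rewrite inE/= in_itv/= andbT => du.
  exact: cf (lt_le_trans d0 du).
- by move=> u du; have [] := dF u (lt_trans d0 du).
- apply: cvg_at_right_filter; apply: cvgMl_tmp; exact: cp.
- move=> u; rewrite in_itv/= andbT => du; rewrite derive1E.
  by have [_ ->] := dF u (lt_trans d0 du).
Qed.

Lemma integral_gamma_integrand_le (a : R) : 0 < a -> a < 1 ->
  (\int[leb]_(u in `]0%R, +oo[) (gamma_integrand a u)%:E <= (a^-1)%:E)%E.
Proof.
move=> a0 a1; pose A n := [set` `[n.+1%:R^-1 : R, +oo[].
have <- : \bigcup_n A n = [set` `]0, +oo[].
  apply/seteqP; split => [x [n _]/=|x/=].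
    by rewrite /A/= !in_itv/= !andbT; apply: lt_le_trans.
  rewrite in_itv/= andbT => x0; exists (Num.bound x^-1) => //.
  rewrite /A/= in_itv/= andbT invf_ple ?posrE//.
  have x1 : 0 <= x^-1 by rewrite invr_ge0 ltW.
  by rewrite (le_trans (ltW (archi_boundP x1)))// ler_nat.
have h : (\int[leb]_(u in A n) (gamma_integrand a u)%:E @[n --> \oo] -->
    \int[leb]_(u in \bigcup_n A n) (gamma_integrand a u)%:E)%E.
  apply: ge0_nondecreasing_set_cvg_integral.
  - move=> i j ij; apply/subsetPset; apply: subset_itv; rewrite bnd_simp//.
    by rewrite lef_pV2 ?posrE// ler_nat.
  - by move=> n; exact: measurable_itv.
  - by move=> n; apply/measurable_EFinP; apply: measurable_funTS; exact: measurable_gamma_integrand.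
  - by move=> n x _; rewrite lee_fin gamma_integrand_ge0.
rewrite -(cvg_lim _ h)//; apply: lime_le; first by apply/cvg_ex; eexists; exact: h.
by apply: nearW => n; exact: gamma_integrand_tail.
Qed.

Lemma Gamma_gt0 (a : R) : 0 < a -> a < 1 -> 0 < Gamma a.
Proof.
move=> a0 a1; rewrite /Gamma /Rintegral.
pose c : R := 2 `^ (a - 1) * expR (- 2).
have c0 : 0 < c by rewrite mulr_gt0 ?powR_gt0 ?expR_gt0.
have h : (c%:E <= \int[leb]_(u in `]0%R, +oo[) (gamma_integrand a u)%:E)%E.
  apply: (@le_trans _ _ (\int[leb]_(u in `[1%R, 2%R]) (gamma_integrand a u)%:E)%E).
    apply: (@le_trans _ _ (\int[leb]_(u in `[1%R, 2%R]) c%:E)%E).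
      rewrite integral_cst//= lebesgue_measure_itv/= lte_fin ltr1n/= -EFinB.
      by rewrite -EFinM lee_fin (_ : 2 - 1 = 1 :> R) ?mulr1//; ring.
    apply: ge0_le_integral => //.
    - by move=> u _; rewrite lee_fin ltW.
    - by apply/measurable_EFinP; apply: measurable_funTS; exact: measurable_gamma_integrand.
    - move=> u; rewrite /= in_itv/= => /andP[u1 u2]; have u0 := lt_le_trans ltr01 u1.
      rewrite lee_fin ler_pM ?powR_ge0 ?expR_ge0//.
        by rewrite -opprB; apply: (@powRN_anti R (1 - a)); rewrite ?subr_gt0.
      by rewrite ler_expR lerN2.
  apply: ge0_subset_integral => //.
  - by apply/measurable_EFinP; apply: measurable_funTS; exact: measurable_gamma_integrand.
  - by move=> u _; rewrite lee_fin gamma_integrand_ge0.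
  - by move=> u; rewrite /= !in_itv/= andbT => /andP[/(lt_le_trans ltr01)].
have le := integral_gamma_integrand_le a0 a1.
apply: (lt_le_trans c0); rewrite -lee_fin fineK//.
by rewrite ge0_fin_numE ?(le_lt_trans le) ?ltry//; apply: integral_ge0 => u _;
  rewrite lee_fin gamma_integrand_ge0.
Qed.

Lemma integral_gamma_integrand (a : R) : 0 < a -> a < 1 ->
  (\int[leb]_(u in `]0%R, +oo[) (gamma_integrand a u)%:E = (Gamma a)%:E)%E.
Proof.
move=> a0 a1; have le := integral_gamma_integrand_le a0 a1.
rewrite /Gamma /Rintegral fineK// ge0_fin_numE ?(le_lt_trans le) ?ltry//.
by apply: integral_ge0 => u _; rewrite lee_fin gamma_integrand_ge0.
Qed.

End GammaIntegral.

Section RadialDensity.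
Context {R : realType}.
Local Notation T := (measurableTypeR R).
Local Notation leb := (@lebesgue_measure R).
Variable s : R.
Hypotheses (s_gt0 : 0 < s) (s_lt1 : s < 1).

Definition ydens (y : R) : R :=
  if 0 < y then 2 * pi `^ (1 - s) / Gamma (1 - s) * y `^ (1 - 2 * s) else 0.

Let cs_gt0 : 0 < 2 * pi `^ (1 - s) / Gamma (1 - s).
Proof.
by rewrite divr_gt0 ?mulr_gt0 ?powR_gt0 ?pi_gt0// Gamma_gt0 ?subr_gt0// gtrBl.
Qed.

Lemma ydens_ge0 y : 0 <= ydens y.
Proof. by rewrite /ydens; case: ifP => // _; rewrite mulr_ge0 ?powR_ge0// ltW. Qed.

Lemma measurable_ydens : measurable_fun setT (ydens : T -> R).
Proof.
apply: measurable_fun_ifT => //; first exact: measurable_fun_ltr.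
by apply: measurable_funM => //; exact: measurable_powR.
Qed.

Lemma ydens_scale r y : 0 < r -> ydens (r * y) = r `^ (1 - 2 * s) * ydens y.
Proof.
move=> r0; rewrite /ydens pmulr_rgt0//; case: ifPn => [y0|_]; last by rewrite mulr0.
by rewrite powRM ?ltW// mulrCA.
Qed.

Lemma integral_ydens_gauss :
  (\int[leb]_y (ydens y * expR (- (y ^+ 2 / 4)))%:E = ((4 * pi) `^ (1 - s))%:E)%E.
Proof.
pose a := 1 - s; have a0 : 0 < a by rewrite subr_gt0.
have a1 : a < 1 by rewrite gtrBl.
have G0 := Gamma_gt0 a0 a1.
pose c : R := (4 * pi) `^ a / Gamma a.
transitivity (\int[leb]_(y in `]0%R, +oo[) (c%:E * (gamma_integrand a (y ^+ 2 / 4) * (y / 2))%:E))%E.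
  rewrite [RHS]integral_mkcond; apply: eq_integral => y _; rewrite patchE.
  rewrite mem_setE in_itv/= andbT /ydens; case: ifPn => y0; last by rewrite mul0r.
  rewrite -EFinM; congr EFin; rewrite /gamma_integrand /c -/a.
  rewrite [(4 * pi) `^ a]powRM ?pi_ge0// -[y ^+ 2]powR_mulrn ?ltW//.
  rewrite [(_ / 4) `^ _]powRM ?powR_ge0 ?invr_ge0// -powRrM.
  have -> : y `^ (2%:R * (a - 1)) = y `^ (1 - 2 * s) * y^-1.
    rewrite -powR_inv1 ?ltW// -powRD; first by congr (_ `^ _); rewrite /a; ring.
    by rewrite (gt_eqF y0) implybT.
  have -> : 4^-1 `^ (a - 1) = 4 / 4 `^ a :> R.
    rewrite -powR_inv1// -powRrM mulN1r opprB powRB//; last by rewrite pnatr_eq0 implybT.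
    by rewrite powRr1.
  rewrite powR_mulrn ?ltW//.
  have p4 : 4 `^ a != 0 :> R by rewrite gt_eqF ?powR_gt0.
  by field; rewrite p4 !gt_eqF.
rewrite ge0_integralZl//=; last 3 first.
- apply/measurable_EFinP; apply: measurable_funTS; apply: measurable_funM.
    apply: (measurableT_comp (measurable_gamma_integrand a)).
    by apply: measurable_funM => //; exact: exprn_measurable.
  exact: measurable_funM.
- move=> y; rewrite in_itv/= andbT => y0; rewrite lee_fin mulr_ge0 ?gamma_integrand_ge0//.
  by rewrite divr_ge0// ltW.
- by rewrite lee_fin divr_ge0 ?powR_ge0 ?ltW.
rewrite -gamma_substitution integral_gamma_integrand// -EFinM; congr EFin.
by rewrite /c divfK// gt_eqF.
Qed.

Lemma measurable_ydens_gauss (c : R) :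
  measurable_fun setT (fun y : T => ydens y * expR (- (c * y ^+ 2))).
Proof.
apply: measurable_funM; first exact: measurable_ydens.
apply: measurable_fun_expR; apply: measurable_funN; exact: measurable_funM.
Qed.

Lemma integrable_ydens_gauss (c : R) : 0 < c ->
  leb.-integrable setT (EFin \o (fun y => ydens y * expR (- (c * y ^+ 2)))).
Proof.
move=> c0; pose r := 2 * Num.sqrt c.
have r0 : 0 < r by rewrite mulr_gt0 ?sqrtr_gt0.
have p0 y : 0 <= ydens y * expR (- (c * y ^+ 2)) by rewrite mulr_ge0 ?ydens_ge0 ?expR_ge0.
pose C := (r `^ (1 - 2 * s))^-1 * ((4 * pi) `^ (1 - s) / r).
apply: (@integrable_ge0_EFin _ _ C) => //; first exact: measurable_ydens_gauss.
have h := integral_ydens_gauss.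
rewrite (ge0_integral_affine 0 r0) in h; last 2 first.
- apply/measurable_EFinP; apply: eq_measurable_fun (measurable_ydens_gauss 4^-1) => y _.
  by congr (_ * expR (- _)); rewrite mulrC.
- by move=> y; rewrite lee_fin mulr_ge0 ?ydens_ge0 ?expR_ge0.
have E y : ydens (r * y + 0) * expR (- ((r * y + 0) ^+ 2 / 4)) =
    r `^ (1 - 2 * s) * (ydens y * expR (- (c * y ^+ 2))).
  rewrite addr0 ydens_scale// mulrA; congr (_ * expR (- _)).
  by rewrite /r !exprMn sqr_sqrtr ?ltW//; field.
have hE : (\int[leb]_x (ydens (r * x + 0)%R * expR (- ((r * x + 0) ^+ 2 / 4)))%:E =
    \int[leb]_x ((r `^ (1 - 2 * s))%:E * (ydens x * expR (- (c * x ^+ 2)))%:E))%E.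
  by apply: eq_integral => y _; rewrite E EFinM.
rewrite {}hE in h.
rewrite ge0_integralZl// in h; last 3 first.
- by apply/measurable_EFinP; exact: measurable_ydens_gauss.
- by move=> y _; rewrite lee_fin.
- by rewrite lee_fin powR_ge0.
have p1 : 0 < r `^ (1 - 2 * s) by rewrite powR_gt0.
set I := (\int[leb]_x _)%E in h *.
have I0 : (0 <= I)%E by apply: integral_ge0 => y _; rewrite lee_fin.
move: h I0; case: I => [I| |]//; last by rewrite !gt0_muley ?lte_fin.
rewrite -!EFinM => -[h] _; congr EFin; rewrite /C -h; field.
by rewrite !gt_eqF.
Qed.

End RadialDensity.

Section IteratedDomination.
Context d1 d2 (T1 : measurableType d1) (T2 : measurableType d2) (R : realType).
Variables (m1 : {sigma_finite_measure set T1 -> \bar R})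
          (m2 : {sigma_finite_measure set T2 -> \bar R}).

Lemma norm_Rintegral_le (f g : T2 -> R) : measurable_fun setT f ->
  m2.-integrable setT (EFin \o g) -> (forall y, `|f y| <= g y) ->
  `|\int[m2]_y f y| <= \int[m2]_y g y.
Proof.
move=> mf gi fg.
have fi : m2.-integrable setT (EFin \o f) by exact: (integrable_dominated measurableT mf gi).
rewrite (le_trans (le_normr_Rintegral measurableT fi))// le_Rintegral//.
exact: (integrable_norm fi).
Qed.

Lemma dominated_iterated_cvg (F : R -> T1 * T2 -> R) (f : T1 * T2 -> R) (a : R)
    (g1 : T1 -> R) (g2 : T2 -> R) :
  (forall t, a < t -> measurable_fun setT (F t)) ->
  (forall p, F t p @[t --> a^'+] --> f p) ->
  m1.-integrable setT (EFin \o g1) -> m2.-integrable setT (EFin \o g2) ->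
  (forall t x y, a < t -> `|F t (x, y)| <= g1 x * g2 y) ->
  \int[m1]_x \int[m2]_y F t (x, y) @[t --> a^'+] --> \int[m1]_x \int[m2]_y f (x, y).
Proof.
move=> mF Ff i1 i2 Fg.
apply: (@dominated_Rintegral_cvg_right _ _ _ m1 _ (fun t x => \int[m2]_y F t (x, y)) a _
  (fun x => (\int[m2]_y g2 y) * g1 x)) => //.
- by move=> t at_; apply: measurable_Rintegral_section; exact: mF.
- move=> x _; apply: (@dominated_Rintegral_cvg_right _ _ _ m2 _ (fun t y => F t (x, y)) a _
    (fun y => g1 x * g2 y)) => //.
  + by move=> t at_; apply: (measurableT_comp (mF t at_)).
  + exact: integrable_mull.
  + by move=> t y at_ _; exact: Fg.
- exact: integrable_mull.
- move=> t x at_ _; rewrite mulrC -RintegralZl//.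
  apply: norm_Rintegral_le; last by move=> y; exact: Fg.
  + by apply: (measurableT_comp (mF t at_)).
  + exact: integrable_mull.
Qed.

End IteratedDomination.

Section Gaussian.
Context {R : realType}.
Local Notation T := (measurableTypeR R).
Local Notation leb := (@lebesgue_measure R).
Local Notation rn n := (@lebesgue_rn R n).

Lemma Rintegral_affine (a b : R) (f : T -> R) : 0 < a -> measurable_fun setT f ->
  \int[leb]_x f x = a * \int[leb]_x f (a * x + b).
Proof.
move=> a0 mf; have mF : measurable_fun setT (EFin \o f) by exact/measurable_EFinP.
pose A (x : T) : T := a * x + b.
have hp : (((EFin \o f) \o A)^\+ = (EFin \o f)^\+ \o A)%E by exact: funepos_comp.
have hn : (((EFin \o f) \o A)^\- = (EFin \o f)^\- \o A)%E by exact: funeneg_comp.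
rewrite /Rintegral -[fun _ => (f (a * _ + b))%:E]/((EFin \o f) \o A).
rewrite [in LHS]integralE [in RHS]integralE hp hn.
rewrite (ge0_integral_affine b a0 (measurable_funepos mF))//.
rewrite (ge0_integral_affine b a0 (measurable_funeneg mF))//.
have p0 : (0 <= \int[leb]_x ((EFin \o f)^\+ \o A) x)%E.
  by apply: integral_ge0 => x _; exact: funepos_ge0.
have n0 : (0 <= \int[leb]_x ((EFin \o f)^\- \o A) x)%E.
  by apply: integral_ge0 => x _; exact: funeneg_ge0.
rewrite -[X in (a%:E * X - _)%E]/(\int[leb]_x ((EFin \o f)^\+ \o A) x)%E.
rewrite -[X in (_ - a%:E * X)%E]/(\int[leb]_x ((EFin \o f)^\- \o A) x)%E.
move: p0 n0; case: (\int[leb]_x _)%E => [p| |]// _; case: (\int[leb]_x _)%E => [n| |]// _.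
- by rewrite /= mulrBr.
- by rewrite gt0_muley ?lte_fin//= mulr0.
- by rewrite gt0_muley ?lte_fin//= mulr0.
- by rewrite gt0_muley ?lte_fin//= mulr0.
Qed.

Definition gauss n (c : R) (z : n.-tuple T) : R := expR (- (c * nrm z ^+ 2)).

Lemma gauss_prod n c (z : n.-tuple T) :
  gauss c z = \prod_(i < n) expR (- (c * tnth z i ^+ 2)).
Proof. by rewrite -expR_sum sumrN -mulr_sumr -sqr_nrm. Qed.

Let g4 (x : T) : R := expR (- (4^-1 * x ^+ 2)).

Let integral_g4 : (\int[leb]_x (g4 x)%:E = (2 * Num.sqrt pi)%:E)%E.
Proof. by rewrite -integral_gauss4; apply: eq_integral => x _; rewrite /g4 mulrC. Qed.

Let measurable_g4 : measurable_fun setT g4.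
Proof. by apply: measurable_fun_expR; apply: measurable_funN; exact: measurable_funM. Qed.

Lemma Rintegral_gauss4 n : \int[rn n]_z gauss 4^-1 z = (2 * Num.sqrt pi) ^+ n.
Proof.
rewrite /Rintegral; under eq_integral do rewrite gauss_prod.
by rewrite (ge0_integral_rn_prod n measurable_g4 (fun x => expR_ge0 _) integral_g4).
Qed.

Lemma integrable_gauss n c : 0 < c -> (rn n).-integrable setT (EFin \o @gauss n c).
Proof.
move=> c0; pose r := 2 * Num.sqrt c.
have r0 : 0 < r by rewrite mulr_gt0 ?sqrtr_gt0.
have i4 : (rn n).-integrable setT (EFin \o @gauss n 4^-1).
  apply: eq_integrable (integrable_rn_prod n measurable_g4 (fun x => expR_ge0 _)
    (integrable_ge0_EFin measurable_g4 (fun x => expR_ge0 _) integral_g4)) => // z _.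
  by rewrite /comp gauss_prod.
apply: eq_integrable (integrable_rn_affine (fun=> 0) r0 i4) => // z _.
rewrite /comp /gauss (nrm_scale z (ltW r0)).
have r2 : r ^+ 2 = 4 * c by rewrite exprMn sqr_sqrtr ?ltW// expr2; congr (_ * _); ring.
by rewrite exprMn r2 !mulrA mulVf// mul1r.
Qed.

End Gaussian.

(** * The initial condition *)

Section InitialLimit.
Context {R : realType} {m k : nat}.
Local Notation T := (measurableTypeR R).
Local Notation pt := (pt R m k).
Local Notation rn n := (@lebesgue_rn R n).
Local Notation leb := (@lebesgue_measure R).
Local Notation X := (m.-tuple T * k.-tuple T * T)%type.
Implicit Types (z : m.-tuple T) (sg mu : k.-tuple T) (y : T) (t th : R) (p : X).

Variable S : set (pt -> R).
Hypothesis hS : vertical_schwartz S.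
Variable s : R.
Hypotheses (s_gt0 : 0 < s) (s_lt1 : s < 1).
Let beta : R := m%:R / 2 + 1 - s.
Local Notation c0 := (@wave_const R m k s).

Let beta_gt0 : 0 < beta.
Proof. by rewrite /beta -addrA ltr_wpDl ?divr_ge0// subr_gt0. Qed.

Definition point_measure : {sigma_finite_measure set X -> \bar R} :=
  product_sigma_finite (product_sigma_finite (rn m) (rn k)) leb.

Let c0_ge0 : 0 <= c0.
Proof. by rewrite divr_ge0 ?powR_ge0// exprn_ge0. Qed.

Variable u : pt -> R.
Hypothesis Su : S u.

Lemma modulus_gauss_le t z sg y mu : 0 < t ->
  modulus beta t (rv_of z, rv_of sg, y) mu <=
  weight beta t mu * (gauss (4 * t)^-1 z * expR (- ((4 * t)^-1 * y ^+ 2))).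
Proof.
move=> t0; rewrite /modulus ler_wpM2l ?weight_ge0// -expRD ler_expR -opprD lerN2 -mulrDr.
set r := sqr_radius _.
rewrite -[nrm z ^+ 2 + y ^+ 2]/r; have -> : (4 * t)^-1 * r = r / 4 * t^-1 by rewrite invfM; ring.
by rewrite ler_wpM2l ?cosh_shc_ge// divr_ge0// sqr_radius_ge0.
Qed.

Definition joint_integrand t th (w : X * k.-tuple T) : R :=
  wave beta t (fun=> c0) th (pt_of w.1) w.2 * u (pt_of w.1) * ydens s w.1.2.

Lemma measurable_sqr_radius :
  measurable_fun setT (fun p : X => sqr_radius (pt_of p)).
Proof.
apply: (@measurable_funD _ _ _ _ (fun p : X => nrm p.1.1 ^+ 2) (fun p : X => p.2 ^+ 2)).
  by apply: measurable_funX; apply: (measurableT_comp measurable_nrm); apply: measurableT_comp.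
by apply: measurable_funX; exact: measurable_snd.
Qed.

Lemma measurable_joint_integrand t th : measurable_fun setT (joint_integrand t th).
Proof.
apply: measurable_funM; last by apply: (measurableT_comp (measurable_ydens s)); apply: measurableT_comp.
apply: measurable_funM; last first.
  by apply: (measurableT_comp (measurable_continuous_pt (vs_continuous hS Su))).
apply: measurable_funM.
  apply: measurable_funM => //; apply: measurable_funM.
    by apply: (measurableT_comp (measurable_weight beta t)).
  apply: measurable_fun_expR; apply: measurable_funN; apply: measurable_funM.
    apply: measurable_funM => //; exact: (measurableT_comp measurable_sqr_radius).
  by apply: (measurableT_comp (measurable_coth_symbol t)).
apply: measurable_fun_cos; apply: measurable_funD => //.
by apply: measurable_dotp2 => //; do 2 apply: measurableT_comp => //.
Qed.

Lemma joint_integrand_le : exists2 C, 0 <= C & forall t th z sg y mu, 0 < t ->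
  `|joint_integrand t th ((z, sg, y), mu)| <=
  gauss (4 * t)^-1 z * (C * decay sg) * (ydens s y * expR (- ((4 * t)^-1 * y ^+ 2))) *
    (c0 * weight beta t mu).
Proof.
have [C C0 hC] := vs_bound hS Su; exists C => // t th z sg y mu t0.
rewrite /joint_integrand /wave -[pt_of _]/(rv_of z, rv_of sg, y)
  -[(_, mu).2]/mu -[(_, mu).1.2]/y -[(_, y).1.2]/(rv_of sg).
set c := cos _; set v := u _; set d := ydens s y; set M := modulus _ _ _ _; set K := weight _ _ _.
rewrite normrM [`|_ * v|]normrM [`|_ * c|]normrM [`|_ * M|]normrM.
have d0 : 0 <= d by exact: ydens_ge0.
have hM : M <= K * (gauss (4 * t)^-1 z * expR (- ((4 * t)^-1 * y ^+ 2))) by exact: modulus_gauss_le.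
have M0 : 0 <= M by exact: modulus_ge0.
rewrite (ger0_norm c0_ge0) (ger0_norm d0) (ger0_norm M0).
have c1 : `|c| <= 1 by exact: cos_max.
have h1 : c0 * M * `|c| <= c0 * M by rewrite ler_piMr//; exact: (mulr_ge0 c0_ge0 M0).
apply: (@le_trans _ _ (c0 * M * (C * decay sg) * d)).
  by rewrite ler_wpM2r// ler_pM ?hC// mulr_ge0// mulr_ge0.
rewrite [leRHS](_ : _ = c0 * (K * (gauss (4 * t)^-1 z * expR (- ((4 * t)^-1 * y ^+ 2)))) *
  (C * decay sg) * d); last by ring.
rewrite ler_wpM2r// ler_wpM2r ?mulr_ge0 ?(ltW (decay_gt0 _))//.
by rewrite ler_wpM2l.
Qed.

Lemma integrable_weight1 t : 0 < t ->
  (rn k).-integrable setT (EFin \o (fun mu => c0 * weight beta t mu)).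
Proof.
move=> t0; have := integrable_weight beta_gt0 t0 (@tame_cst R k c0).
by apply: eq_integrable => // mu _; rewrite /comp ger0_norm.
Qed.

Lemma integrable_joint t th : 0 < t ->
  (point_measure \x rn k)%E.-integrable setT (EFin \o joint_integrand t th).
Proof.
move=> t0; have [C C0 hC] := joint_integrand_le.
have t4 : 0 < (4 * t)^-1 by rewrite invr_gt0 mulr_gt0.
pose g1 z := gauss (4 * t)^-1 z.
pose g2 sg := C * decay sg.
pose g3 y := ydens s y * expR (- ((4 * t)^-1 * y ^+ 2)).
have i1 : (rn m).-integrable setT (EFin \o g1) by exact: integrable_gauss.
have i2 : (rn k).-integrable setT (EFin \o g2).
  by apply: integrable_mull => //; exact: integrable_decay.
have i3 : leb.-integrable setT (EFin \o g3) by exact: integrable_ydens_gauss.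
have i12 := integrable_tensor i1 i2.
have i123 := @integrable_tensor _ _ _ _ R leb (product_sigma_finite (rn m) (rn k)) _ _ i12 i3.
have i := @integrable_tensor _ _ _ _ R (rn k) point_measure _ _ i123 (integrable_weight1 t0).
apply: (integrable_dominated measurableT (measurable_joint_integrand t th) i).
by move=> [[[z sg] y] mu] _; exact: hC.
Qed.

Lemma integrable_joint_frequency t th p : 0 < t ->
  (rn k).-integrable setT (fun mu => (joint_integrand t th (p, mu))%:E).
Proof.
move=> t0; have i := integrable_wave beta_gt0 th (pt_of p) t0 (@tame_cst R k c0).
apply: eq_integrable (integrable_mull (u (pt_of p) * ydens s p.2) measurableT i) => // mu _.
by rewrite /comp /joint_integrand/= mulrC -!mulrA.
Qed.

Lemma integrable_joint_point t th mu : 0 < t ->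
  point_measure.-integrable setT (fun p => (joint_integrand t th (p, mu))%:E).
Proof.
move=> t0; have [C C0 hC] := joint_integrand_le.
have t4 : 0 < (4 * t)^-1 by rewrite invr_gt0 mulr_gt0.
pose g1 z := gauss (4 * t)^-1 z.
pose g2 sg := C * decay sg.
pose g3 y := ydens s y * expR (- ((4 * t)^-1 * y ^+ 2)).
have i1 : (rn m).-integrable setT (EFin \o g1) by exact: integrable_gauss.
have i2 : (rn k).-integrable setT (EFin \o g2).
  by apply: integrable_mull => //; exact: integrable_decay.
have i3 : leb.-integrable setT (EFin \o g3) by exact: integrable_ydens_gauss.
have i12 := integrable_tensor i1 i2.
have i123 := @integrable_tensor _ _ _ _ R leb (product_sigma_finite (rn m) (rn k)) _ _ i12 i3.
apply: (@integrable_dominated _ _ _ _ _ _ (fun p => (c0 * weight beta t mu) *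
  (g1 p.1.1 * g2 p.1.2 * g3 p.2))) => //.
- by apply: (measurableT_comp (measurable_joint_integrand t th)).
- exact: integrable_mull.
- by move=> [[z sg] y] _; rewrite mulrC; exact: hC.
Qed.

Lemma integrable_joint_slab t th mu y : 0 < t ->
  (rn m \x rn k)%E.-integrable setT (fun q => (joint_integrand t th ((q, y), mu))%:E).
Proof.
move=> t0; have [C C0 hC] := joint_integrand_le.
have t4 : 0 < (4 * t)^-1 by rewrite invr_gt0 mulr_gt0.
have i2 : (rn k).-integrable setT (EFin \o (fun sg => C * decay sg)).
  by apply: integrable_mull => //; exact: integrable_decay.
apply: (@integrable_dominated _ _ _ _ _ _ (fun q =>
  ((ydens s y * expR (- ((4 * t)^-1 * y ^+ 2))) * (c0 * weight beta t mu)) *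
  (gauss (4 * t)^-1 q.1 * (C * decay q.2)))) => //.
- have mq : measurable_fun setT (fun q : m.-tuple T * k.-tuple T => ((q, y), mu)).
    by do 2 apply: measurable_fun_pair => //.
  exact: (measurableT_comp (measurable_joint_integrand t th) mq).
- by apply: integrable_mull => //; exact: integrable_tensor (integrable_gauss m t4) i2.
- move=> [z sg] _; rewrite -[(z, sg).1]/z -[(z, sg).2]/sg.
  have := hC t th z sg y mu t0; congr (_ <= _); ring.
Qed.

Lemma integrable_joint_vertical t th mu y z : 0 < t ->
  (rn k).-integrable setT (fun sg => (joint_integrand t th ((z, sg, y), mu))%:E).
Proof.
move=> t0; have i := integrable_slice_cos hS z y mu th Su.
apply: eq_integrable (integrable_mull
  (c0 * modulus beta t (rv_of z, 0, y) mu * ydens s y) measurableT i) => // sg _.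
rewrite /comp -[joint_integrand t th _]/(c0 * modulus beta t (rv_of z, 0, y) mu *
  cos (dotp (rv_of sg) mu + th) * u (rv_of z, rv_of sg, y) * ydens s y).
by congr EFin; ring.
Qed.

Lemma Rintegral_joint_vertical t th mu y z : 0 < t ->
  \int[rn k]_sg joint_integrand t th ((z, sg, y), mu) =
  c0 * modulus beta t (rv_of z, 0, y) mu * ydens s y * vfourier u th z mu y.
Proof.
move=> t0; rewrite -RintegralZl//; last exact: (integrable_slice_cos hS).
apply: eq_Rintegral => sg _.
rewrite -[joint_integrand t th _]/(c0 * modulus beta t (rv_of z, 0, y) mu *
  cos (dotp (rv_of sg) mu + th) * u (rv_of z, rv_of sg, y) * ydens s y).
by ring.
Qed.

Lemma Rintegral_waveint_vfourier t th : 0 < t ->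
  \int[point_measure]_p (waveint beta t (fun=> c0) th (pt_of p) * u (pt_of p) * ydens s p.2) =
  \int[rn k]_mu \int[leb]_y \int[rn m]_z
    (c0 * modulus beta t (rv_of z, 0, y) mu * ydens s y * vfourier u th z mu y).
Proof.
move=> t0; have i := integrable_joint th t0.
transitivity (\int[point_measure]_p \int[rn k]_mu joint_integrand t th (p, mu)).
  apply: eq_Rintegral => p _; rewrite -mulrA mulrC /waveint.
  rewrite -RintegralZl//; last exact: (integrable_wave beta_gt0 th (pt_of p) t0 (@tame_cst R k c0)).
  by apply: eq_Rintegral => mu _; rewrite /joint_integrand -[(_, mu).2]/mu -[(p, mu).1]/p mulrC mulrA.
rewrite -(Rintegral_fubini1 i); last by move=> p; exact: integrable_joint_frequency.
rewrite (Rintegral_fubini2 i); last by move=> mu; exact: integrable_joint_point.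
apply: eq_Rintegral => mu _.
have i2 : (product_sigma_finite (rn m) (rn k) \x leb)%E.-integrable setT
  (EFin \o (fun p => joint_integrand t th (p, mu))) by exact: (integrable_joint_point th mu t0).
transitivity (\int[leb]_y \int[product_sigma_finite (rn m) (rn k)]_q joint_integrand t th ((q, y), mu)).
  by apply: (Rintegral_fubini2 i2) => y; exact: integrable_joint_slab.
apply: eq_Rintegral => y _.
have i3 : (rn m \x rn k)%E.-integrable setT (EFin \o (fun q => joint_integrand t th ((q, y), mu))).
  exact: integrable_joint_slab.
transitivity (\int[rn m]_z \int[rn k]_sg joint_integrand t th ((z, sg, y), mu)).
  by apply: (Rintegral_fubini1 i3) => z; exact: integrable_joint_vertical.
by apply: eq_Rintegral => z _; exact: Rintegral_joint_vertical.
Qed.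

(* The joint integrand, already integrated over [sigma], at [(sqrt t z, sqrt t y)]; the
   powers of [t] in the Jacobian, the density and the weight cancel. *)
Definition rescaled_integrand t th (w : k.-tuple T * T * m.-tuple T) : R :=
  over_sinh (t * nrm w.1.1) `^ beta *
  expR (- (4^-1 * (nrm w.2 ^+ 2 + w.1.2 ^+ 2) * over_tanh (t * nrm w.1.1))) *
  ydens s w.1.2 *
  vfourier u th (affine (Num.sqrt t) (fun=> 0) w.2) w.1.1 (Num.sqrt t * w.1.2).

Lemma rescaled_integrand_le : exists2 C, 0 <= C & forall t th z mu y, 0 < t ->
  `|rescaled_integrand t th (mu, y, z)| <=
  C * decay mu * (ydens s y * expR (- (4^-1 * y ^+ 2))) * gauss 4^-1 z.
Proof.
have [C C0 hC] := vfourier_decay hS Su; exists C => // t th z mu y t0.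
rewrite /rescaled_integrand -[(_, z).2]/z -[(_, z).1.1]/mu -[(_, z).1.2]/y.
set V := vfourier _ _ _ _ _; set d := ydens s y; set r := nrm z ^+ 2 + y ^+ 2.
have S0 := shc_gt0 (nrm mu) t0.
have r0 : 0 <= r by rewrite addr_ge0 ?sqr_ge0.
have d0 : 0 <= d by exact: ydens_ge0.
have o1 : over_sinh (t * nrm mu) `^ beta <= 1.
  apply: (@le_trans _ _ (1 `^ beta)); last by rewrite powR1.
  rewrite over_sinhE//; apply: ge0_ler_powR; rewrite ?nnegrE ?(ltW beta_gt0)//.
    by rewrite divr_ge0// ltW.
  by rewrite ler_pdivrMr// mul1r shc_ge// ltW.
have e1 : expR (- (4^-1 * r * over_tanh (t * nrm mu))) <= expR (- (4^-1 * r)).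
  rewrite ler_expR lerN2 -[leLHS]mulr1 ler_wpM2l ?mulr_ge0//.
  have t1 : t * t^-1 = 1 by rewrite mulfV// gt_eqF.
  rewrite over_tanhE// -[leLHS]t1.
  by rewrite ler_wpM2l ?cosh_shc_ge// ltW.
have E : C * decay mu * (d * expR (- (4^-1 * y ^+ 2))) * gauss 4^-1 z =
    1 * expR (- (4^-1 * r)) * d * (C * decay mu).
  rewrite /r mulrDr opprD expRD /gauss; ring.
rewrite E normrM [`|_ * d|]normrM [`|_ * expR _|]normrM (ger0_norm d0).
rewrite [`|expR _|]ger0_norm ?expR_ge0// [`|_ `^ _|]ger0_norm ?powR_ge0//.
by rewrite ler_pM ?hC// ?mulr_ge0 ?powR_ge0 ?expR_ge0// ler_wpM2r// ler_pM ?powR_ge0 ?expR_ge0.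
Qed.

Lemma measurable_over_sinh_nrm t : 0 < t ->
  measurable_fun setT (fun mu => over_sinh (t * nrm mu)).
Proof.
move=> t0; rewrite (_ : (fun _ => _) = (fun mu => t / shc t (nrm mu))); last first.
  by apply/funext => mu; rewrite over_sinhE.
apply: measurable_funM => //; apply: measurable_fun_inv; apply: measurable_fun_shc.
exact: measurable_nrm.
Qed.

Lemma measurable_over_tanh_nrm t : 0 < t ->
  measurable_fun setT (fun mu => over_tanh (t * nrm mu)).
Proof.
move=> t0; rewrite (_ : (fun _ => _) = (fun mu => t * coth_symbol t mu)); last first.
  by apply/funext => mu; rewrite over_tanhE.
by apply: measurable_funM => //; exact: measurable_coth_symbol.
Qed.

Lemma measurable_rescaled_integrand t th : 0 < t -> measurable_fun setT (rescaled_integrand t th).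
Proof.
move=> t0; apply: measurable_funM; last first.
  apply: (@measurable_vfourier _ _ _ _ hS _ _ _ _
    (fun w : k.-tuple T * T * m.-tuple T => affine (Num.sqrt t) (fun=> 0) w.2)
    (fun w => w.1.1) (fun w => (Num.sqrt t * w.1.2 : T)) Su).
  - by apply: (measurableT_comp (measurable_affine_tuple _ _)).
  - by apply: measurableT_comp.
  - by apply: measurable_funM => //; apply: measurableT_comp.
apply: measurable_funM; last by apply: (measurableT_comp (measurable_ydens s)); apply: measurableT_comp.
apply: measurable_funM.
  apply: (measurableT_comp (measurable_powR beta)).
  by apply: (measurableT_comp (measurable_over_sinh_nrm t0)); apply: measurableT_comp.
apply: measurable_fun_expR; apply: measurable_funN; apply: measurable_funM.
  apply: measurable_funM => //; apply: measurable_funD.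
    by apply: measurable_funX; apply: (measurableT_comp measurable_nrm).
  by apply: measurable_funX; apply: measurableT_comp.
by apply: (measurableT_comp (measurable_over_tanh_nrm t0)); apply: measurableT_comp.
Qed.

Lemma modulus_scale t th mu y z : 0 < t ->
  c0 * modulus beta t (rv_of (affine (Num.sqrt t) (fun=> 0) z), 0, Num.sqrt t * y) mu *
    ydens s (Num.sqrt t * y) *
    vfourier u th (affine (Num.sqrt t) (fun=> 0) z) mu (Num.sqrt t * y) =
  c0 / (Num.sqrt t * Num.sqrt t ^+ m) * rescaled_integrand t th (mu, y, z).
Proof.
move=> t0; have r0 : 0 < Num.sqrt t by rewrite sqrtr_gt0.
rewrite ydens_scale// /rescaled_integrand -[(_, z).2]/z -[(_, z).1.1]/mu -[(_, z).1.2]/y.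
set V := vfourier _ _ _ _ _.
rewrite over_sinh_weight// over_tanhE// -/beta.
have -> : modulus beta t (rv_of (affine (Num.sqrt t) (fun=> 0) z), 0, Num.sqrt t * y) mu =
   weight beta t mu * expR (- (4^-1 * (nrm z ^+ 2 + y ^+ 2) * (t * (cosh (t * nrm mu) / shc t (nrm mu))))).
  rewrite /modulus; congr (_ * expR (- _)); rewrite /sqr_radius.
  rewrite -[enorm _]/(nrm (affine (Num.sqrt t) (fun=> 0) z)) -[(_, _ * y).2]/(Num.sqrt t * y).
  rewrite nrm_scale ?(ltW r0)// !exprMn sqr_sqrtr ?(ltW t0)// /coth_symbol.
  by move: (_ / shc _ _) => a; ring.
have E : Num.sqrt t `^ (1 - 2 * s) * (Num.sqrt t * Num.sqrt t ^+ m) = t `^ beta.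
  rewrite -[X in _ * (X * _)](powRr1 (ltW r0)) -powR_mulrn ?(ltW r0)//.
  rewrite -!powRD; last 2 first.
  - by rewrite (gt_eqF r0) implybT.
  - by rewrite (gt_eqF r0) implybT.
  by rewrite -(powR12_sqrt (ltW t0)) -powRrM; congr (_ `^ _); rewrite /beta; field.
have n0 : Num.sqrt t * Num.sqrt t ^+ m != 0 by rewrite gt_eqF// mulr_gt0// exprn_gt0.
rewrite -E; move: (Num.sqrt t * _ ^+ m) n0 => q n0.
by field.
Qed.

Local Notation gy := (fun y : R => ydens s y * expR (- (4^-1 * y ^+ 2))).
Let Gz : R := \int[rn m]_z gauss 4^-1 z.

Let integrable_gy : leb.-integrable setT (EFin \o gy).
Proof. exact: integrable_ydens_gauss. Qed.

Lemma integrable_rescaled_integrand t th mu y : 0 < t ->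
  (rn m).-integrable setT (fun z => (rescaled_integrand t th (mu, y, z))%:E).
Proof.
move=> t0; have [C C0 hC] := rescaled_integrand_le.
apply: (@integrable_dominated _ _ _ _ _ _
  (fun z => C * decay mu * gy y * gauss 4^-1 z)) => //.
- by apply: (measurableT_comp (measurable_rescaled_integrand th t0)).
- by apply: integrable_mull => //; exact: integrable_gauss.
- by move=> z _; exact: hC.
Qed.

Definition rescaled_slab t th (w : k.-tuple T * T) : R := \int[rn m]_z rescaled_integrand t th (w, z).

Lemma measurable_rescaled_slab t th : 0 < t -> measurable_fun setT (rescaled_slab t th).
Proof.
by move=> t0; apply: measurable_Rintegral_section; exact: measurable_rescaled_integrand.
Qed.

Lemma rescaled_slab_le : exists2 C, 0 <= C & forall t th mu y, 0 < t ->
  `|rescaled_slab t th (mu, y)| <= C * decay mu * gy y.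
Proof.
have [C C0 hC] := rescaled_integrand_le; have G0 : 0 <= Gz.
  by apply: Rintegral_ge0 => z _; exact: expR_ge0.
exists (C * Gz); first exact: mulr_ge0.
move=> t th mu y t0.
have -> : C * Gz * decay mu * gy y = \int[rn m]_z (C * decay mu * gy y * gauss 4^-1 z).
  by rewrite RintegralZl//; [rewrite /Gz; ring|exact: integrable_gauss].
apply: norm_Rintegral_le => //.
- by apply: (measurableT_comp (measurable_rescaled_integrand th t0)).
- by apply: integrable_mull => //; exact: integrable_gauss.
- by move=> z; exact: hC.
Qed.

Lemma rescaled_integrand_cvg th mu y z : rescaled_integrand t th (mu, y, z) @[t --> 0^'+] -->
  gy y * vfourier u th [tuple of nseq m 0] mu 0 * gauss 4^-1 z.
Proof.
have -> : gy y * vfourier u th [tuple of nseq m 0] mu 0 * gauss 4^-1 z =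
   1 `^ beta * expR (- (4^-1 * (nrm z ^+ 2 + y ^+ 2) * 1)) * ydens s y *
   vfourier u th [tuple of nseq m 0] mu 0.
  by rewrite powR1 mulr1 mulrDr opprD expRD /gauss; ring.
apply: cvgM; last exact: (vfourier_cvg0 hS).
apply: cvgMr_tmp; apply: cvgM.
  apply: (@cvg_comp _ _ _ (fun t : R => over_sinh (t * nrm mu)) (fun x : R => x `^ beta)
    _ (nbhs (1 : R))); first exact: over_sinh_cvg1.
  have [/derivable1_diffP/differentiable_continuous + _] := is_derive1_powR beta (@ltr01 R).
  exact.
apply: (@cvg_comp _ _ _ (fun t : R => - (4^-1 * (nrm z ^+ 2 + y ^+ 2) * over_tanh (t * nrm mu)))
  (@expR R) _ (nbhs (- (4^-1 * (nrm z ^+ 2 + y ^+ 2) * 1) : R))); last exact: continuous_expR.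
by apply: cvgN; apply: cvgMl_tmp; exact: over_tanh_cvg1.
Qed.

Lemma rescaled_slab_cvg th w : rescaled_slab t th w @[t --> 0^'+] -->
  Gz * gy w.2 * vfourier u th [tuple of nseq m 0] w.1 0.
Proof.
case: w => mu y; have [C C0 hC] := rescaled_integrand_le.
rewrite -[(mu, y).1]/mu -[(mu, y).2]/y.
have -> : Gz * gy y * vfourier u th [tuple of nseq m 0] mu 0 =
   \int[rn m]_z (gy y * vfourier u th [tuple of nseq m 0] mu 0 * gauss 4^-1 z).
  by rewrite RintegralZl//; [rewrite /Gz; ring|exact: integrable_gauss].
apply: (@dominated_Rintegral_cvg_right _ _ _ _ _ (fun t z => rescaled_integrand t th (mu, y, z)) 0 _
  (fun z => C * decay mu * gy y * gauss 4^-1 z)) => //.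
- by move=> t t0; apply: (measurableT_comp (measurable_rescaled_integrand th t0)).
- by move=> z _; exact: rescaled_integrand_cvg.
- by apply: integrable_mull => //; exact: integrable_gauss.
- by move=> t z t0 _; exact: hC.
Qed.

Lemma Rintegral_rescaled t th mu : 0 < t ->
  \int[leb]_y \int[rn m]_z
    (c0 * modulus beta t (rv_of z, 0, y) mu * ydens s y * vfourier u th z mu y) =
  c0 * \int[leb]_y rescaled_slab t th (mu, y).
Proof.
move=> t0; set r := Num.sqrt t; have r0 : 0 < r by rewrite sqrtr_gt0.
pose f y z := c0 * modulus beta t (rv_of z, 0, y) mu * ydens s y * vfourier u th z mu y.
have fi y : (rn m).-integrable setT (EFin \o f y).
  have i3 : (rn m \x rn k)%E.-integrable setT (EFin \o (fun q => joint_integrand t th ((q, y), mu))).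
    exact: integrable_joint_slab.
  have := integrable_Rintegral1 i3 (fun z => integrable_joint_vertical th mu y z t0).
  by apply: eq_integrable => // z _; rewrite /comp (Rintegral_joint_vertical th mu y z t0).
have mf : measurable_fun setT (fun w : T * m.-tuple T => f w.1 w.2).
  apply: measurable_funM; last first.
    exact: (@measurable_vfourier _ _ _ _ hS _ _ _ _ snd (fun=> mu) fst Su).
  apply: measurable_funM; last exact: (measurableT_comp (measurable_ydens s)).
  apply: measurable_funM => //; apply: measurable_funM => //.
  apply: measurable_fun_expR; apply: measurable_funN; apply: measurable_funM => //.
  apply: measurable_funM => //.
  apply: (@measurable_funD _ _ _ _ (fun w : T * m.-tuple T => nrm w.2 ^+ 2) (fun w => w.1 ^+ 2)).
    by apply: measurable_funX; exact: (measurableT_comp measurable_nrm).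
  by apply: measurable_funX; exact: measurable_fst.
rewrite -[LHS]/(\int[leb]_y \int[rn m]_z f y z).
have [C C0 hC] := rescaled_slab_le.
have i2 : leb.-integrable setT (EFin \o (fun y => rescaled_slab t th (mu, y))).
  apply: (@integrable_dominated _ _ _ _ _ _ (fun y => C * decay mu * gy y)) => //.
  - by apply: (measurableT_comp (measurable_rescaled_slab th t0)).
  - exact: integrable_mull.
  - by move=> y _; exact: hC.
rewrite (Rintegral_affine 0 r0 (measurable_Rintegral_section (rn m) mf)).
transitivity (r * \int[leb]_y (c0 / r * rescaled_slab t th (mu, y))).
  congr (_ * _); apply: eq_Rintegral => y _.
  rewrite (Rintegral_rn_affine (fun=> 0) r0 (fi _)) addr0 /f.
  under eq_Rintegral do rewrite modulus_scale//.
  rewrite RintegralZl//; last exact: integrable_rescaled_integrand.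
  rewrite -/r mulrA /rescaled_slab; congr (_ * _).
  by field; rewrite (gt_eqF r0) expf_neq0// gt_eqF.
rewrite RintegralZl// mulrA; congr (_ * _).
by field; rewrite gt_eqF.
Qed.

Lemma wave_normalisation (v : R) :
  c0 * (Gz * (4 * pi) `^ (1 - s) * ((2 * pi) ^+ k * v)) = v.
Proof.
have p0 : 0 < 4 * pi :> R by rewrite mulr_gt0 ?pi_gt0.
have q0 : 2 * Num.sqrt pi = (4 * pi) `^ 2^-1 :> R.
  rewrite powR12_sqrt ?ltW// sqrtrM// (_ : 4 = 2 ^+ 2 :> R); last by ring.
  by rewrite sqrtr_sqr ger0_norm.
rewrite /Gz Rintegral_gauss4 q0 -[(_ `^ _) ^+ m]powR_mulrn ?powR_ge0// -powRrM /wave_const.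
have E : (4 * pi) `^ (m%:R / 2 + 1 - s + k%:R) =
    (4 * pi) `^ (2^-1 * m%:R) * (4 * pi) `^ (1 - s) * (4 * pi) ^+ k :> R.
  rewrite -(powR_mulrn _ (ltW p0)) -!powRD; last 2 first.
  - by rewrite (gt_eqF p0) implybT.
  - by rewrite (gt_eqF p0) implybT.
  by congr (_ `^ _); field.
have n1 : (4 * pi) `^ (2^-1 * m%:R) != 0 :> R by rewrite gt_eqF ?powR_gt0.
have n2 : (4 * pi) `^ (1 - s) != 0 :> R by rewrite gt_eqF ?powR_gt0.
have n3 : (4 * pi) ^+ k != 0 :> R by rewrite gt_eqF ?exprn_gt0.
have E2 : 2 ^+ k * (2 * pi) ^+ k = (4 * pi) ^+ k :> R.
  by rewrite -exprMn mulrA; congr ((_ * _) ^+ _); ring.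
rewrite E; move: n1 n2 n3 E2; move: (_ `^ (2^-1 * _)) (_ `^ (1 - s)) ((4 * pi) ^+ k) => a b c n1 n2 n3 E2.
have -> : 2 ^+ k / (a * b * c) * (a * b * ((2 * pi) ^+ k * v)) =
   (2 ^+ k * (2 * pi) ^+ k) / c * v by field; rewrite n1 n2 n3.
by rewrite E2 divff// mul1r.
Qed.

Lemma waveint_initial_cvg th :
  \int[point_measure]_p (waveint beta t (fun=> c0) th (pt_of p) * u (pt_of p) * ydens s p.2)
    @[t --> 0^'+] --> cos th * u (0, 0, 0).
Proof.
pose V0 mu := vfourier u th [tuple of nseq m 0] mu 0.
have V0i : (rn k).-integrable setT (EFin \o V0) by exact: (integrable_vfourier hS).
have [C C0 hC] := rescaled_slab_le.
have h : c0 * \int[rn k]_mu \int[leb]_y rescaled_slab t th (mu, y) @[t --> 0^'+] -->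
    c0 * \int[rn k]_mu \int[leb]_y (Gz * gy y * V0 mu).
  apply: cvgMl_tmp.
  apply: (@dominated_iterated_cvg _ _ _ _ _ (rn k) leb (fun t => rescaled_slab t th)
    (fun w => Gz * gy w.2 * V0 w.1) 0 (fun mu => C * decay mu) gy) => //.
  - by move=> t t0; exact: measurable_rescaled_slab.
  - by move=> w; exact: rescaled_slab_cvg.
  - by apply: integrable_mull => //; exact: integrable_decay.
  - by move=> t mu y t0; exact: hC.
have E : c0 * \int[rn k]_mu \int[leb]_y (Gz * gy y * V0 mu) = cos th * u (0, 0, 0).
  have Ey mu : \int[leb]_y (Gz * gy y * V0 mu) = Gz * (4 * pi) `^ (1 - s) * V0 mu.
    have -> : \int[leb]_y (Gz * gy y * V0 mu) = \int[leb]_y (Gz * V0 mu * gy y).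
      by apply: eq_Rintegral => y _; ring.
    rewrite RintegralZl//.
    have -> : \int[leb]_y gy y = (4 * pi) `^ (1 - s).
      rewrite /Rintegral (_ : (\int[leb]_y (gy y)%:E)%E = ((4 * pi) `^ (1 - s))%:E)//.
      rewrite -(integral_ydens_gauss s_gt0 s_lt1); apply: eq_integral => y _.
      by congr (_ * expR (- _))%:E; exact: mulrC.
    by ring.
  under eq_Rintegral do rewrite Ey.
  rewrite RintegralZl// (Rintegral_vfourier hS)// wave_normalisation.
  congr (_ * u (_, _, _)); apply/rowP => i.
  by rewrite !mxE (tnth_nth 0) nth_nseq if_same.
rewrite -E; apply: cvg_trans h; apply: near_eq_cvg; near=> t.
have t0 : 0 < t by [].
rewrite Rintegral_waveint_vfourier//.
have i2 : (rn k).-integrable setT (EFin \o (fun mu => \int[leb]_y rescaled_slab t th (mu, y))).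
  apply: (@integrable_dominated _ _ _ _ _ _ (fun mu => (\int[leb]_y gy y) * (C * decay mu))) => //.
  - by apply: measurable_Rintegral_section; exact: measurable_rescaled_slab.
  - by do 2 apply: integrable_mull => //; exact: integrable_decay.
  - move=> mu _; rewrite mulrC -RintegralZl//; apply: norm_Rintegral_le => //.
    + by apply: (measurableT_comp (measurable_rescaled_slab th t0)).
    + exact: integrable_mull.
    + by move=> y; exact: hC.
rewrite -RintegralZl//; apply: eq_Rintegral => mu _.
by rewrite Rintegral_rescaled.
Unshelve. all: by end_near. Qed.

Lemma integrable_waveint t th : 0 < t -> pt_measure.-integrable setT
  (fun p => (waveint beta t (fun=> c0) th (pt_of p) * u (pt_of p) * ydens s p.2)%:E).
Proof.
move=> t0; have := integrable_Rintegral1 (integrable_joint th t0)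
  (fun p => integrable_joint_frequency th p t0).
apply: eq_integrable => // p _; congr EFin; rewrite -mulrA mulrC /waveint.
rewrite -RintegralZl//; last exact: (integrable_wave beta_gt0 th (pt_of p) t0 (@tame_cst R k c0)).
by apply: eq_Rintegral => mu _; rewrite /joint_integrand -[(_, mu).2]/mu -[(p, mu).1]/p -mulrA mulrC.
Qed.

End InitialLimit.

Section InitialDirac.
Context {R : realType} {m k : nat}.
Local Notation T := (measurableTypeR R).
Local Notation pt := (pt R m k).
Local Notation X := (m.-tuple T * k.-tuple T * T)%type.
Variable s : R.
Hypotheses (s_gt0 : 0 < s) (s_lt1 : s < 1).
Let beta : R := m%:R / 2 + 1 - s.
Local Notation c0 := (@wave_const R m k s).
Local Notation point_measure := (@point_measure R m k).

Let beta_gt0 : 0 < beta.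
Proof. by rewrite /beta -addrA ltr_wpDl ?divr_ge0// subr_gt0. Qed.

Lemma measurable_halfspace : measurable (@halfspace R m k).
Proof.
rewrite (_ : halfspace = setT `&` (snd : X -> T) @^-1` [set` `]0, +oo[]).
  have ms : measurable_fun setT (snd : X -> T) by exact: measurable_snd.
  by apply: ms => //; exact: measurable_itv.
by rewrite setTI; apply/seteqP; split => p /=; rewrite /halfspace/= in_itv/= andbT.
Qed.

Variables (phi psi : pt -> R[i]).
Hypotheses (psiS : schwartz psi) (phiE : forall x : pt, 0 <= x.2 -> phi x = psi x).

Let Re0 : pt -> R := @complex.Re R \o psi.
Let Im0 : pt -> R := @complex.Im R \o psi.

Let SRe : partials psi Re0. Proof. by exists [::]; left. Qed.
Let SIm : partials psi Im0. Proof. by exists [::]; right. Qed.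
Let hS := vertical_schwartz_partials psiS.

Definition tested_wave (th : R) (u : pt -> R) (t : R) (p : X) : R :=
  waveint beta t (fun=> c0) th (pt_of p) * u (pt_of p) * ydens s p.2.

Let integrable_tested th u t : partials psi u -> 0 < t ->
  point_measure.-integrable setT (EFin \o tested_wave th u t).
Proof. by move=> Su t0; exact: (integrable_waveint hS s_gt0 s_lt1 Su th t0). Qed.

Let tested_cvg th u : partials psi u ->
  \int[point_measure]_p tested_wave th u t p @[t --> 0^'+] --> cos th * u (0, 0, 0).
Proof. by move=> Su; exact: (waveint_initial_cvg hS s_gt0 s_lt1 Su). Qed.

Lemma tested_integrandE t p : 0 < t -> 0 < p.2 ->
  tested_integrand s (q_kernel s) phi t (pt_of p) =
  (tested_wave 0 Re0 t p - tested_wave (pi / 2) Im0 t p) +i*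
  (tested_wave 0 Im0 t p + tested_wave (pi / 2) Re0 t p).
Proof.
move=> t0 p0; rewrite /tested_integrand (q_kernelE beta_gt0)// phiE; last exact: ltW.
have -> : mu_density s (pt_of p) = ydens s p.2 by rewrite /ydens p0.
rewrite /tested_wave /Re0 /Im0 /cwave /comp; case: (psi _) => a b.
rewrite mulrC mulrC; apply/eqP; rewrite eq_complex/=.
by apply/andP; split; apply/eqP; ring.
Qed.

Lemma integrable_halfspace (f : X -> R) (g : X -> R) :
  (forall p, 0 < p.2 -> f p = g p) -> (forall p, ~~ (0 < p.2) -> g p = 0) ->
  point_measure.-integrable setT (EFin \o g) ->
  pt_measure.-integrable halfspace (EFin \o f) /\
  \int[pt_measure]_(p in halfspace) f p = \int[point_measure]_p g p.
Proof.
move=> fg g0 gi; split.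
  apply/(integrable_mkcond _ measurable_halfspace).
  apply: eq_integrable gi => // p _; rewrite patchE /comp.
  case: ifPn => [|/negP pn]; first by rewrite inE => /fg ->.
  by rewrite g0//; apply/negP => p0; apply: pn; rewrite inE.
rewrite Rintegral_mkcond; apply: eq_Rintegral => p _; rewrite patchE.
case: ifPn => [|/negP pn]; first by rewrite inE => /fg ->.
by rewrite g0//; apply/negP => p0; apply: pn; rewrite inE.
Qed.

Lemma tested_wave0 th u t p : ~~ (0 < p.2) -> tested_wave th u t p = 0.
Proof. by move=> /negPf p0; rewrite /tested_wave /ydens p0 mulr0. Qed.

Let part_Re t : 0 < t ->
  pt_measure.-integrable halfspace
    (EFin \o (@complex.Re R \o (tested_integrand s (q_kernel s) phi t \o @pt_of R m k))) /\
  \int[pt_measure]_(p in halfspace)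
    complex.Re ((tested_integrand s (q_kernel s) phi t \o @pt_of R m k) p) =
  \int[point_measure]_p tested_wave 0 Re0 t p - \int[point_measure]_p tested_wave (pi / 2) Im0 t p.
Proof.
move=> t0; have i1 := integrable_tested 0 SRe t0; have i2 := integrable_tested (pi / 2) SIm t0.
rewrite -RintegralB//; apply: integrable_halfspace.
- by move=> p p0; rewrite /comp tested_integrandE.
- by move=> p p0; rewrite !tested_wave0// subr0.
- exact: (integrableB measurableT i1 i2).
Qed.

Let part_Im t : 0 < t ->
  pt_measure.-integrable halfspace
    (EFin \o (@complex.Im R \o (tested_integrand s (q_kernel s) phi t \o @pt_of R m k))) /\
  \int[pt_measure]_(p in halfspace)
    complex.Im ((tested_integrand s (q_kernel s) phi t \o @pt_of R m k) p) =
  \int[point_measure]_p tested_wave 0 Im0 t p + \int[point_measure]_p tested_wave (pi / 2) Re0 t p.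
Proof.
move=> t0; have i1 := integrable_tested 0 SIm t0; have i2 := integrable_tested (pi / 2) SRe t0.
rewrite -RintegralD//; apply: integrable_halfspace.
- by move=> p p0; rewrite /comp tested_integrandE.
- by move=> p p0; rewrite !tested_wave0// addr0.
- exact: (integrable_add measurableT i1 i2).
Qed.

Lemma q_kernel_initial :
  (forall t, 0 < t ->
     cintegrable pt_measure halfspace (tested_integrand s (q_kernel s) phi t \o @pt_of R m k)) /\
  let I t := cintegral pt_measure halfspace
    (tested_integrand s (q_kernel s) phi t \o @pt_of R m k) in
  complex.Re (I t) @[t --> 0^'+] --> complex.Re (phi (0, 0, 0)) /\
  complex.Im (I t) @[t --> 0^'+] --> complex.Im (phi (0, 0, 0)).
Proof.
split; first by move=> t t0; split; [have [] := part_Re t0|have [] := part_Im t0].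
rewrite phiE//=; split.
- have h : \int[point_measure]_p tested_wave 0 Re0 t p - \int[point_measure]_p tested_wave (pi / 2) Im0 t p
      @[t --> 0^'+] --> cos 0 * Re0 (0, 0, 0) - cos (pi / 2) * Im0 (0, 0, 0).
    by apply: cvgB; exact: tested_cvg.
  rewrite cos0 cos_pihalf mul1r mul0r subr0 in h.
  apply: cvg_trans h; apply: near_eq_cvg; near=> t.
  by have [|_ ->] := @part_Re t.
- have h : \int[point_measure]_p tested_wave 0 Im0 t p + \int[point_measure]_p tested_wave (pi / 2) Re0 t p
      @[t --> 0^'+] --> cos 0 * Im0 (0, 0, 0) + cos (pi / 2) * Re0 (0, 0, 0).
    by apply: cvgD; exact: tested_cvg.
  rewrite cos0 cos_pihalf mul1r mul0r addr0 in h.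
  apply: cvg_trans h; apply: near_eq_cvg; near=> t.
  by have [|_ ->] := @part_Im t.
Unshelve. all: by end_near. Qed.

End InitialDirac.

Theorem theorem4p1 (R : realType) (g : vectType R)
    (br : {bilinear g -> g -> g}) (ip : {dot g for idfun})
    (V1 V2 : {vspace g}) (hG : carnot_step_two br V1 V2)
    (m k : nat) (e : m.-tuple (subvs_of V1)) (eps : k.-tuple (subvs_of V2))
    (he : orthonormal_basis ip e) (heps : orthonormal_basis ip eps)
    (J : subvs_of V2 -> 'End(subvs_of V1)) (hJ : kaplan_map br ip J)
    (hH : heisenberg_type ip J) (s : R) (s_gt0 : 0 < s) (s_lt1 : s < 1) :
  [/\ forall (t : R) (x : pt R m k), 0 < t ->
        cintegrable (lebesgue_rn k) setT
          (kernel_integrand s t x \o @rv_of R k),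
      solves_extension_heat ip J e eps s (q_kernel s)
    & initial_dirac (m := m) (k := k) s (q_kernel s)].
Proof.
have beta_gt0 : 0 < m%:R / 2 + 1 - s by rewrite -addrA ltr_wpDl ?divr_ge0// subr_gt0.
have [[br_alt _] _ _ _] := hG.
split.
- by move=> t x t0; exact: kernel_cintegrable.
- exact: (q_kernel_solves br_alt hJ hH he heps s_lt1).
- by move=> phi [psi psiS phiE]; exact: (q_kernel_initial s_gt0 s_lt1 psiS phiE).
Qed.
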